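(* Let $b=\rho\,\Phi\in C^1_\sharp(Y_d)^d$, where $\rho\in C^1_\sharp(Y_d)$ is non negative and not identically zero, and $\Phi\in C^1_\sharp(Y_d)^d$ is a non vanishing vector field (i.e. $\Phi(x)\neq0_{\mathbb{R}^d}$ for every $x$). Assume that there exists a sequence $(\rho_n)_{n\in\mathbb{N}}$ in $C^1_\sharp(Y_d)$ such that (i) for any $n\in\mathbb{N}$, $\rho\le\rho_n$ and $\rho_n>0$ in $Y_d$, and $(\rho_n)_{n\in\mathbb{N}}$ converges uniformly to $\rho$ on $Y_d$; (ii) for any $n\in\mathbb{N}$, $\mathsf{C}_{b_n}=\{\zeta_n\}$ for some $\zeta_n\in\mathbb{R}^d$, where $b_n:=\rho_n\,\Phi$. Also assume that there exists a positive function $\sigma\in C^1_\sharp(Y_d)$ such that $\sigma\,\Phi$ is divergence free in $\mathbb{R}^d$, and that $\rho$ vanishes in $Y_d$ (i.e. at some point of $Y_d$). Then the following alternative holds, involving the harmonic mean $\underline{\rho/\sigma}$ of $\rho/\sigma$: - If $\underline{\rho/\sigma}=0$, then the flow $X$ associated with $b$ satisfies $$\forall\,x\in Y_d,\quad\lim_{t\to\infty}\frac{X(t,x)}{t}=0_{\mathbb{R}^d}.$$ - If $\underline{\rho/\sigma}>0$, then $$\mathsf{C}_b=[0_{\mathbb{R}^d},\zeta]\quad\text{with}\quad\zeta:=\underline{\rho/\sigma}\int_{Y_d}\Phi(y)\,\sigma(y)\,dy.$$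
   Context: $Y_d=\mathbb{R}^d/\mathbb{Z}^d$ is the $d$-dimensional torus, identified with $[0,1)^d$. $C^k_\sharp(Y_d)$ is the space of real-valued $\mathbb{Z}^d$-periodic functions in $C^k(\mathbb{R}^d)$. For a non negative $a\in L^1_\sharp(Y_d)$ (periodic, integrable on $Y_d$), the harmonic mean is $\underline{a}:=\left(\int_{Y_d}\frac{dy}{a(y)}\right)^{-1}$, with value $0$ when the integral is $+\infty$. For $b\in C^1_\sharp(Y_d)^d$, the flow $X:\mathbb{R}\times\mathbb{R}^d\to\mathbb{R}^d$ associated with $b$ is the solution of $\partial_t X(t,x)=b(X(t,x))$, $t\in\mathbb{R}$, $X(0,x)=x$; it satisfies $X(t,x+\kappa)=X(t,x)+\kappa$ for $\kappa\in\mathbb{Z}^d$, so it induces a flow on $Y_d$. A probability measure $\mu$ on $Y_d$ is invariant for the flow $X$ if $\int_{Y_d}\psi(X(t,y))\,d\mu(y)=\int_{Y_d}\psi(y)\,d\mu(y)$ for all $t\in\mathbb{R}$ and $\psi\in C^0_\sharp(Y_d)$; $\mathscr{I}_b$ denotes the set of these invariant probability measures. The (Herman) rotation set is $\mathsf{C}_b:=\left\{\int_{Y_d}b(y)\,d\mu(y):\mu\in\mathscr{I}_b\right\}\subset\mathbb{R}^d$. $[0_{\mathbb{R}^d},\zeta]$ is the closed line segment. *)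

(* Defs.v *)
From HB Require Import structures.
From mathcomp Require Import all_boot all_order all_algebra.
From mathcomp Require Import all_classical all_reals all_analysis.

Set Implicit Arguments.
Unset Strict Implicit.
Unset Printing Implicit Defensive.

Import Order.TTheory GRing.Theory Num.Theory.
Import numFieldNormedType.Exports.

Local Open Scope classical_set_scope.
Local Open Scope ring_scope.

(* Vectors of R^d are rows. Functions and fields on the torus are Z^d-periodic
   functions on R^d; measures on the torus, identified with [0,1)^d, are Borel
   measures on R^d carried by [0,1)^d. *)

Section Regularity.
Context {R : realType} {d : nat}.

Definition Zd_periodic {T : Type} (f : 'rV[R]_d -> T) :=
  forall (x : 'rV[R]_d) (k : 'rV[int]_d), f (x + map_mx intr k) = f x.

Definition class_C1 {W : normedModType R} (f : 'rV[R]_d -> W) :=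
  (forall x, differentiable f x) /\
  (forall v : 'rV[R]_d, continuous ('D_v f)).

Definition periodic_C0 (f : 'rV[R]_d -> R) := Zd_periodic f /\ continuous f.

Definition periodic_C1 {W : normedModType R} (f : 'rV[R]_d -> W) :=
  Zd_periodic f /\ class_C1 f.

Definition divergence (F : 'rV[R]_d -> 'rV[R]_d) (x : 'rV[R]_d) : R :=
  \sum_(i < d) 'D_(delta_mx 0 i) (fun y => F y 0 i) x.

End Regularity.

Notation borel_rV R d := (g_sigma_algebraType (@open 'rV[R]_d)).

Definition unit_cell (R : realType) (d : nat) : set 'rV[R]_d :=
  [set x | forall i, 0 <= x 0 i < 1].
Arguments unit_cell : clear implicits.

Section LebesgueTorus.
Context {R : realType}.

Definition cons_pair n (p : measurableTypeR R * n.-tuple (measurableTypeR R)) :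
    n.+1.-tuple (measurableTypeR R) := [tuple of p.1 :: p.2].

Lemma measurable_cons_pair n : measurable_fun [set: _] (@cons_pair n).
Proof. by apply: measurable_cons. Qed.

HB.instance Definition _ n :=
  isMeasurableFun.Build _ _ _ _ (@cons_pair n) (@measurable_cons_pair n).

(* The d-fold product of the uniform probability on [0,1]. *)
Fixpoint uniform_tuple (d : nat) :
    probability (d.-tuple (measurableTypeR R)) R :=
  if d is n.+1 then
    distribution (uniform_prob (@ltr01 R) \x uniform_tuple n)%E (@cons_pair n)
  else \d_ [tuple].

Definition row_of_tuple (d : nat) (t : d.-tuple (measurableTypeR R)) :
  borel_rV R d := \row_i tnth t i.

(* Every open set of R^d is a countable union of open boxes with rational
   vertices. *)
Lemma measurable_row_of_tuple (d : nat) :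
  measurable_fun [set: _] (@row_of_tuple d).
Proof.
apply: (@measurability _ _ _ (borel_rV R d) _ _ (@open 'rV[R]_d)) => //.
move=> _ [U oU <-]; rewrite setTI.
pose box (q : {ffun 'I_d -> rat * rat}) : set 'rV[R]_d :=
  [set v | forall i, ratr (q i).1 < v 0 i < ratr (q i).2].
have -> : @row_of_tuple d @^-1` U =
    \bigcup_(q in [set q | box q `<=` U]) (@row_of_tuple d @^-1` box q).
  rewrite -preimage_bigcup; congr (_ @^-1` _); apply/seteqP; split; last first.
    by move=> v [q /= qU qv]; exact: qU.
  move=> v Uv; have /nbhs_ballP[e /= e0 veU] : nbhs v U.
    by move: oU; rewrite openE; exact.
  have /choice[q qP] (i : 'I_d) : exists p : rat * rat,
      v 0 i - e < ratr p.1 < v 0 i /\ v 0 i < ratr p.2 < v 0 i + e.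
    have [|p1 p1v] := @rat_in_itvoo R (v 0 i - e) (v 0 i).
      by rewrite ltrBlDr ltrDl.
    have [|p2 p2v] := @rat_in_itvoo R (v 0 i) (v 0 i + e); first by rewrite ltrDl.
    by exists (p1, p2); move: p1v p2v; rewrite !in_itv/=.
  exists [ffun i => q i] => /=; last first.
    by move=> i; rewrite ffunE; have [/andP[_ ->] /andP[->]] := qP i.
  move=> w qw; apply: veU; split => // j i; rewrite ord1.
  move: (qw i); rewrite ffunE => /andP[q1 q2].
  have [/andP[v1 _] /andP[_ v2]] := qP i.
  rewrite /ball/= ltr_distlC; apply/andP; split.
    exact: lt_trans q1.
  exact: lt_trans v2.
rewrite bigcup_mkcond; apply: countable_bigcupT_measurable => // q.
case: ifPn => // _.
have -> : @row_of_tuple d @^-1` box q = \bigcap_(i in [set: 'I_d])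
    ((fun t => tnth t i) @^-1` `](ratr (q i).1 : R), ratr (q i).2[).
  apply/seteqP; split => t /= tq i; have := tq i; rewrite /= in_itv/= !mxE //.
  by move=> /(_ I).
apply: fin_bigcap_measurable => [|i _]; first exact: finite_finset.
rewrite -[X in measurable X]setTI.
by apply: (@measurable_tnth _ (measurableTypeR R) d i) => //; exact: measurable_itv.
Qed.

HB.instance Definition _ d :=
  isMeasurableFun.Build _ _ _ _ (@row_of_tuple d) (@measurable_row_of_tuple d).

Definition lebesgue_torus (d : nat) : probability (borel_rV R d) R :=
  distribution (uniform_tuple d) (@row_of_tuple d).

End LebesgueTorus.

Arguments lebesgue_torus : clear implicits.

Section TorusIntegrals.
Context {R : realType} {d : nat}.

Definition vintegral (mu : probability (borel_rV R d) R)
    (F : 'rV[R]_d -> 'rV[R]_d) : 'rV[R]_d :=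
  \row_i \int[mu]_(y in unit_cell R d) F y 0 i.

(* The inverses are taken in the extended reals, where 0^-1 = +oo and
   (+oo)^-1 = 0. *)
Definition harmonic_mean_torus (a : 'rV[R]_d -> R) : R :=
  fine ((\int[lebesgue_torus R d]_(y in unit_cell R d) (a y)%:E^-1)^-1)%E.

End TorusIntegrals.

Section RotationSet.
Context {R : realType} {d : nat}.
Implicit Type b : 'rV[R]_d -> 'rV[R]_d.

Definition is_flow b (X : R -> 'rV[R]_d -> 'rV[R]_d) :=
  forall x, X 0 x = x /\
    forall t : R, is_derive t (1 : R) (fun s : R => X s x) (b (X t x)).

(* The solution of the flow equation, which exists and is unique when b is
   periodic and C^1 (Cauchy-Lipschitz); an arbitrary value otherwise. *)
Definition flow b : R -> 'rV[R]_d -> 'rV[R]_d :=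
  get [set X : R -> 'rV[R]_d -> 'rV[R]_d | is_flow b X].

Definition invariant_probability b : set (probability (borel_rV R d) R) :=
  [set mu : probability (borel_rV R d) R | mu (unit_cell R d) = 1%E /\
    forall (t : R) (psi : 'rV[R]_d -> R), periodic_C0 psi ->
      \int[mu]_(y in unit_cell R d) psi (flow b t y) =
      \int[mu]_(y in unit_cell R d) psi y].

Definition rotation_set b : set 'rV[R]_d :=
  [set vintegral mu b | mu in invariant_probability b].

End RotationSet.

(* Main.v *)
Require Import Defs.
From HB Require Import structures.
From mathcomp Require Import all_boot all_order all_algebra.
From mathcomp Require Import all_classical all_reals all_analysis.
From mathcomp Require Import measurable_realfun.
From mathcomp Require Import ring lra.

(** Write [b_ n = rho_ n Phi], let [lam] be the Lebesgue measure of the torus,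
    [v] the integral of [sigma Phi], [I_ n] that of [sigma / rho_ n], and [hm] the
    harmonic mean of [rho / sigma].

    The main tool is time change ([time_change_invariant]): if a measure is
    invariant for [w B] with [w >= 0], then, weighted by [w] and normalised, it is
    invariant for [B]. When [B] has a single rotation vector [zeta], this shows
    that the velocity of an invariant measure of [w B] is [zeta] times the
    integral of [w] ([vintegral_time_change]). It is used twice with [B = b_ n].
    Since [sigma Phi] is divergence free, [lam] is invariant for it ([liouville]),
    and [w = sigma / rho_ n] yields the rotation vector [v / I_ n] of [b_ n]. With
    [w = rho / rho_ n], which is at most [1], every rotation vector of [b] is
    [c v] with [0 <= c <= 1 / I_ n]. As [1 / I_ n] tends to [hm]
    ([harmonic_mean_cvg]), [c] can be taken with [0 <= c <= hm]
    ([rotation_set_sub]).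

    If [hm = 0], the rotation set of [b] is thus reduced to [0], and a limit of
    time averages along a badly behaved orbit would be an invariant measure with
    nonzero velocity ([rotation0_mean_velocity]). If [hm > 0], then [rho] is
    positive almost everywhere and [sigma / rho] is the density of a finite
    measure, invariant for [b] as a limit of the measures of densities
    [sigma / rho_ n] ([density_invariant]); once normalised it has velocity
    [hm v], and mixing it with a Dirac mass at a zero of [rho] fills the segment
    ([rotation_set_sup]).

    All invariant measures are produced from positive linear functionals on
    continuous functions by the Riesz theorem ([torus_riesz]), proved with an
    outer measure defined from covers by functions. The flow is only ever
    estimated through the Lipschitz constant of its field; in particular
    Liouville's theorem is proved without differentiating the flow in space, by
    splitting it into shears along the axes, whose effect on integrals is
    computed line by line. *)

Set Implicit Arguments.
Unset Strict Implicit.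
Unset Printing Implicit Defensive.

Import Order.TTheory GRing.Theory Num.Theory.
Import numFieldNormedType.Exports.

Local Open Scope classical_set_scope.
Local Open Scope ring_scope.

(** * Vector-valued functions of time and differential equations *)

Section Calculus.
Context {R : realType}.
Implicit Types (f F : R -> R).

Lemma row_norm_le d (v : 'rV[R]_d) e :
  0 <= e -> (forall i, `|v 0 i| <= e) -> `|v| <= e.
Proof.
move=> e0 ve; rewrite /Num.Def.normr/= mx_normrE.
by apply: (bigmax_le _ e0) => -[i j] _ /=; rewrite ord1.
Qed.

Lemma norm_coord_le d (v : 'rV[R]_d) i : `|v 0 i| <= `|v|.
Proof.
rewrite [leRHS]/Num.Def.normr/= mx_normrE.
exact: (le_bigmax _ (fun ij : 'I_1 * 'I_d => `|v ij.1 ij.2|) (0, i)).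
Qed.

Lemma is_derive_rowP d (u : R -> 'rV[R]_d) t l :
  is_derive t (1 : R) u l <->
  forall i, is_derive t (1 : R) (fun s => u s 0 i) (l 0 i).
Proof.
split=> [[du <-] i|du].
  by split; [move/derivable_mxP : du; exact|rewrite derive_mx// mxE].
have du' : derivable u t 1.
  by apply/derivable_mxP => i j; rewrite ord1; case: (du j).
split=> //; rewrite derive_mx//; apply/rowP => i; rewrite mxE.
by case: (du i).
Qed.

Lemma is_derive_continuous (V : normedModType R) (u : R -> V) t l :
  is_derive t (1 : R) u l -> {for t, continuous u}.
Proof. by move=> [du _]; exact/differentiable_continuous/derivable1_diffP. Qed.

(** The base point of the integral has to lie to the left of both [0] and [t], so
    it moves with [t]; near a given [t] it can be replaced by a fixed one, since
    the difference of two integrals is independent of it. *)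
Lemma primitive_exists f : continuous f ->
  exists F, F 0 = 0 /\ forall t, is_derive t (1 : R) F (f t).
Proof.
move=> cf; pose mu := @lebesgue_measure R.
have intf a b : mu.-integrable `[a, b] (EFin \o f).
  apply: continuous_compact_integrable; first exact: segment_compact.
  exact: continuous_subspaceT.
pose G a t := \int[mu]_(x in `[a, t]) f x.
have Gchange (a a' t : R) : a <= a' -> a' <= t -> a' <= 0 ->
    G a t - G a 0 = G a' t - G a' 0.
  move=> aa' a't a'0.
  have GB s : a' <= s -> G a s - G a a' = G a' s.
    move=> a's; rewrite /G Rintegral_itvB ?bnd_simp//.
    rewrite Rintegral_itv_obnd_cbnd//.
    by apply: integrableS (intf a' s) => //; exact: subset_itv_oc_cc.
  rewrite -(GB t)// -(GB 0)//; lra.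
pose a_ (t : R) : R := - `|t| - 1.
exists (fun t => G (a_ t) t - G (a_ t) 0); split; first by rewrite subrr.
move=> t; pose a := - `|t| - 3.
have [dG GE] : derivable (G a) t 1 /\ 'D_1 (G a) t = f t.
  rewrite -derive1E; apply: (@continuous_FTC1_closed _ f a t (t + 1)) => //.
  - by rewrite ltrDl.
  - have := ler_norm (- t); rewrite normrN /a; lra.
  - exact: cf.
have : is_derive t (1 : R) (fun s => G a s - G a 0) (f t).
  rewrite -[f t]subr0; apply: is_deriveB.
  exact: DeriveDef.
apply: near_eq_is_derive; near=> s.
have st : `|t - s| <= 1 by near: s; apply/nbhs_ballP; exists 1 => //= r /ltW.
have := ler_normD (t - s) (- t); have := ler_normD (s - t) t.
rewrite !normrN => ? ?.
have n := ler_norm (- s); rewrite normrN in n.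
have n' := normr_ge0 s.
have h : `|t - s| = `|s - t| by rewrite distrC.
have h2 : `|s| <= `|t| + 1.
  by rewrite -[s](subrK t) addrC (le_trans (ler_normD _ _))// lerD2l -distrC.
by rewrite (@Gchange a (a_ s))// /a /a_; lra.
Unshelve. all: by end_near. Qed.

Lemma derive_le_increment f F f' F' a b : a <= b ->
  (forall t, is_derive t (1 : R) f (f' t)) ->
  (forall t, is_derive t (1 : R) F (F' t)) ->
  (forall t, a <= t <= b -> f' t <= F' t) -> f b - f a <= F b - F a.
Proof.
move=> ab df dF f'F'.
have dFf t : is_derive t (1 : R) (F - f) (F' t - f' t) by exact: is_deriveB.
have [|c cab] := MVT_segment ab (fun t _ => dFf t).
  apply: continuous_subspaceT => t; exact: is_derive_continuous (dFf t).
rewrite -subr_ge0 => E.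
have -> : F b - F a - (f b - f a) = (F - f) b - (F - f) a.
  by rewrite /= !fctE; ring.
by rewrite E mulr_ge0 ?subr_ge0// f'F'.
Qed.

Lemma derive_norm_le_increment f F f' F' a b : a <= b ->
  (forall t, is_derive t (1 : R) f (f' t)) ->
  (forall t, is_derive t (1 : R) F (F' t)) ->
  (forall t, a <= t <= b -> `|f' t| <= F' t) -> `|f b - f a| <= F b - F a.
Proof.
move=> ab df dF f'F'; rewrite ler_norml; apply/andP; split; last first.
  by apply: derive_le_increment ab df dF _ => t /f'F'; exact/le_trans/ler_norm.
rewrite lerNl -[- (f b - f a)]/(- (f b - f a)).
have -> : - (f b - f a) = (- f) b - (- f) a by rewrite /= !fctE; ring.
apply: (@derive_le_increment (- f) F (fun t => - f' t)) => //.
by move=> t /f'F'; apply: le_trans; rewrite -normrN; exact: ler_norm.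
Qed.

Lemma is_derive_expRM (c l t : R) :
  is_derive t (1 : R) (fun s => c * expR (l * s)) (c * l * expR (l * t)).
Proof.
have H : is_derive t (1 : R) (fun s => expR (l * s)) (expR (l * t) * l).
  apply: (@is_derive1_comp _ expR (fun s => l * s)).
  have : is_derive t (1 : R) (l *: (@id R)) (l *: (1 : R)) by apply: is_deriveZ.
  by rewrite [l *: 1]mulr1.
have -> : c * l * expR (l * t) = c *: (expR (l * t) * l).
  by rewrite /GRing.scale/=; ring.
exact: is_deriveZ.
Qed.

Lemma geometric_le (x b C : R) : (forall n, x <= C * 2^-1 ^+ n + b) -> x <= b.
Proof.
move=> xC; apply/ler_addgt0Pr => _/posnumP[eps].
have : (C * 2^-1 ^+ n) @[n --> \oo] --> C * 0.
  by apply: cvgMr; apply: cvg_expr; rewrite gtr0_norm// invf_lt1// ltr1n.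
rewrite mulr0 => /cvgrPdist_le/(_ _ [gt0 of eps%:num])[n _ /(_ n (leqnn n))].
rewrite sub0r normrN => h.
by rewrite (le_trans (xC n))// addrC lerD2l (le_trans (ler_norm _) h).
Qed.

Lemma geometric_cvg (V : completeNormedModType R) (a : nat -> V) (C : R) :
  (forall n, `|a n.+1 - a n| <= C * 2^-1 ^+ n) ->
  exists l, forall n, `|l - a n| <= 2 * C * 2^-1 ^+ n.
Proof.
move=> aC.
have C0 : 0 <= C.
  by have := aC 0%N; rewrite expr0 mulr1; exact: le_trans (normr_ge0 _).
have aK n k : `|a (n + k)%N - a n| <= 2 * C * 2^-1 ^+ n * (1 - 2^-1 ^+ k).
  elim: k => [|k IH]; first by rewrite addn0 subrr normr0 expr0 subrr mulr0.
  rewrite -(subrKA (a (n + k)%N)) (le_trans (ler_normD _ _))//.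
  rewrite addnS (le_trans (lerD (aC _) IH))// exprD exprS.
  rewrite le_eqVlt; apply/orP; left; apply/eqP; by field.
have aKle n k : `|a (n + k)%N - a n| <= 2 * C * 2^-1 ^+ n.
  rewrite (le_trans (aK n k))// ler_piMr// ?lerBlDr ?lerDl ?exprn_ge0//.
  by rewrite !mulr_ge0// exprn_ge0.
have ca : cvgn a.
  apply/cauchy_cvgP/cauchy_ballP => _/posnumP[eps].
  have : (2 * C * 2^-1 ^+ n) @[n --> \oo] --> 2 * C * 0.
    by apply: cvgMr; apply: cvg_expr; rewrite gtr0_norm// invf_lt1// ltr1n.
  rewrite mulr0 => /cvgrPdist_lt/(_ _ [gt0 of (eps%:num / 2)])[n _ nP].
  have {nP} h k : (n <= k)%N -> `|a k - a n| < eps%:num / 2.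
    move=> nk; rewrite -(subnKC nk); apply: le_lt_trans (aKle n _) _.
    have := nP n (leqnn n); rewrite sub0r normrN.
    exact/le_lt_trans/ler_norm.
  exists (a @` [set k | (n <= k)%N], a @` [set k | (n <= k)%N]) => /=.
    by split; exists n => //= k nk; exists k.
  move=> [x y] [[/= k nk <-] [j nj <-]]; rewrite -ball_normE/=.
  rewrite -(subrKA (a n)) (le_lt_trans (ler_normD _ _))// (splitr eps%:num).
  by rewrite ltrD ?h// distrC h.
exists (limn a) => n.
have : (`|a (k + n)%N - a n|) @[k --> \oo] --> `|limn a - a n|.
  apply: cvg_norm; apply: cvgB; last exact: cvg_cst.
  by rewrite (cvg_shiftn n a).
move=> h; rewrite -(cvg_lim _ h)//; apply: limr_le.
  by apply/cvg_ex; eexists; exact: h.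
by apply: nearW => k; rewrite addnC.
Qed.

Lemma geometric_row_cvg d (a : nat -> 'rV[R]_d) (C : R) :
  (forall n, `|a n.+1 - a n| <= C * 2^-1 ^+ n) ->
  exists l, forall n, `|l - a n| <= 2 * C * 2^-1 ^+ n.
Proof.
move=> aC.
have C0 : 0 <= C.
  by have := aC 0%N; rewrite expr0 mulr1; exact: le_trans (normr_ge0 _).
have aCi i n : `|a n.+1 0 i - a n 0 i| <= C * 2^-1 ^+ n.
  by apply: le_trans (aC n); have := norm_coord_le (a n.+1 - a n) i; rewrite !mxE.
have /choice[l lP] i :=
  @geometric_cvg R (fun n => a n 0 i) _ (fun n => aCi i n).
exists (\row_i l i) => n; apply: row_norm_le => [|i].
  by rewrite !mulr_ge0// exprn_ge0// invr_ge0.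
by rewrite !mxE; exact: lP.
Qed.

Lemma is_derive_row_comp d (u : R -> 'rV[R]_d) (g : R -> R) t l b :
  is_derive (g t) (1 : R) u l -> is_derive t (1 : R) g b ->
  is_derive t (1 : R) (fun s => u (g s)) (b *: l).
Proof.
move=> /is_derive_rowP du dg; apply/is_derive_rowP => i; rewrite mxE mulrC.
exact: (is_derive1_comp (du i) dg).
Qed.

Lemma is_derive_reflect d (u : R -> 'rV[R]_d) t l :
  is_derive (- t) (1 : R) u l -> is_derive t (1 : R) (fun s => u (- s)) (- l).
Proof.
by move=> du; rewrite -scaleN1r; exact: is_derive_row_comp du (is_deriveNid _ _).
Qed.

Lemma is_derive_translate d (u : R -> 'rV[R]_d) t c l :
  is_derive (t + c) (1 : R) u l -> is_derive t (1 : R) (fun s => u (s + c)) l.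
Proof.
move=> du; rewrite -[l]scale1r; apply: (@is_derive_row_comp _ u (shift c) _ _ _ du).
exact: is_derive_shift.
Qed.

Lemma derive_lipschitz f f' (M s t : R) :
  (forall r, is_derive r (1 : R) f (f' r)) -> (forall r, `|f' r| <= M) ->
  `|f t - f s| <= M * `|t - s|.
Proof.
move=> df f'M; wlog st : s t / s <= t.
  move=> H; case: (leP s t) => [|/ltW] st; first exact: H.
  by rewrite distrC [`|t - s|]distrC H.
rewrite [X in _ * X]ger0_norm ?subr_ge0// mulrBr.
have dM r : is_derive r (1 : R) (fun x : R => M * x) M.
  by rewrite -[M in is_derive _ _ _ M]mulr1; apply: is_deriveZ.
exact: (derive_norm_le_increment st df dM).
Qed.

Lemma row_derive_lipschitz d (u u' : R -> 'rV[R]_d) (M s t : R) :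
  (forall s, is_derive s (1 : R) u (u' s)) -> (forall s, `|u' s| <= M) ->
  `|u t - u s| <= M * `|t - s|.
Proof.
move=> du u'M; have M0 : 0 <= M by exact: le_trans (normr_ge0 _) (u'M 0).
apply: row_norm_le => [|i]; first by rewrite mulr_ge0.
have dui r := (is_derive_rowP u r (u' r)).1 (du r) i.
rewrite !mxE; apply: (derive_lipschitz _ _ dui) => r.
exact: le_trans (norm_coord_le _ _) (u'M _).
Qed.

(** Under the weight [expR (l * `|t|)] integration gains a factor [1 / l]: with
    [l] large this turns the integral form of a Lipschitz equation into a
    contraction on the whole line. *)
Lemma exp_weight_increment d (u u' : R -> 'rV[R]_d) (c l t : R) :
  0 < l -> 0 <= c ->
  (forall s, is_derive s (1 : R) u (u' s)) ->
  (forall s : R, `|u' s| <= c * expR (l * `|s|)) ->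
  `|u t - u 0| <= c / l * expR (l * `|t|).
Proof.
move=> l0 c0.
wlog t0 : u u' t / 0 <= t.
  move=> H du u'c; case: (leP 0 t) => t0; first exact: (H u u').
  rewrite -[X in u X - _](opprK t) -[X in _ - u X]oppr0 -[`|t|]normrN.
  apply: (H (fun s => u (- s)) (fun s => - u' (- s))).
  - by rewrite oppr_ge0 ltW.
  - by move=> s; apply: is_derive_reflect; exact: du.
  - by move=> s; rewrite normrN -[`|s|]normrN; exact: u'c.
move=> du u'c.
apply: row_norm_le => [|i]; first by rewrite mulr_ge0 ?expR_ge0 ?divr_ge0// ltW.
have dui s := (is_derive_rowP u s (u' s)).1 (du s) i.
rewrite !mxE [`|t|]ger0_norm//.
apply: (@le_trans _ _ (c / l * expR (l * t) - c / l * expR (l * 0))).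
  apply: (derive_norm_le_increment t0 dui (is_derive_expRM (c / l) l)).
  move=> s /andP[s0 _]; rewrite divfK ?gt_eqF//.
  by have := u'c s; rewrite ger0_norm//; apply: le_trans (norm_coord_le _ _).
by rewrite gerDl oppr_le0 mulr_ge0 ?expR_ge0// divr_ge0// ltW.
Qed.

(** Starting from the crude bound [A * expR (2 * K * `|t|)] given by [M], each
    integration of the differential inequality halves the part of the bound in
    excess of [2 * `|u 0| + e / K], which is a fixed point of this process. *)
Lemma gronwall d (u u' : R -> 'rV[R]_d) (K e M t : R) :
  0 < K -> 0 <= e ->
  (forall s, is_derive s (1 : R) u (u' s)) ->
  (forall s : R, `|u' s| <= K * `|u s| + e) ->
  (forall s : R, `|u' s| <= M) ->
  `|u t| <= (2 * `|u 0| + e / K) * expR (2 * K * `|t|).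
Proof.
move=> K0 e0 du u'K u'M.
have K2 : 0 < 2 * K by rewrite mulr_gt0.
have exp1 (s : R) : 1 <= expR (2 * K * `|s|).
  by rewrite -expR0 ler_expR !mulr_ge0// ltW.
have M0 : 0 <= M by exact: le_trans (normr_ge0 _) (u'M 0).
pose A := M / (2 * K) + `|u 0|.
have u0 (s : R) C : `|u s - u 0| <= C * expR (2 * K * `|s|) ->
    `|u s| <= (C + `|u 0|) * expR (2 * K * `|s|).
  move=> h; rewrite -[u s](subrK (u 0)) (le_trans (ler_normD _ _))//.
  by rewrite mulrDl lerD// ler_peMr.
have uA s : `|u s| <= A * expR (2 * K * `|s|).
  apply: u0; apply: (exp_weight_increment s K2 M0 du) => r.
  by rewrite (le_trans (u'M r))// ler_peMr.
have A0 : 0 <= A by rewrite addr_ge0// divr_ge0// ltW.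
pose B := 2 * `|u 0| + e / K.
have B0 : 0 <= B by apply: addr_ge0; [exact: mulr_ge0|rewrite divr_ge0// ltW].
have step n s : `|u s| <= (A * 2^-1 ^+ n + B) * expR (2 * K * `|s|).
  elim: n s => [|n IH] s.
    by rewrite expr0 mulr1 (le_trans (uA _))// ler_wpM2r ?expR_ge0// lerDl.
  pose C := A * 2^-1 ^+ n + B.
  have C0 : 0 <= C by rewrite addr_ge0 ?mulr_ge0 ?exprn_ge0// invr_ge0.
  have u'C r : `|u' r| <= (K * C + e) * expR (2 * K * `|r|).
    rewrite (le_trans (u'K _))// mulrDl lerD//.
      by rewrite -mulrA ler_wpM2l ?(ltW K0)// IH.
    by rewrite ler_peMr.
  have KC : 0 <= K * C + e by rewrite addr_ge0// mulr_ge0// ltW.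
  apply: (le_trans (u0 _ _ (exp_weight_increment s K2 KC du u'C))).
  rewrite ler_wpM2r ?expR_ge0// /C /B exprS.
  rewrite le_eqVlt; apply/orP; left; apply/eqP; field; lra.
apply: (@geometric_le _ _ (A * expR (2 * K * `|t|))) => n.
by rewrite mulrAC -mulrDl; exact: step.
Qed.

Lemma lipschitz_continuous (V W : normedModType R) (f : V -> W) (k : R) :
  (forall x y, `|f x - f y| <= k * `|x - y|) -> continuous f.
Proof.
move=> fk x; apply/cvgrPdist_le => _/posnumP[e]; near=> y.
have k0 : 0 < `|k| + 1 by rewrite ltr_wpDl.
rewrite (le_trans (fk x y))// (@le_trans _ _ ((`|k| + 1) * `|x - y|))//.
  by rewrite ler_wpM2r// (le_trans (ler_norm _))// lerDl.
rewrite mulrC -ler_pdivlMr//; near: y; by apply: cvgr_dist_le => //; rewrite divr_gt0.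
Unshelve. all: by end_near. Qed.

Lemma row_primitive_exists d (x : 'rV[R]_d) (f : R -> 'rV[R]_d) : continuous f ->
  exists F : R -> 'rV[R]_d, F 0 = x /\ forall t, is_derive t (1 : R) F (f t).
Proof.
move=> cf.
have /choice[F FP] (i : 'I_d) : exists F : R -> R, F 0 = 0 /\
    forall t, is_derive t (1 : R) F (f t 0 i).
  apply: primitive_exists => t.
  apply: (@continuous_comp _ _ _ f (fun v : 'rV[R]_d => v 0 i)).
    exact: cf.
  exact: coord_continuous.
exists (fun t => x + \row_i F i t); split.
  by apply/rowP => i; rewrite !mxE (FP i).1 addr0.
move=> t; apply/is_derive_rowP => i.
have -> : (fun s => (x + \row_i F i s) 0 i) = (cst (x 0 i) + F i).
  by apply/funext => s; rewrite !mxE.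
rewrite -[f t 0 i]add0r; apply: is_deriveD.
exact: (FP i).2.
Qed.

Section Picard.
Context {d : nat}.
Variables (B : 'rV[R]_d -> 'rV[R]_d) (K M : R).
Hypothesis K0 : 0 < K.
Hypothesis B_lip : forall x y, `|B x - B y| <= K * `|x - y|.
Hypothesis B_bnd : forall x, `|B x| <= M.

(** Picard iteration; for the weight [expR (2 * K * `|t|)] it is a contraction of
    factor [1 / 2] on the whole line, so a single limit is a global solution. *)
Lemma ode_solution_exists x : exists u : R -> 'rV[R]_d,
  u 0 = x /\ forall t, is_derive t (1 : R) u (B (u t)).
Proof.
have M0 : 0 <= M by exact: le_trans (normr_ge0 _) (B_bnd 0).
have K2 : 0 < 2 * K by rewrite mulr_gt0.
have cB : continuous B by exact: lipschitz_continuous B_lip.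
have cBu (u : R -> 'rV[R]_d) : continuous u -> continuous (B \o u).
  by move=> cu t; apply: continuous_comp; [exact: cu|exact: cB].
have /choice[P PP] (u : R -> 'rV[R]_d) : exists F : R -> 'rV[R]_d, continuous u ->
    F 0 = x /\ forall t, is_derive t (1 : R) F (B (u t)).
  have [cu|ncu] := pselect (continuous u); last by exists u.
  by have [F FP] := row_primitive_exists x (cBu _ cu); exists F.
have cP u : continuous u -> continuous (P u).
  by move=> cu t; apply: is_derive_continuous; exact: (PP u cu).2.
pose phi n := iter n P (cst x).
have cphi n : continuous (phi n).
  by elim: n => [|n IH]; [exact: cst_continuous|exact: cP].
have Pdiff u v c : 0 <= c -> continuous u -> continuous v ->
    (forall s, `|u s - v s| <= c * expR (2 * K * `|s|)) ->
    forall s, `|P u s - P v s| <= c / 2 * expR (2 * K * `|s|).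
  move=> c0 cu cv uv s; have [Pu0 dPu] := PP u cu; have [Pv0 dPv] := PP v cv.
  have : `|(P u - P v) s - (P u - P v) 0| <=
      K * c / (2 * K) * expR (2 * K * `|s|).
    apply: (exp_weight_increment s K2 _ (fun s => is_deriveB (dPu s) (dPv s))).
      by rewrite mulr_ge0// ltW.
    move=> r; rewrite (le_trans (B_lip _ _))// -mulrA ler_wpM2l// ltW//.
  rewrite !fctE Pu0 Pv0 subrr subr0.
  suff -> : K * c / (2 * K) = c / 2 by [].
  by field; rewrite gt_eqF.
pose A := M / (2 * K).
have A0 : 0 <= A by rewrite divr_ge0// ltW.
have phiS n t : `|phi n.+1 t - phi n t| <=
    A * expR (2 * K * `|t|) * 2^-1 ^+ n.
  rewrite mulrAC; elim: n t => [|n IH] t.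
    rewrite expr0 mulr1 /phi/=.
    have [P0 dP] := PP _ (@cst_continuous R _ x).
    rewrite -[X in _ - X]P0; apply: (exp_weight_increment t K2 M0 dP) => s.
    rewrite (le_trans (B_bnd _))// ler_peMr// -expR0 ler_expR !mulr_ge0// ltW//.
  rewrite [phi n.+1 in X in _ - X]/phi/= exprSr mulrA.
  apply: Pdiff IH t => //; first by rewrite mulr_ge0// exprn_ge0// invr_ge0.
have /choice[u uP] t :=
  @geometric_row_cvg d (fun n => phi n t) _ (fun n => phiS n t).
have cu : continuous u.
  apply: (@lipschitz_continuous _ _ _ M) => s t.
  pose C := 2 * A * expR (2 * K * `|s|) + 2 * A * expR (2 * K * `|t|).
  apply: (@geometric_le _ _ C) => n.
  have us := uP s n; have ut := uP t n.
  have phiM : `|phi n s - phi n t| <= M * `|s - t|.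
    case: n {us ut} => [|n].
      by rewrite /phi/= subrr normr0 mulr_ge0.
    exact: row_derive_lipschitz (PP _ (cphi n)).2 (fun r => B_bnd _).
  have -> : u s - u t =
      (u s - phi n s) + (phi n s - phi n t) - (u t - phi n t).
    by apply/rowP => i; rewrite !mxE; ring.
  rewrite (le_trans (ler_normB _ _))// (le_trans (lerD (ler_normD _ _) (lexx _)))//.
  move: us ut phiM; rewrite /C !mulrDl !mulrA; lra.
suff uE : u = P u.
  have [Pu0 dPu] := PP u cu; exists u; rewrite {1}uE; split => // t.
  by rewrite {1}uE.
apply/funext => t; apply/eqP; rewrite -subr_eq0 -normr_le0.
apply: (@geometric_le _ _ (2 * A * expR (2 * K * `|t|))) => n; rewrite addr0.
have h1 := uP t n.+1.
have h2 : `|P u t - P (phi n) t| <=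
    2 * A * 2^-1 ^+ n / 2 * expR (2 * K * `|t|).
  apply: Pdiff => //; first by apply: mulr_ge0; [exact: mulr_ge0|exact: exprn_ge0].
  by move=> s; rewrite mulrAC -[2 * A * _]mulrA; exact: uP.
rewrite -(subrKA (phi n.+1 t)) (le_trans (ler_normD _ _))//.
rewrite [X in _ + X]distrC (le_trans (lerD h1 h2))// exprS.
rewrite le_eqVlt; apply/orP; left; apply/eqP; by field.
Qed.

End Picard.

End Calculus.

(** * Periodic functions and flows of Lipschitz fields *)

Section Periodic.
Context {R : realType} {d : nat}.
Implicit Types x y : 'rV[R]_d.

Definition floor_row x : 'rV[int]_d := \row_i Num.floor (x 0 i).

Definition frac_row x : 'rV[R]_d := x - map_mx intr (floor_row x).

Lemma frac_row_unit_cell x : unit_cell R d (frac_row x).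
Proof.
move=> i; rewrite !mxE subr_ge0 floor_le/= ltrBlDl addrC.
by have /andP[_] := floor_itv (x 0 i); rewrite intrD addrC.
Qed.

Lemma periodic_frac T (f : 'rV[R]_d -> T) x : Zd_periodic f ->
  f (frac_row x) = f x.
Proof.
by move=> pf; rewrite /frac_row -[in RHS](subrK (map_mx intr (floor_row x)) x) pf.
Qed.

Lemma periodicB T (f : 'rV[R]_d -> T) x k : Zd_periodic f ->
  f (x - map_mx intr k) = f x.
Proof. by move=> pf; rewrite -[in RHS](subrK (map_mx intr k) x) pf. Qed.

Definition unit_cube : set 'rV[R]_d := [set x | forall i, x 0 i \in `[0, 1]].

Lemma unit_cell_cube : unit_cell R d `<=` unit_cube.
Proof.
by move=> x /= cx i; have /andP[x0 x1] := cx i; rewrite in_itv/= x0 ltW.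
Qed.

Lemma compact_unit_cube : compact unit_cube.
Proof.
apply: (@rV_compact R d (fun=> [set` `[0, 1]%R])) => i.
exact: segment_compact.
Qed.

Lemma continuous_unit_cube_bounded (f : 'rV[R]_d -> R) : continuous f ->
  exists C, forall x, unit_cube x -> `|f x| <= C.
Proof.
move=> cf; have [|||c _ cM] := @EVT_max_rV R d (fun x => `|f x|) unit_cube.
- by exists 0 => i; rewrite mxE in_itv/= lexx ler01.
- exact: compact_unit_cube.
- apply: continuous_subspaceT => x; apply: continuous_comp; first exact: cf.
  exact: norm_continuous.
by exists `|f c| => x Kx; apply: cM; rewrite inE.
Qed.

Lemma periodic_bounded (f : 'rV[R]_d -> R) : Zd_periodic f -> continuous f ->
  exists2 M, 0 < M & forall x, `|f x| <= M.
Proof.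
move=> pf cf; have [C fC] := continuous_unit_cube_bounded cf.
have fC' x : `|f x| <= C.
  by rewrite -(periodic_frac x pf); apply/fC/unit_cell_cube/frac_row_unit_cell.
exists (C + 1) => [|x]; last by rewrite (le_trans (fC' x))// lerDl.
by rewrite ltr_wpDl// (le_trans (normr_ge0 _) (fC' 0)).
Qed.

(** Compactness of the closed cube gives a common modulus at its points; a pair
    of nearby points is brought to one whose first point lies in the cube. *)
Lemma periodic_unif_continuous (f : 'rV[R]_d -> R) (e : R) :
  Zd_periodic f -> continuous f -> 0 < e ->
  exists2 dlt : R, 0 < dlt & forall x y, `|x - y| <= dlt -> `|f x - f y| <= e.
Proof.
move=> pf cf e0.
have /compact_near_coveringP/(_ _ (0 : R)^'+ (fun dlt x =>
    forall y, `|x - y| <= dlt -> `|f x - f y| <= e)) := compact_unit_cube.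
case.
  move=> x0 _.
  have /cvgrPdist_lt/(_ (e / 2)) := cf x0.
  rewrite divr_gt0// => /(_ isT) /nbhs_ballP[r /= r0 rP].
  have r2 : 0 < r / 2 by rewrite divr_gt0.
  exists (ball x0 (r / 2), [set t | t < r / 2]).
    by split; [exact: nbhsx_ballx|exact: nbhs_right_lt].
  move=> [x dlt] [/= x0x dltr] y xy.
  rewrite -(subrKA (f x0)) (le_trans (ler_normD _ _))// (splitr e) lerD//.
    rewrite distrC ltW//; apply: rP; apply: le_ball x0x.
    by rewrite ler_pdivrMr// ler_peMr ?ltW// ltr1n.
  apply/ltW/rP; rewrite -ball_normE/= in x0x *.
  rewrite -(subrKA x) (le_lt_trans (ler_normD _ _))// (splitr r) ltrD//.
  exact: le_lt_trans xy dltr.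
move=> dlt /= dlt0 dltP.
have := dltP (dlt / 2); rewrite /ball_/= sub0r normrN.
have d2 : 0 < dlt / 2 by rewrite divr_gt0.
rewrite gtr0_norm// gtr_pMr// invf_lt1 ?ltr1n// => /(_ isT d2) H.
exists (dlt / 2) => // x y xy.
rewrite -(periodic_frac x pf) -(periodicB y (floor_row x) pf).
apply: H; first exact/unit_cell_cube/frac_row_unit_cell.
by rewrite /frac_row opprD opprK addrACA addNr addr0.
Qed.

End Periodic.

Section C1_Lipschitz.
Context {R : realType} {d : nat}.

Lemma is_derive_line (V W : normedModType R) (f : V -> W) (x v : V) (s : R) l :
  is_derive (x + s *: v) v f l -> is_derive s (1 : R) (fun r => f (x + r *: v)) l.
Proof.
have E : (fun h : R => h^-1 *: (((fun r => f (x + r *: v)) \o shift s) (h *: (1 : R)) -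
    f (x + s *: v))) = (fun h => h^-1 *: ((f \o shift (x + s *: v)) (h *: v) -
    f (x + s *: v))).
  apply/funext => h /=; congr (_ *: (f _ - _)).
  by rewrite [h *: 1]mulr1 scalerDl addrCA.
by move=> [df <-]; split; rewrite /derivable /derive E.
Qed.

Lemma differentiable_coordinate (f : 'rV[R]_d -> 'rV[R]_d) i x :
  differentiable f x -> differentiable (fun y => f y 0 i) x.
Proof.
move=> df; apply: (@differentiable_comp _ _ _ _ f (fun v => v 0 i)) => //.
exact: differentiable_coord.
Qed.

Lemma periodic_C1_coord (f : 'rV[R]_d -> 'rV[R]_d) i :
  periodic_C1 f -> periodic_C1 (fun y => f y 0 i).
Proof.
move=> [pf [df cf]]; split; first by move=> x k; rewrite pf.
split=> [x|v x]; first exact: differentiable_coordinate.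
have -> : 'D_v (fun y => f y 0 i) = (fun y => 'D_v f y 0 i).
  apply/funext => y; rewrite derive_mx ?mxE//.
  exact: diff_derivable.
apply: (@continuous_comp _ _ _ ('D_v f) (fun v : 'rV[R]_d => v 0 i)).
  exact: cf.
exact: coord_continuous.
Qed.

Lemma periodic_derive (W : normedModType R) (f : 'rV[R]_d -> W) v :
  Zd_periodic f -> Zd_periodic ('D_v f).
Proof.
move=> pf x k; rewrite /derive [X in lim (X @ _)](_ : _ =
  fun h : R => h^-1 *: ((f \o shift x) (h *: v) - f x))//.
by apply/funext => h /=; rewrite addrA !pf.
Qed.

Lemma periodic_C1_continuous (W : normedModType R) (f : 'rV[R]_d -> W) :
  periodic_C1 f -> continuous f.
Proof. by move=> [_ [df _]] x; exact: differentiable_continuous. Qed.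

Lemma row_sum_delta_mx (v : 'rV[R]_d) : v = \sum_j v 0 j *: delta_mx 0 j.
Proof. by rewrite {1}[v]row_sum_delta. Qed.

(** The derivative along a segment is a combination of the partial derivatives,
    which are bounded because they are continuous and periodic. *)
Lemma periodic_C1_lipschitz (f : 'rV[R]_d -> R) : periodic_C1 f ->
  exists2 K, 0 < K & forall x y, `|f x - f y| <= K * `|x - y|.
Proof.
move=> [pf [df cf]].
have /choice[M MP] (j : 'I_d) : exists M, 0 < M /\
    forall x, `|'D_(delta_mx 0 j) f x| <= M.
  have [M M0 MP] := periodic_bounded (periodic_derive (delta_mx 0 j) pf) (cf _).
  by exists M.
have K0 : 0 <= \sum_j M j by apply: sumr_ge0 => j _; rewrite ltW// (MP j).1.
exists (\sum_j M j + 1) => [|x y]; first by rewrite ltr_wpDl.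
pose v := x - y.
have dfv s : is_derive s (1 : R) (fun r => f (y + r *: v)) ('D_v f (y + s *: v)).
  by apply: is_derive_line; apply/derivableP; exact: diff_derivable.
have vM s : `|'D_v f (y + s *: v)| <= (\sum_j M j) * `|v|.
  rewrite deriveE// [v in 'd _ _ v]row_sum_delta_mx linear_sum/=.
  rewrite (le_trans (ler_norm_sum _ _ _))// mulr_suml ler_sum// => j _.
  rewrite linearZ/= normrZ mulrC ler_pM//; last exact: norm_coord_le.
  by rewrite -deriveE//; exact: (MP j).2.
have dF s : is_derive s (1 : R) (fun r => (\sum_j M j) * `|v| * r)
    ((\sum_j M j) * `|v|).
  by rewrite -[X in is_derive _ _ _ X]mulr1; apply: is_deriveZ.
have := derive_norm_le_increment ler01 dfv dF (fun s _ => vM s).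
have -> : y + 1 *: v = x by rewrite scale1r /v addrC subrK.
rewrite scale0r addr0 mulr1 mulr0 subr0 => /le_trans; apply.
by rewrite ler_wpM2r// lerDl.
Qed.

End C1_Lipschitz.

Section LipschitzBounded.
Context {R : realType} {d : nat}.

(** The estimates on a flow depend on its field only through these constants. *)
Definition lipschitz_bounded (W : normedModType R) (f : 'rV[R]_d -> W) (K M : R) :=
  [/\ 0 < K, 0 <= M, forall x y, `|f x - f y| <= K * `|x - y|
    & forall x, `|f x| <= M].

Lemma periodic_C1_lipschitz_bounded (f : 'rV[R]_d -> R) : periodic_C1 f ->
  exists K M, lipschitz_bounded f K M.
Proof.
move=> C1f; have [K K0 fK] := periodic_C1_lipschitz C1f.
have [M M0 fM] := periodic_bounded C1f.1 (periodic_C1_continuous C1f).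
by exists K, M; split => //; exact: ltW.
Qed.

Lemma periodic_C1_row_lipschitz_bounded (f : 'rV[R]_d -> 'rV[R]_d) :
  periodic_C1 f -> exists K M, lipschitz_bounded f K M.
Proof.
move=> C1f.
have /choice[K /choice[M KM]] i :=
  periodic_C1_lipschitz_bounded (periodic_C1_coord i C1f).
have sumK i : K i <= \sum_j K j.
  rewrite (bigD1 i)//= lerDl sumr_ge0// => j _.
  by have [/ltW] := KM j.
have sumM i : M i <= \sum_j M j.
  rewrite (bigD1 i)//= lerDl sumr_ge0// => j _.
  by have [] := KM j.
have K0 : 0 <= \sum_j K j by apply: sumr_ge0 => j _; have [/ltW] := KM j.
have M0 : 0 <= \sum_j M j by apply: sumr_ge0 => j _; have [] := KM j.
exists (\sum_j K j + 1), (\sum_j M j); split => //; first by rewrite ltr_wpDl.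
- move=> x y; apply: row_norm_le => [|i]; first by rewrite mulr_ge0// addr_ge0.
  rewrite !mxE; have [_ _ h _] := KM i; rewrite (le_trans (h x y))//.
  by rewrite ler_wpM2r// (le_trans (sumK i))// lerDl.
- move=> x; apply: row_norm_le => // i.
  by have [_ _ _ h] := KM i; rewrite (le_trans (h x)).
Qed.

Lemma lipschitz_bounded_scale (a : 'rV[R]_d -> R) (f : 'rV[R]_d -> 'rV[R]_d)
    K M K' M' : lipschitz_bounded a K M -> lipschitz_bounded f K' M' ->
  lipschitz_bounded (fun x => a x *: f x) (K * M' + M * K' + 1) (M * M').
Proof.
move=> [K0 M0 aK aM] [K'0 M'0 fK fM]; split.
- by rewrite ltr_wpDl// addr_ge0// mulr_ge0// ltW.
- exact: mulr_ge0.
- move=> x y; have -> : a x *: f x - a y *: f y =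
      (a x - a y) *: f x + a y *: (f x - f y).
    by rewrite scalerBl scalerBr addrA subrK.
  rewrite (le_trans (ler_normD _ _))// !normrZ.
  rewrite (@le_trans _ _ ((K * M' + M * K') * `|x - y|))//; last first.
    by rewrite ler_wpM2r// lerDl.
  rewrite mulrDl lerD//.
    by rewrite mulrAC ler_pM.
  by rewrite -mulrA ler_pM.
- by move=> x; rewrite normrZ ler_pM.
Qed.

Lemma lipschitz_bounded_continuous (W : normedModType R) (f : 'rV[R]_d -> W) K M :
  lipschitz_bounded f K M -> continuous f.
Proof. by move=> [_ _ fK _]; exact: lipschitz_continuous fK. Qed.

Lemma periodic_C1_scale (a : 'rV[R]_d -> R) (f : 'rV[R]_d -> 'rV[R]_d) :
  periodic_C1 a -> periodic_C1 f ->
  Zd_periodic (fun x => a x *: f x) /\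
  exists K M, lipschitz_bounded (fun x => a x *: f x) K M.
Proof.
move=> C1a C1f; split; first by move=> x k; rewrite C1a.1 C1f.1.
have [K [M aKM]] := periodic_C1_lipschitz_bounded C1a.
have [K' [M' fKM]] := periodic_C1_row_lipschitz_bounded C1f.
exists (K * M' + M * K' + 1), (M * M'); exact: lipschitz_bounded_scale.
Qed.

End LipschitzBounded.

Section Flow.
Context {R : realType} {d : nat}.
Variables (B : 'rV[R]_d -> 'rV[R]_d) (K M : R).
Hypothesis BKM : lipschitz_bounded B K M.

Let K0 : 0 < K. Proof. by case: BKM. Qed.
Let M0 : 0 <= M. Proof. by case: BKM. Qed.
Let B_lip x y : `|B x - B y| <= K * `|x - y|. Proof. by case: BKM. Qed.
Let B_bnd x : `|B x| <= M. Proof. by case: BKM. Qed.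

Lemma flow_is_flow : is_flow B (flow B).
Proof.
have /choice[X XP] x := ode_solution_exists K0 B_lip B_bnd x.
apply: (@getPex _ [set X | is_flow B X]).
by exists (fun t x => X x t) => x; exact: XP.
Qed.

Lemma flow0 x : flow B 0 x = x. Proof. exact: (flow_is_flow x).1. Qed.

Lemma flow_derive x t :
  is_derive t (1 : R) (fun s => flow B s x) (B (flow B t x)).
Proof. exact: (flow_is_flow x).2. Qed.

(** Uniqueness holds with an arbitrary bounded time-dependent factor in front of
    the field: this is what identifies two time changes of one flow. *)
Lemma ode_unique (c : R -> R) (C : R) (u v : R -> 'rV[R]_d) :
  (forall t, `|c t| <= C) ->
  (forall t, is_derive t (1 : R) u (c t *: B (u t))) ->
  (forall t, is_derive t (1 : R) v (c t *: B (v t))) ->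
  u 0 = v 0 -> u = v.
Proof.
move=> cC du dv uv0; apply/funext => t.
have C0 : 0 <= C by exact: le_trans (normr_ge0 _) (cC 0).
have CK0 : 0 < (C + 1) * K by rewrite mulr_gt0// ltr_wpDl.
have bnd s : `|c s *: B (u s) - c s *: B (v s)| <= C * M + C * M.
  by rewrite (le_trans (ler_normB _ _))// !normrZ lerD// ler_pM.
have := gronwall t CK0 (lexx 0) (fun s => is_deriveB (du s) (dv s)) _ bnd.
rewrite !fctE uv0 subrr normr0 mulr0 mul0r addr0 mul0r => H.
apply/eqP; rewrite -subr_eq0 -normr_le0; apply: H => s.
rewrite addr0 -scalerBr normrZ -mulrA ler_pM//.
by rewrite (le_trans (cC s))// lerDl.
Qed.

Lemma flow_unique (u : R -> 'rV[R]_d) :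
  (forall t, is_derive t (1 : R) u (B (u t))) ->
  forall t, u t = flow B t (u 0).
Proof.
move=> du t; suff -> : u = (fun s => flow B s (u 0)) by rewrite flow0.
apply: (@ode_unique (cst 1) 1); rewrite ?flow0//.
- by move=> s; rewrite normr1.
- by move=> s; rewrite scale1r.
- by move=> s; rewrite scale1r; exact: flow_derive.
Qed.

Lemma flowD s t x : flow B (s + t) x = flow B s (flow B t x).
Proof.
rewrite (_ : flow B (s + t) x = (fun r => flow B (r + t) x) s)//.
rewrite -[X in flow B s (flow B X x)]add0r.
apply: (@flow_unique (fun r => flow B (r + t) x)) => r.
exact: (@is_derive_translate _ _ (fun r => flow B r x) _ _ _ (flow_derive _ _)).
Qed.

Lemma flow_fixed x : B x = 0 -> forall t, flow B t x = x.
Proof.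
move=> Bx0 t; apply/esym; apply: (@flow_unique (cst x)) => s.
by rewrite Bx0; exact: is_derive_cst.
Qed.

Lemma flow_lipschitz_time x s t :
  `|flow B t x - flow B s x| <= M * `|t - s|.
Proof. exact: (row_derive_lipschitz _ _ (flow_derive x)). Qed.

Lemma flow_continuous_time x : continuous (fun t => flow B t x).
Proof. by move=> t; apply: is_derive_continuous; exact: flow_derive. Qed.

End Flow.

Lemma flow_perturbation (R : realType) d (B B' : 'rV[R]_d -> 'rV[R]_d)
    (K M K' M' e t : R) x y :
  lipschitz_bounded B K M -> lipschitz_bounded B' K' M' ->
  (forall z, `|B' z - B z| <= e) ->
  `|flow B' t x - flow B t y| <=
    (2 * `|x - y| + e / K) * expR (2 * K * `|t|).
Proof.
move=> BKM B'KM B'B; have [K0 _ B_lip B_bnd] := BKM; have [_ _ _ B'_bnd] := B'KM.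
have e0 : 0 <= e by exact: le_trans (normr_ge0 _) (B'B 0).
have := @gronwall _ _ _ _ K e (M' + M) t K0 e0
  (fun s => is_deriveB (flow_derive B'KM x s) (flow_derive BKM y s)).
rewrite !fctE (flow0 B'KM) (flow0 BKM); apply => s.
  rewrite -(subrKA (B (flow B' s x))) (le_trans (ler_normD _ _))//.
  by rewrite [leRHS]addrC lerD.
by rewrite (le_trans (ler_normB _ _))// lerD.
Qed.

Section FlowSpace.
Context {R : realType} {d : nat}.
Variables (B : 'rV[R]_d -> 'rV[R]_d) (K M : R).
Hypothesis BKM : lipschitz_bounded B K M.

Let K0 : 0 < K. Proof. by case: BKM. Qed.
Let M0 : 0 <= M. Proof. by case: BKM. Qed.
Let B_lip x y : `|B x - B y| <= K * `|x - y|. Proof. by case: BKM. Qed.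
Let flow0 := flow0 BKM.
Let flow_derive := flow_derive BKM.
Let flow_unique := flow_unique BKM.
Let flow_lipschitz_time := flow_lipschitz_time BKM.

Lemma flow_lipschitz t x y :
  `|flow B t x - flow B t y| <= 2 * expR (2 * K * `|t|) * `|x - y|.
Proof.
have := @flow_perturbation _ _ B B K M K M 0 t x y BKM BKM.
rewrite mul0r addr0 mulrAC; apply => z.
by rewrite subrr normr0.
Qed.

Lemma flow_continuous t : continuous (flow B t).
Proof. exact: lipschitz_continuous (flow_lipschitz t). Qed.

Lemma flow_periodic t : Zd_periodic B ->
  forall x k, flow B t (x + map_mx intr k) = flow B t x + map_mx intr k.
Proof.
move=> pB x k; apply/esym.
rewrite -[X in flow B t (X + _)](flow0 x).
apply: (@flow_unique (fun s => flow B s x + map_mx intr k)) => s.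
by rewrite pB -[B _]addr0; apply: is_deriveD; exact: flow_derive.
Qed.

Lemma periodic_C0_flow t psi : Zd_periodic B -> periodic_C0 psi ->
  periodic_C0 (fun x => psi (flow B t x)).
Proof.
move=> pB [ppsi cpsi]; split; first by move=> x k; rewrite flow_periodic// ppsi.
by move=> x; apply: continuous_comp; [exact: flow_continuous|exact: cpsi].
Qed.

(** The error of an explicit Euler step is quadratic because the velocity varies
    by at most [K * M * h] during a time [h]. *)
Lemma flow_euler_step (h : R) x : 0 <= h ->
  `|flow B h x - (x + h *: B x)| <= K * M * h ^+ 2.
Proof.
move=> h0; apply: row_norm_le => [|i].
  by rewrite !mulr_ge0 ?exprn_ge0// ltW.
pose g s := flow B s x 0 i - s * B x 0 i.
have dg s : is_derive s (1 : R) g (B (flow B s x) 0 i - B x 0 i).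
  apply: is_deriveB; first exact: ((is_derive_rowP _ _ _).1 (flow_derive x s) i).
  have : is_derive s (1 : R) (B x 0 i *: @id R) (B x 0 i *: (1 : R)).
    exact: is_deriveZ.
  rewrite [_ *: 1]mulr1; congr is_derive.
  by apply/funext => r; rewrite mulrC.
have dF s : is_derive s (1 : R) (fun r => K * M * h * r) (K * M * h).
  by rewrite -[X in is_derive _ _ _ X]mulr1; apply: is_deriveZ.
have := derive_norm_le_increment h0 dg dF.
rewrite /g flow0 mulr0 subr0 mul0r subr0 expr2 !mulrA !mxE => H.
rewrite opprD addrA addrAC; apply: H => s /andP[s0 sh].
have := norm_coord_le (B (flow B s x) - B x) i; rewrite !mxE => /le_trans; apply.
rewrite (le_trans (B_lip _ _))// -!mulrA ler_wpM2l ?(ltW K0)//.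
have := flow_lipschitz_time x 0 s; rewrite flow0 subr0 => /le_trans; apply.
by rewrite ler_wpM2l// ger0_norm.
Qed.

End FlowSpace.

(** * The Riesz representation of positive functionals *)

Section InfConvolution.
Context {R : realType} {d : nat}.
Variables (g : 'rV[R]_d -> R) (c n : R).
Hypothesis gc : forall x, c <= g x.
Hypothesis n0 : 0 <= n.

Definition inf_convolution x : R :=
  inf [set g y + n * `|x - y| | y in [set: 'rV[R]_d]].

Lemma inf_convolution_has_inf x :
  has_inf [set g y + n * `|x - y| | y in [set: 'rV[R]_d]].
Proof.
split; first by exists (g 0 + n * `|x - 0|), 0.
by exists c => _ [y _ <-]; rewrite (le_trans (gc y))// lerDl mulr_ge0.
Qed.

Lemma inf_convolution_le x y : inf_convolution x <= g y + n * `|x - y|.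
Proof.
by apply: ge_inf; [exact: (inf_convolution_has_inf x).2|exists y].
Qed.

Lemma inf_convolution_ge x a : (forall y, a <= g y + n * `|x - y|) ->
  a <= inf_convolution x.
Proof.
move=> H; apply: lb_le_inf; first exact: (inf_convolution_has_inf x).1.
by move=> _ [y _ <-].
Qed.

Lemma inf_convolution_lipschitz x y :
  `|inf_convolution x - inf_convolution y| <= n * `|x - y|.
Proof.
have H u v : inf_convolution u - inf_convolution v <= n * `|u - v|.
  rewrite lerBlDl -lerBlDr; apply: inf_convolution_ge => z.
  rewrite lerBlDr (le_trans (inf_convolution_le u z))// -addrA lerD2l -mulrDr.
  by rewrite ler_wpM2l// -(subrKA v u) addrC ler_normD.
by rewrite ler_norml lerNl opprB H distrC H.
Qed.

Lemma inf_convolution_continuous : continuous inf_convolution.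
Proof. exact: lipschitz_continuous inf_convolution_lipschitz. Qed.

End InfConvolution.

(** The inf-convolution of the indicator of [U] is continuous and vanishes
    exactly off [U]: around a point of [U] the value [0] is taken by the
    indicator only at a positive distance. *)
Lemma open_cozero (R : realType) d (U : set 'rV[R]_d) : open U ->
  exists u : 'rV[R]_d -> R, [/\ continuous u, forall x, 0 <= u x
    & forall x, U x <-> 0 < u x].
Proof.
move=> oU; have g0 x : 0 <= (\1_U x : R) by [].
exists (inf_convolution \1_U 1); split.
- exact: inf_convolution_continuous g0 ler01.
- by move=> x; apply: (inf_convolution_ge g0 ler01) => y; rewrite addr_ge0// mul1r.
move=> x; split => [Ux|].
- have /nbhs_ballP[r /= r0 rU] : nbhs x U by move: oU; rewrite openE; exact.
  apply: (@lt_le_trans _ _ (Num.min 1 r)); first by rewrite lt_min ltr01.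
  apply: (inf_convolution_ge g0 ler01) => y; rewrite mul1r.
  have [xyr|rxy] := ltP `|x - y| r.
    rewrite indicE mem_set; last by apply: rU; rewrite -ball_normE.
    by rewrite (@le_trans _ _ 1)// ?ge_min ?lexx// lerDl.
  by rewrite (@le_trans _ _ r)// ?ge_min ?lexx ?orbT// (le_trans rxy)// lerDr.
- rewrite ltNge => h; apply: contrapT => nUx; apply/negP: h; rewrite negbK.
  rewrite (le_trans (inf_convolution_le g0 ler01 x x))//.
  by rewrite subrr normr0 mulr0 addr0 indicE memNset.
Qed.

Lemma nneseries_pairs (R : realType) (F : nat -> nat -> \bar R)
    (f : nat -> nat * nat) : set_bij setT setT f -> (forall i j, 0 <= F i j)%E ->
  (\sum_(k <oo) F (f k).1 (f k).2 = \sum_(i <oo) \sum_(j <oo) F i j)%E.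
Proof.
move=> bf F0; rewrite nneseries_esumT.
rewrite nneseries_esumT; last by move=> i; exact: nneseries_ge0.
under [RHS]eq_esum do rewrite nneseries_esumT//.
rewrite esum_esum; last by move=> *; exact: F0.
rewrite (_ : _ `*`` _ = [set: nat * nat]); last by apply/seteqP; split.
  by rewrite (@reindex_esum _ _ _ _ _ _ (fun p => F p.1 p.2) bf).
by move=> n; exact: F0.
Qed.

Lemma continuous_mulf (R : realType) (T : topologicalType) (f g : T -> R) :
  continuous f -> continuous g -> continuous (fun x => f x * g x).
Proof. by move=> cf cg x; apply: continuousM; [exact: cf|exact: cg]. Qed.

Lemma continuous_subf (R : realType) (T : topologicalType) (f g : T -> R) :
  continuous f -> continuous g -> continuous (fun x => f x - g x).
Proof. by move=> cf cg x; apply: continuousB; [exact: cf|exact: cg]. Qed.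

(** Positivity is required on [K] only, which is how [L] is made to depend only
    on the restriction of functions to [K]. *)
Definition positive_functional (R : realType) (T : topologicalType) (K : set T)
    (L : (T -> R) -> R) :=
  [/\ forall f g : T -> R, continuous f -> continuous g ->
        L (fun x => f x + g x) = L f + L g,
      forall (a : R) (f : T -> R), continuous f -> L (fun x => a * f x) = a * L f,
      forall f : T -> R, continuous f -> (forall x, K x -> 0 <= f x) -> 0 <= L f
    & L (fun=> 1) = 1].

Lemma continuous_measurable_rV (R : realType) d (f : 'rV[R]_d -> R) : continuous f ->
  measurable_fun [set: borel_rV R d] f.
Proof.
move=> cf; apply: (measurability _ (measurable_realfun.RGenOpens.measurableE R)).
move=> _ [_ [a [b ->]] <-]; rewrite setTI; apply: sub_sigma_algebra.
by move/continuousP : cf; apply; exact: interval_open.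
Qed.

(** Clipping [y] to the successive unit intervals splits it into slices. *)
Lemma clip_sum (R : realType) (y : R) n : 0 <= y ->
  \sum_(j < n) Num.min 1 (Num.max 0 (y - j%:R)) = Num.min y n%:R.
Proof.
move=> y0; elim: n => [|n IH]; first by rewrite big_ord0 min_r.
rewrite big_ord_recr/= IH -natr1.
by rewrite /Num.min /Num.max; do ![case: ifPn]; rewrite -?leNgt; lra.
Qed.

Section RieszOuterMeasure.
Context {R : realType} {d : nat}.
Local Notation V := 'rV[R]_d.
Variables (K : set V) (L : (V -> R) -> R).
Hypothesis cK : compact K.
Hypothesis posL : positive_functional K L.

Let LD (f g : V -> R) : continuous f -> continuous g ->
  L (fun x => f x + g x) = L f + L g.
Proof. by case: posL => + _ _ _; exact. Qed.
Let LZ a (f : V -> R) : continuous f -> L (fun x => a * f x) = a * L f.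
Proof. by case: posL => _ + _ _; exact. Qed.
Let L_ge0 (f : V -> R) : continuous f -> (forall x, K x -> 0 <= f x) -> 0 <= L f.
Proof. by case: posL => _ _ + _; exact. Qed.
Let L1 : L (fun=> 1) = 1. Proof. by case: posL. Qed.

Lemma positive_functional_cst a : L (fun=> a) = a.
Proof.
rewrite (_ : (fun=> a) = (fun x : V => a * 1)); last first.
  by apply/funext => x; rewrite mulr1.
by rewrite LZ ?L1 ?mulr1//; exact: cst_continuous.
Qed.

Lemma positive_functionalB (f g : V -> R) : continuous f -> continuous g ->
  L (fun x => f x - g x) = L f - L g.
Proof.
move=> cf cg; rewrite (_ : (fun x => _) = (fun x => f x + -1 * g x)); last first.
  by apply/funext => x; rewrite mulN1r.
rewrite LD ?LZ ?mulN1r// => x.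
apply: (@continuousM _ _ (cst (-1)) g); last exact: cg.
exact: cst_continuous.
Qed.

Lemma positive_functional_le (f g : V -> R) : continuous f -> continuous g ->
  (forall x, K x -> f x <= g x) -> L f <= L g.
Proof.
move=> cf cg fg; rewrite -subr_ge0 -positive_functionalB//; apply: L_ge0.
  by move=> x; apply: continuousB; [exact: cg|exact: cf].
by move=> x Kx; rewrite subr_ge0 fg.
Qed.

Lemma continuous_sum_fun (f : nat -> V -> R) n : (forall k, continuous (f k)) ->
  continuous (fun x => \sum_(k < n) f k x).
Proof.
move=> cf; elim: n => [|n IH] x.
  rewrite (_ : (fun x => _) = cst 0); first exact: cst_continuous.
  by apply/funext => y; rewrite big_ord0.
rewrite (_ : (fun x => _) = (fun x => \sum_(k < n) f k x + f n x)).
  by apply: continuousD; [exact: IH|exact: cf].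
by apply/funext => y; rewrite big_ord_recr.
Qed.

Lemma positive_functional_sum (f : nat -> V -> R) n :
  (forall k, continuous (f k)) ->
  L (fun x => \sum_(k < n) f k x) = \sum_(k < n) L (f k).
Proof.
move=> cf; elim: n => [|n IH].
  rewrite big_ord0 (_ : (fun x => _) = cst 0) ?positive_functional_cst//.
  by apply/funext => y; rewrite big_ord0.
rewrite big_ord_recr/= -IH -LD//; last exact: continuous_sum_fun.
by congr L; apply/funext => y; rewrite big_ord_recr.
Qed.

(** Dini's argument: on a compact set a continuous function below a sum of
    nonnegative continuous functions is, up to any [e > 0], below one of the
    partial sums; this is the sigma-additivity of [L]. *)
Lemma positive_functional_dini (f : nat -> V -> R) (g : V -> R) :
  (forall k, continuous (f k)) -> (forall k x, 0 <= f k x) -> continuous g ->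
  (forall x, K x -> (g x)%:E <= \sum_(k <oo) (f k x)%:E)%E ->
  ((L g)%:E <= \sum_(k <oo) (L (f k))%:E)%E.
Proof.
move=> cf f0 cg gf.
have Lf0 k : 0 <= L (f k) by apply: L_ge0 => // x _; exact: f0.
apply/lee_addgt0Pr => _/posnumP[e].
have /compact_near_coveringP/(_ _ \oo (fun n x =>
    g x - e%:num <= \sum_(k < n) f k x)) := cK.
case.
  move=> x Kx.
  have [n nP] : exists n, g x - e%:num < \sum_(k < n) f k x.
    apply: contrapT => /forallNP H.
    have : (\sum_(k <oo) (f k x)%:E <= (g x - e%:num)%:E)%E.
      apply: lime_le; first by apply: is_cvg_nneseries => *; rewrite lee_fin.
      apply: nearW => n; rewrite big_mkord sumEFin lee_fin leNgt.
      by apply/negP; exact: H.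
    move/(le_trans (gf x Kx)); rewrite lee_fin lerBrDl gerDr => h.
    by have := [gt0 of e%:num]; rewrite ltNge h.
  have cfg : {for x, continuous (fun y => \sum_(k < n) f k y - (g y - e%:num))}.
    apply: continuousB; first exact: continuous_sum_fun.
    by apply: continuousB; [exact: cg|exact: cst_continuous].
  have : \forall y \near x, 0 < \sum_(k < n) f k y - (g y - e%:num).
    by apply: (cvgr_gt _ cfg); rewrite subr_gt0.
  move=> Hn; exists ([set y | 0 < \sum_(k < n) f k y - (g y - e%:num)],
      [set m | (n <= m)%N]).
    by split => //; exists n.
  move=> [y m] [/=]; rewrite subr_gt0 => h nm; rewrite (le_trans (ltW h))//.
  by rewrite -(subnKC nm) big_split_ord/= lerDl sumr_ge0.
move=> n _ /(_ n (leqnn n)) H.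
have : L (fun x => g x - e%:num) <= L (fun x => \sum_(k < n) f k x).
  apply: positive_functional_le => //.
  - by move=> x; apply: continuousB; [exact: cg|exact: cst_continuous].
  - exact: continuous_sum_fun.
rewrite positive_functionalB//; last exact: cst_continuous.
rewrite positive_functional_cst positive_functional_sum// lerBlDr => h.
rewrite (@le_trans _ _ ((\sum_(k < n) L (f k))%:E + e%:num%:E)%E)//.
rewrite leeD2r// -sumEFin -(big_mkord xpredT (fun k => (L (f k))%:E)).
by apply: nneseries_lim_ge => k _ _; rewrite lee_fin.
Qed.

(** Covering by series of nonnegative continuous functions instead of sets lets
    [L] itself be the price of a cover; only the part of [A] inside [K] has to
    be covered. *)
Definition riesz_cover (A : set V) (f : nat -> V -> R) :=
  [/\ forall k, continuous (f k), forall k x, 0 <= f k x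
    & forall x, A x -> K x -> (1 <= \sum_(k <oo) (f k x)%:E)%E].

Definition riesz_outer (A : set V) : \bar R :=
  ereal_inf [set \sum_(k <oo) (L (f k))%:E | f in riesz_cover A]%E.

Let cover_L_ge0 A f k : riesz_cover A f -> 0 <= L (f k).
Proof. by case=> cf f0 _; apply: L_ge0 => // x _; exact: f0. Qed.

Lemma riesz_outer_ge0 A : (0 <= riesz_outer A)%E.
Proof.
apply: le_ereal_inf_tmp => _ [f fA <-]; apply: nneseries_ge0 => k _ _.
by rewrite lee_fin (cover_L_ge0 _ fA).
Qed.

Lemma riesz_outer_le A f : riesz_cover A f ->
  (riesz_outer A <= \sum_(k <oo) (L (f k))%:E)%E.
Proof. by move=> fA; apply: ereal_inf_lbound; exists f. Qed.

Lemma riesz_outer_le_one A (f : V -> R) : continuous f -> (forall x, 0 <= f x) ->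
  (forall x, A x -> K x -> 1 <= f x) -> (riesz_outer A <= (L f)%:E)%E.
Proof.
move=> cf f0 Af; pose F k : V -> R := if k is 0%N then f else cst 0.
have Fsum (G : (V -> R) -> R) : 0 <= G f -> G (cst 0) = 0 ->
    (\sum_(k <oo) (G (F k))%:E = (G f)%:E)%E.
  move=> Gf0 G0; rewrite (nneseries_recl)//=; last first.
    by move=> [|k] _ /=; rewrite lee_fin// G0.
  by rewrite eseries_cond eseries0 ?adde0// => -[|k] _ _ //=; rewrite G0.
rewrite -(Fsum L); [|by apply: L_ge0|exact: positive_functional_cst].
apply: riesz_outer_le; split.
- by case=> [|k] //; exact: cst_continuous.
- by case=> [|k] x //=.
- move=> x Ax Kx; rewrite (Fsum (fun h => h x))//.
  by rewrite lee_fin Af.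
Qed.

Lemma riesz_outer_le1 A : (riesz_outer A <= 1)%E.
Proof.
rewrite -L1; apply: riesz_outer_le_one => //; exact: cst_continuous.
Qed.

Lemma riesz_outer0 : riesz_outer set0 = 0%E.
Proof.
apply/eqP; rewrite eq_le riesz_outer_ge0 andbT -[X in (_ <= X)%E]/((0 : R)%:E) -[in X in (_ <= X)%E](positive_functional_cst 0).
by apply: riesz_outer_le_one => //; exact: cst_continuous.
Qed.

Lemma le_riesz_outer : {homo riesz_outer : A B / A `<=` B >-> (A <= B)%E}.
Proof.
move=> A B AB; apply: le_ereal_inf_tmp => _ [f [cf f0 fB] <-].
by apply: riesz_outer_le; split => // x /AB; exact: fB.
Qed.

Lemma riesz_outer_fin_num A : riesz_outer A \is a fin_num.
Proof.
rewrite ge0_fin_numE ?riesz_outer_ge0//.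
exact: le_lt_trans (riesz_outer_le1 A) (ltry 1).
Qed.

Lemma riesz_outer_adherent A (e : R) : 0 < e -> exists2 f, riesz_cover A f &
  (\sum_(k <oo) (L (f k))%:E <= riesz_outer A + e%:E)%E.
Proof.
move=> e0; have := lb_ereal_inf_adherent e0 (riesz_outer_fin_num A).
by move=> [_ [f fA <-] /ltW]; exists f.
Qed.

Lemma riesz_outer_le_pairs A (F : nat -> nat -> V -> R) :
  (forall i j, continuous (F i j)) -> (forall i j x, 0 <= F i j x) ->
  (forall x, A x -> K x -> 1 <= \sum_(i <oo) \sum_(j <oo) (F i j x)%:E)%E ->
  (riesz_outer A <= \sum_(i <oo) \sum_(j <oo) (L (F i j))%:E)%E.
Proof.
move=> cF F0 AF; have [f bf] : exists f, set_bij [set: nat] [set: nat * nat] f.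
  by apply/card_set_bijP; rewrite card_eq_sym; exact: card_nat2.
rewrite -(nneseries_pairs bf) => [|i j]; last first.
  by rewrite lee_fin; apply: L_ge0.
apply: (riesz_outer_le (f := fun k => F (f k).1 (f k).2)); split => //.
move=> x Ax Kx.
by rewrite (nneseries_pairs (F := fun i j => (F i j x)%:E) bf) ?AF// => i j; rewrite lee_fin.
Qed.

Lemma riesz_outer_sigma_subadditive : sigma_subadditive riesz_outer.
Proof.
move=> A; apply/lee_addgt0Pr => _/posnumP[e].
rewrite (le_trans _ (epsilon_trick _ _ _))//; last first.
  by move=> n; exact: riesz_outer_ge0.
have /choice[F FP] n : exists f, riesz_cover (A n) f /\
    (\sum_(k <oo) (L (f k))%:E <= riesz_outer (A n) +
      (e%:num / (2 ^ n.+1)%:R)%:E)%E.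
  have [|f fA fL] := @riesz_outer_adherent (A n) (e%:num / (2 ^ n.+1)%:R).
    by rewrite divr_gt0// ltr0n expn_gt0.
  by exists f.
have F0 n k x : 0 <= F n k x by have [[_ + _] _] := FP n; exact.
apply: (le_trans (riesz_outer_le_pairs (F := F) _ _ _)).
- by move=> n; have [[]] := FP n.
- by [].
- move=> x [n _ Anx] Kx; have [[_ _ /(_ x Anx Kx) h] _] := FP n.
  apply: (le_trans h).
  have S0 i : (0 <= \sum_(j <oo) (F i j x)%:E)%E.
    by apply: nneseries_ge0 => *; rewrite lee_fin.
  apply: (@le_trans _ _ (\sum_(0 <= i < n.+1) \sum_(j <oo) (F i j x)%:E)%E).
    by rewrite big_nat_recr//= leeDr// sume_ge0.
  exact: nneseries_lim_ge.
- apply: lee_nneseries => n _; last exact: (FP n).2.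
  by move=> *; apply: nneseries_ge0 => k _ _; rewrite lee_fin (cover_L_ge0 _ (FP n).1).
Qed.

HB.instance Definition _ := isOuterMeasure.Build R V riesz_outer
  riesz_outer0 riesz_outer_ge0 le_riesz_outer riesz_outer_sigma_subadditive.

(** The functions [min 1 (n u)] increase to the indicator of the open set
    [u > 0]. Cutting each function of a cover of [X] along them, the increments
    cover [X] inside the open set and one late remainder covers [X] outside. *)
Lemma open_riesz_caratheodory U : open U -> riesz_outer.-caratheodory U.
Proof.
move=> oU; apply: le_caratheodory_measurable => X.
have [u [cu u0 Uu]] := open_cozero oU.
apply/lee_addgt0Pr => _/posnumP[e].
have e2 : 0 < e%:num / 2 by rewrite divr_gt0.
have [f fX fL] := riesz_outer_adherent X e2; have [cf f0 fX1] := fX.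
pose phi (n : nat) x := Num.min 1 (n%:R * u x).
have cphi n : continuous (phi n).
  move=> x; apply: (@continuous_min _ _ (cst 1) (fun x => n%:R * u x)).
    exact: cst_continuous.
  apply: (@continuousM _ _ (cst n%:R) u); last exact: cu.
  exact: cst_continuous.
have phi0 x : phi 0 x = 0 by rewrite /phi mul0r min_r.
have phi1 n x : phi n x <= 1 by rewrite /phi ge_min lexx.
have phi_ge0 n x : 0 <= phi n x by rewrite /phi le_min ler01 mulr_ge0.
have phiS n x : phi n x <= phi n.+1 x.
  rewrite /phi le_min ge_min lexx/= ge_min; apply/orP; right.
  by rewrite ler_wpM2r// ler_nat.
have phi_out n x : ~ U x -> phi n x = 0.
  move=> nUx; suff ux0 : u x = 0 by rewrite /phi ux0 mulr0 min_r.
  by apply/eqP; rewrite eq_le u0 andbT leNgt; apply/negP => /Uu.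
have phi_in x : U x -> exists n, phi n x = 1.
  move=> /Uu ux0; exists (Num.truncn (u x)^-1).+1; rewrite /phi min_l//.
  by rewrite -ler_pdivrMr// div1r ltW// truncnS_gt.
pose G k n x := f k x * (phi n.+1 x - phi n x).
have cG k n : continuous (G k n).
  by apply: continuous_mulf; [exact: cf|exact: continuous_subf].
have G0 k n x : 0 <= G k n x by rewrite mulr_ge0// subr_ge0.
have cfphi k n : continuous (fun x => f k x * phi n x).
  exact: continuous_mulf.
have LG k n : \sum_(0 <= i < n) L (G k i) = L (fun x => f k x * phi n x).
  elim: n => [|n IH].
    rewrite big_geq//; apply/esym; rewrite -[RHS](positive_functional_cst 0).
    by congr L; apply/funext => x; rewrite phi0 mulr0.
  rewrite big_nat_recr//= IH -LD//.
  by congr L; apply/funext => x; rewrite -mulrDr addrC subrK.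
have LG0 k n : 0 <= L (G k n) by apply: L_ge0.
have LGf k n : L (fun x => f k x * phi n x) <= L (f k).
  apply: positive_functional_le => // x _; exact: ler_piMr.
have /choice[c cP] k : exists c : R,
    (\sum_(n <oo) (L (G k n))%:E)%E = c%:E.
  have le : (\sum_(n <oo) (L (G k n))%:E <= (L (f k))%:E)%E.
    apply: lime_le; first by apply: is_cvg_nneseries => *; rewrite lee_fin.
    by apply: nearW => n; rewrite sumEFin lee_fin LG.
  have ge : (0 <= \sum_(n <oo) (L (G k n))%:E)%E.
    by apply: nneseries_ge0 => *; rewrite lee_fin.
  exists (fine (\sum_(n <oo) (L (G k n))%:E)%E); rewrite fineK//.
  by rewrite ge0_fin_numE// (le_lt_trans le)// ltry.
have c0 k : 0 <= c k.
  by rewrite -lee_fin -cP; apply: nneseries_ge0 => *; rewrite lee_fin.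
have dk0 k : 0 < e%:num / 2 / (2 ^ k.+1)%:R.
  by rewrite divr_gt0// ltr0n expn_gt0.
have /choice[N NP] k : exists n,
    L (f k) - L (fun x => f k x * phi n x) <=
    L (f k) - c k + e%:num / 2 / (2 ^ k.+1)%:R.
  apply: contrapT => /forallNP H.
  have : ((c k)%:E <= (c k - e%:num / 2 / (2 ^ k.+1)%:R)%:E)%E.
    rewrite -cP; apply: lime_le.
      by apply: is_cvg_nneseries => *; rewrite lee_fin.
    apply: nearW => n; rewrite sumEFin lee_fin LG.
    by have := H n => /negP; rewrite -ltNge; lra.
  by rewrite lee_fin; have := dk0 k; lra.
have in_le : (riesz_outer (X `&` U) <= \sum_(k <oo) (c k)%:E)%E.
  under eq_eseriesr do rewrite -cP.
  apply: riesz_outer_le_pairs => // x [Xx Ux] Kx.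
  apply: (le_trans (fX1 x Xx Kx)); apply: lee_nneseries => k _.
    by rewrite lee_fin.
  have [n phin] := phi_in _ Ux.
  apply: (@le_trans _ _ (\sum_(0 <= i < n) (G k i x)%:E)%E); last first.
    by apply: nneseries_lim_ge => *; rewrite lee_fin.
  rewrite sumEFin lee_fin /G -mulr_sumr telescope_sumr//.
  by rewrite phin phi0 subr0 mulr1.
have out_le : (riesz_outer (X `&` ~` U) <=
    \sum_(k <oo) ((L (f k) - c k)%:E + (e%:num / 2 / (2 ^ k.+1)%:R)%:E))%E.
  pose h k x := f k x - f k x * phi (N k) x.
  have ch k : continuous (h k).
    exact: continuous_subf.
  have h0 k x : 0 <= h k x by rewrite subr_ge0 ler_piMr.
  apply: (@le_trans _ _ (\sum_(k <oo) (L (h k))%:E)%E).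
    apply: riesz_outer_le; split=> // x [Xx nUx] Kx.
    apply: (le_trans (fX1 x Xx Kx)); apply: lee_nneseries => k _.
      by rewrite lee_fin.
    by rewrite /h phi_out// mulr0 subr0.
  apply: lee_nneseries => k _; first by rewrite lee_fin L_ge0.
  by rewrite -EFinD lee_fin /h positive_functionalB.
have cL k : c k <= L (f k).
  rewrite -lee_fin -cP; apply: lime_le.
    by apply: is_cvg_nneseries => *; rewrite lee_fin.
  by apply: nearW => n; rewrite sumEFin lee_fin LG.
apply: (le_trans (leeD in_le out_le)).
rewrite nneseriesD; last 2 first.
- by move=> k _; rewrite lee_fin subr_ge0.
- by move=> k _; rewrite lee_fin ltW.
rewrite addeA -nneseriesD; last 2 first.
- by move=> k _; rewrite lee_fin.
- by move=> k _; rewrite lee_fin subr_ge0.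
under eq_eseriesr do rewrite -EFinD addrC subrK.
have -> : (e%:num%:E = (e%:num / 2)%:E + (e%:num / 2)%:E :> \bar R)%E.
  by rewrite -EFinD -splitr.
rewrite addeA leeD//.
have := @epsilon_trick R (fun=> 0%E) (e%:num / 2) xpredT (fun=> lexx _) (ltW e2).
rewrite [X in (_ <= X + _)%E]eseries0// add0e; apply: le_trans.
rewrite le_eqVlt; apply/orP; left; apply/eqP; apply: eq_eseriesr => k _.
by rewrite add0e.
Qed.

Definition riesz_measure (A : set (borel_rV R d)) : \bar R := riesz_outer A.

Lemma borel_riesz_caratheodory (A : set (borel_rV R d)) :
  measurable A -> riesz_outer.-caratheodory A.
Proof.
apply: smallest_sub; last exact: open_riesz_caratheodory.
exact: (sigma_algebra_measurable (caratheodory_type riesz_outer)).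
Qed.

Let riesz_measure0 : riesz_measure set0 = 0%E.
Proof. exact: riesz_outer0. Qed.

Let riesz_measure_ge0 A : (0 <= riesz_measure A)%E.
Proof. exact: riesz_outer_ge0. Qed.

Let riesz_measure_sigma_additive : semi_sigma_additive riesz_measure.
Proof.
move=> F mF tF mUF; apply: (@caratheodory_measure_sigma_additive R V riesz_outer) => //.
- by move=> i; exact: borel_riesz_caratheodory.
- exact: borel_riesz_caratheodory.
Qed.

HB.instance Definition _ := isMeasure.Build _ _ _ riesz_measure
  riesz_measure0 riesz_measure_ge0 riesz_measure_sigma_additive.

Lemma riesz_measureT : riesz_measure setT = 1%E.
Proof.
apply/eqP; rewrite eq_le riesz_outer_le1/=; apply: le_ereal_inf_tmp.
move=> _ [f [cf f0 f1] <-].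
rewrite -[1%E]/((1 : R)%:E) -[X in (X%:E <= _)%E]L1.
apply: positive_functional_dini => // [|x Kx]; first exact: cst_continuous.
exact: f1.
Qed.

HB.instance Definition _ :=
  Measure_isProbability.Build _ _ _ riesz_measure riesz_measureT.

(** Slicing [N * f] at the integer heights, each slice dominates the indicator of
    a superlevel set, so the measure of this set is at most the value of [L] on
    the slice. *)
Lemma integral_riesz_le (f : V -> R) (C : R) :
  continuous f -> (forall x, 0 <= f x <= C) ->
  (\int[riesz_measure]_x (f x)%:E <= (L f)%:E)%E.
Proof.
move=> cf fC.
have f0 x : 0 <= f x by have /andP[] := fC x.
apply/lee_addgt0Pr => _/posnumP[e].
pose N := (Num.truncn (e%:num^-1)).+1.
have N0 : 0 < N%:R :> R by rewrite ltr0n.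
have Ne : N%:R^-1 <= e%:num.
  by rewrite -[leRHS]invrK lef_pV2 ?posrE ?invr_gt0// ltW// truncnS_gt.
pose J := (Num.truncn (N%:R * C)).+1.
have fJ x : N%:R * f x <= J%:R.
  rewrite (@le_trans _ _ (N%:R * C))//; last by rewrite ltW// truncnS_gt.
  by rewrite ler_wpM2l//; have /andP[] := fC x.
pose g (j : nat) x := Num.min 1 (Num.max 0 (N%:R * f x - j%:R)).
have cNf : continuous (fun x => N%:R * f x).
  by apply: continuous_mulf => //; exact: cst_continuous.
have cg j : continuous (g j).
  move=> x; apply: (@continuous_min _ _ (cst 1) (fun x => Num.max 0 (N%:R * f x - j%:R))).
    exact: cst_continuous.
  apply: (@continuous_max _ _ (cst 0) (fun x => N%:R * f x - j%:R)).
    exact: cst_continuous.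
  by apply: continuous_subf => //; exact: cst_continuous.
have g0 j x : 0 <= g j x by rewrite /g le_min ler01 le_max lexx.
have gsum x : \sum_(j < J) g j x = N%:R * f x.
  by rewrite clip_sum ?min_l// mulr_ge0// ltW.
pose A (j : nat) : set (borel_rV R d) := [set x | j.+1%:R <= N%:R * f x].
have mA j : measurable (A j).
  rewrite (_ : A j = setT `&` (fun x => N%:R * f x) @^-1` `[j.+1%:R, +oo[).
    exact: continuous_measurable_rV cNf _ _ (measurable_itv _).
  by rewrite setTI; apply/seteqP; split => x /=; rewrite in_itv/= andbT.
have Ag j : (riesz_measure (A j) <= (L (g j))%:E)%E.
  apply: riesz_outer_le_one => // x Ax _; rewrite /g le_min lexx/= le_max.
  by apply/orP; right; move: Ax; rewrite /A/= -natr1; lra.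
have mf : measurable_fun [set: borel_rV R d] f by exact: continuous_measurable_rV.
have fA x : N%:R * f x <= 1 + \sum_(j < J) \1_(A j) x.
  rewrite -gsum /J big_ord_recl/= lerD//; first by rewrite /g ge_min lexx.
  rewrite [leRHS]big_ord_recr/= -[leLHS]addr0 lerD//.
  apply: ler_sum => j _; rewrite /g /bump/= add1n indicE.
  case: (boolP (x \in A j)) => [_|]; first by rewrite ge_min lexx.
  rewrite notin_setE /A/= => /negP; rewrite -ltNge => h.
  by rewrite ge_min ge_max lexx/= subr_le0 (ltW h) orbT.
have intNf : (\int[riesz_measure]_x (N%:R * f x)%:E =
    N%:R%:E * \int[riesz_measure]_x (f x)%:E)%E.
  under eq_integral do rewrite EFinM.
  rewrite ge0_integralZl_EFin//.
  - by move=> x _; rewrite lee_fin.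
  - exact/measurable_EFinP.
have : (\int[riesz_measure]_x (N%:R * f x)%:E <=
    1 + \sum_(j < J) riesz_measure (A j))%E.
  apply: (@le_trans _ _ (\int[riesz_measure]_x
      (1 + \sum_(j < J) (\1_(A j) x)%:E))%E).
    apply: ge0_le_integral => //.
    - by move=> x _; rewrite lee_fin mulr_ge0// ltW.
    - by apply/measurable_EFinP; exact: continuous_measurable_rV.
    - apply: emeasurable_funD => //; apply: emeasurable_sum => j.
      by apply/measurable_EFinP; exact: measurable_indic.
    - by move=> x _; rewrite sumEFin -EFinD lee_fin.
  rewrite ge0_integralD//; last 2 first.
  - by move=> x _; rewrite sume_ge0.
  - by apply: emeasurable_sum => j; apply/measurable_EFinP; exact: measurable_indic.
  rewrite integral_cst//.
  rewrite [X in (_ * X + _)%E](riesz_measureT : riesz_measure [set: borel_rV R d] = _).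
  rewrite mule1 leeD2l//.
  rewrite ge0_integral_sum//.
    by apply: lee_sum => j _; rewrite integral_indic// setIT.
  by move=> j; apply/measurable_EFinP; exact: measurable_indic.
rewrite intNf => /le_trans -/(_ (1 + (N%:R * L f)%:E)%E) H.
have {}H : (N%:R%:E * \int[riesz_measure]_x (f x)%:E <= 1 + (N%:R * L f)%:E)%E.
  apply: H; rewrite leeD2l//.
  rewrite -LZ// (_ : (fun x => _) = (fun x => \sum_(j < J) g j x)); last first.
    by apply/funext => x; rewrite gsum.
  by rewrite positive_functional_sum// -sumEFin; apply: lee_sum => j _.
rewrite -(@lee_pmul2l _ N%:R%:E)//.
apply: (le_trans H); rewrite addeC -EFinD -EFinD -EFinM lee_fin mulrDr lerD2l.
by rewrite -ler_pdivrMl// mulr1.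
Qed.

(** The inequality between the integral and [L], applied to [f + C] and to
    [- f + C], is an equality. *)
Lemma riesz_representation : exists m : probability (borel_rV R d) R,
  forall (f : V -> R) C, continuous f -> (forall x, `|f x| <= C) ->
    \int[m]_x f x = L f.
Proof.
exists riesz_measure => f C cf fC.
have mf : measurable_fun [set: borel_rV R d] f by exact: continuous_measurable_rV.
have C0 : 0 <= C by exact: le_trans (normr_ge0 _) (fC 0).
have intf : riesz_measure.-integrable setT (EFin \o f).
  apply: measurable_bounded_integrable => //.
    by rewrite (le_lt_trans (riesz_outer_le1 _))// ltry.
  by exists C; split; [exact: num_real|move=> M CM x _ /=; rewrite (le_trans (fC x))// ltW].
have intC : riesz_measure.-integrable setT (EFin \o cst C).
  by apply: finite_measure_integrable_cst; exact: (@measurableT _ (borel_rV R d)).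
have H (g : V -> R) : continuous g -> (forall x, `|g x| <= C) ->
    riesz_measure.-integrable setT (EFin \o g) -> \int[riesz_measure]_x g x <= L g.
  move=> cg gC intg.
  have gC' x : 0 <= g x + C <= 2 * C.
    by have := gC x; rewrite ler_norml => /andP[? ?]; apply/andP; split; lra.
  have cgC : continuous (fun x => g x + C).
    by move=> x; apply: continuousD; [exact: cg|exact: cst_continuous].
  have := integral_riesz_le cgC gC'.
  rewrite LD//; last exact: cst_continuous.
  rewrite positive_functional_cst => h.
  rewrite -(lerD2r C).
  have -> : \int[riesz_measure]_x g x + C = \int[riesz_measure]_x (g x + C).
    rewrite (RintegralD measurableT intg intC); congr +%R.
    rewrite (Rintegral_cst _ measurableT).
    rewrite -[LHS]mulr1; congr (_ * _).
    by rewrite [X in fine X](riesz_measureT : riesz_measure [set: borel_rV R d] = _).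
  rewrite -lee_fin; apply: le_trans h; rewrite /Rintegral fineK//.
  by apply: integrable_fin_num => //; exact: (integrableD _ intg intC).
apply/eqP; rewrite eq_le H//=.
have := H (fun x => -1 * f x).
rewrite LZ// RintegralZl// !mulN1r lerN2; apply.
- by apply: continuous_mulf => //; exact: cst_continuous.
- by move=> x; rewrite mulN1r normrN.
- by apply: (eq_integrable _ _ _ _ (integrableZl _ (-1) intf)).
Qed.

End RieszOuterMeasure.

(** * Invariant measures and mean velocities *)

Section ProbabilityIntegrals.
Context {dT : measure_display} {T : measurableType dT} {R : realType}.
Variables (mu : probability T R) (D : set T).
Hypothesis mD : measurable D.

Lemma bounded_integrable (f : T -> R) C : measurable_fun D f ->
  (forall x, D x -> `|f x| <= C) -> mu.-integrable D (EFin \o f).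
Proof.
move=> mf fC; apply: measurable_bounded_integrable => //.
  by rewrite (le_lt_trans (probability_le1 _ mD))// ltry.
exists C; split; first exact: num_real.
by move=> M CM x /= Dx; rewrite (le_trans (fC x Dx))// ltW.
Qed.

Lemma Rintegral_norm_le (f : T -> R) C : 0 <= C -> measurable_fun D f ->
  (forall x, D x -> `|f x| <= C) -> `|\int[mu]_(x in D) f x| <= C.
Proof.
move=> C0 mf fC; have intf := bounded_integrable mf fC.
rewrite (le_trans (le_normr_Rintegral mD intf))//.
rewrite (@le_trans _ _ (\int[mu]_(x in D) C))//.
  apply: le_Rintegral => //.
  - apply: (@bounded_integrable _ C); first exact: measurableT_comp.
    by move=> x Dx; rewrite normr_id fC.
  - exact: (@bounded_integrable _ `|C|).
rewrite Rintegral_cst// ler_piMr// -lee_fin fineK ?probability_le1//.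
by rewrite ge0_fin_numE// (le_lt_trans (probability_le1 _ mD))// ltry.
Qed.

Lemma Rintegral_dominated (f_ : nat -> T -> R) (f g : T -> R) :
  (forall n, measurable_fun D (f_ n)) ->
  (forall x, D x -> f_ ^~ x @ \oo --> f x) ->
  mu.-integrable D (EFin \o g) -> (forall n x, D x -> `|f_ n x| <= g x) ->
  mu.-integrable D (EFin \o f) /\
  \int[mu]_(x in D) f_ n x @[n --> \oo] --> \int[mu]_(x in D) f x.
Proof.
move=> mf ff intg fg.
have mlim : measurable_fun D f.
  exact: (measurable_fun_cvg mf).
have [||||intf _ cvgf] := @dominated_convergence _ _ _ mu D mD
  (fun n => EFin \o f_ n) (EFin \o f) (EFin \o g) _ _ _ intg _.
- by move=> n; exact/measurable_EFinP.
- exact/measurable_EFinP.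
- apply: aeW => x Dx; apply: cvg_EFin; last exact: ff.
  exact: nearW.
- by apply: aeW => x n Dx; rewrite /= lee_fin fg.
split => //; apply: fine_cvg; move: cvgf; rewrite fineK//.
exact: integrable_fin_num.
Qed.

End ProbabilityIntegrals.

Section TorusMeasures.
Context {R : realType} {d : nat}.
Local Notation V := 'rV[R]_d.

Lemma measurable_coord_rV i : measurable_fun [set: borel_rV R d] (fun x : V => x 0 i).
Proof. by apply: continuous_measurable_rV; exact: coord_continuous. Qed.

Lemma measurable_unit_cell : measurable (unit_cell R d : set (borel_rV R d)).
Proof.
rewrite (_ : unit_cell R d = \bigcap_(i in [set: 'I_d])
    ((fun x : V => x 0 i) @^-1` `[0, 1[)); last first.
  apply/seteqP; split => x /= xc i; first by move=> _ /=; rewrite in_itv/=; exact: xc.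
  by have := xc i Logic.I; rewrite /= in_itv.
apply: fin_bigcap_measurable => [|i _]; first exact: finite_finset.
rewrite -[X in measurable X]setTI.
exact: measurable_coord_rV (measurable_itv _).
Qed.

Lemma measurable_floor : measurable_fun [set: R] (fun x : R => (Num.floor x)%:~R : R).
Proof.
apply: nondecreasing_measurable => // x y xy.
by rewrite ler_int le_floor.
Qed.

Lemma measurable_frac_row : measurable_fun [set: borel_rV R d]
  (frac_row : V -> borel_rV R d).
Proof.
pose fr (x : borel_rV R d) : d.-tuple (measurableTypeR R) :=
  [tuple (x : V) 0 i - (Num.floor ((x : V) 0 i))%:~R | i < d].
rewrite (_ : frac_row = @row_of_tuple R d \o fr); last first.
  by apply/funext => x; apply/rowP => i; rewrite !mxE tnth_mktuple.
apply: measurableT_comp; first exact: measurable_row_of_tuple.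
apply/measurable_fun_tnthP => i.
rewrite (_ : _ \o _ = fun x : borel_rV R d =>
   ((x : V) 0 i - (Num.floor ((x : V) 0 i))%:~R)); last first.
  by apply/funext => x /=; rewrite tnth_mktuple.
apply: measurable_funB; first exact: measurable_coord_rV.
exact: (measurableT_comp measurable_floor (measurable_coord_rV i)).
Qed.

HB.instance Definition _ := isMeasurableFun.Build _ _ _ _
  (frac_row : borel_rV R d -> borel_rV R d) measurable_frac_row.

Lemma measurable_periodic_C0 psi : periodic_C0 psi ->
  measurable_fun [set: borel_rV R d] psi.
Proof. by move=> [_ cpsi]; exact: continuous_measurable_rV. Qed.

Lemma periodic_C0_integrable (mu : probability (borel_rV R d) R) g :
  periodic_C0 g -> mu.-integrable (unit_cell R d) (EFin \o g).
Proof.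
move=> gC0; have [D D0 gD] := periodic_bounded gC0.1 gC0.2.
apply: (@bounded_integrable _ _ _ _ _ measurable_unit_cell _ D) => //.
exact: measurable_funTS (measurable_periodic_C0 gC0).
Qed.

Lemma periodic_C0_mul (f g : V -> R) : periodic_C0 f -> periodic_C0 g ->
  periodic_C0 (fun x => f x * g x).
Proof.
move=> [pf cf] [pg cg]; split; first by move=> x k; rewrite pf pg.
exact: continuous_mulf.
Qed.

Lemma periodic_C0_cst (c : R) : periodic_C0 (fun _ : V => c).
Proof. by split => //; exact: cst_continuous. Qed.

Lemma periodic_C0_sub (f g : V -> R) : periodic_C0 f -> periodic_C0 g ->
  periodic_C0 (fun x => f x - g x).
Proof.
move=> [pf cf] [pg cg]; split; first by move=> x k; rewrite pf pg.
exact: continuous_subf.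
Qed.

(** A measure representing [L] on the closed cube is moved to the half-open unit
    cell by taking fractional parts; periodic functions do not see the move. *)
Lemma torus_riesz L : positive_functional unit_cube L ->
  exists mu : probability (borel_rV R d) R, mu (unit_cell R d) = 1%E /\
    forall psi, periodic_C0 psi -> \int[mu]_(y in unit_cell R d) psi y = L psi.
Proof.
move=> posL; have [m mP] := riesz_representation compact_unit_cube posL.
exists (distribution m (frac_row : borel_rV R d -> borel_rV R d)).
have frac_cell : (frac_row : borel_rV R d -> borel_rV R d) @^-1` unit_cell R d = setT.
  by apply/seteqP; split => // x _; exact: frac_row_unit_cell.
split.
  by rewrite -[RHS](probability_setT m) -[in RHS]frac_cell.
move=> psi psiC0; have [ppsi cpsi] := psiC0.
have [C C0 psiC] := periodic_bounded ppsi cpsi.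
have mpsi := measurable_periodic_C0 psiC0.
rewrite -(mP psi C)// /Rintegral /distribution integral_pushforward//.
- rewrite frac_cell; congr fine; apply: eq_integral => x _ /=.
  by rewrite periodic_frac.
- exact/measurable_EFinP.
- rewrite frac_cell.
  apply: (@bounded_integrable _ _ _ m setT measurableT (psi \o frac_row) C).
    exact: measurableT_comp mpsi measurable_frac_row.
  by move=> x _; exact: psiC.
- exact: measurable_unit_cell.
Qed.

End TorusMeasures.

Section InvariantFunctionals.
Context {R : realType} {d : nat}.
Local Notation V := 'rV[R]_d.

Lemma invariant_functional (B : V -> V) K M L :
  lipschitz_bounded B K M -> Zd_periodic B -> positive_functional unit_cube L ->
  (forall t psi, periodic_C0 psi -> L (fun y => psi (flow B t y)) = L psi) ->
  exists2 mu, invariant_probability B mu &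
    forall psi, periodic_C0 psi -> \int[mu]_(y in unit_cell R d) psi y = L psi.
Proof.
move=> BKM pB posL Linv; have [mu [mu1 muL]] := torus_riesz posL.
exists mu => //; split => // t psi psiC0.
by rewrite !muL ?Linv//; exact: (periodic_C0_flow BKM).
Qed.

Lemma periodic_C0_coord (B : V -> V) K M i : lipschitz_bounded B K M ->
  Zd_periodic B -> periodic_C0 (fun x => B x 0 i).
Proof.
move=> BKM pB; split=> [x k|x]; first by rewrite pB.
apply: (@continuous_comp _ _ _ B (fun y : V => y 0 i)).
  exact: lipschitz_bounded_continuous BKM _.
exact: coord_continuous.
Qed.

Lemma density_integrable (mu : probability (borel_rV R d) R)
    (D : set (borel_rV R d)) (w f : V -> R) : measurable D -> D `<=` unit_cube ->
  mu.-integrable D (EFin \o w) -> continuous f ->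
  mu.-integrable D (EFin \o (fun y => w y * f y)).
Proof.
move=> mD DK intw cf; have [C fC] := continuous_unit_cube_bounded cf.
apply: (@integrableMl _ _ _ mu D mD (EFin \o w) f intw).
  exact: measurable_funTS (continuous_measurable_rV cf).
exists C; split; first exact: num_real.
by move=> r Cr x Dx /=; rewrite (le_trans (fC _ (DK _ Dx)))// ltW.
Qed.

Lemma density_positive_functional (mu : probability (borel_rV R d) R)
    (D : set (borel_rV R d)) (w : V -> R) (m : R) :
  measurable D -> D `<=` unit_cube -> (forall x, D x -> 0 <= w x) ->
  mu.-integrable D (EFin \o w) -> 0 < m -> \int[mu]_(y in D) w y = m ->
  positive_functional unit_cube
    (fun f => m^-1 * \int[mu]_(y in D) (w y * f y)).
Proof.
move=> mD DK w0 intw m0 wm; split.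
- move=> f g cf cg; under eq_Rintegral do rewrite mulrDr.
  by rewrite RintegralD ?mulrDr//; exact: density_integrable.
- move=> a f cf.
  have -> : \int[mu]_(y in D) (w y * (a * f y)) =
      a * \int[mu]_(y in D) (w y * f y).
    rewrite -(RintegralZl a mD (density_integrable mD DK intw cf)).
    by apply: eq_Rintegral => y _; rewrite mulrCA.
  by rewrite mulrCA.
- move=> f cf f0; rewrite mulr_ge0 ?invr_ge0 ?(ltW m0)//.
  by apply: Rintegral_ge0 => x Dx; rewrite mulr_ge0 ?w0// f0//; exact: DK.
- by under eq_Rintegral do rewrite mulr1; rewrite wm mulVf// gt_eqF.
Qed.

Lemma eval_positive_functional (z : V) : unit_cube z ->
  positive_functional unit_cube (fun f : V -> R => f z).
Proof. by move=> Kz; split => // f _ /(_ z Kz). Qed.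

Lemma convex_positive_functional (L L' : (V -> R) -> R) (s : R) : 0 <= s <= 1 ->
  positive_functional unit_cube L -> positive_functional unit_cube L' ->
  positive_functional unit_cube (fun f => (1 - s) * L f + s * L' f).
Proof.
move=> /andP[s0 s1] [LD LZ L0 L1] [L'D L'Z L'0 L'1]; split.
- by move=> f g cf cg; rewrite LD// L'D//; ring.
- by move=> a f cf; rewrite LZ// L'Z//; ring.
- move=> f cf f0; apply: addr_ge0; apply: mulr_ge0; rewrite ?subr_ge0//.
    exact: L0.
  exact: L'0.
- by rewrite L1 L'1; ring.
Qed.

End InvariantFunctionals.

Section UltrafilterLimits.
Context {R : realType} {T : Type} (F : set_system T) {FF : UltraFilter F}.

(** Along an ultrafilter every bounded function converges, by compactness; such
    limits are linear and defined for all continuous functions at once. *)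
Lemma ultrafilter_bounded_cvg (h : T -> R) C :
  (\forall t \near F, `|h t| <= C) -> cvg (h @ F).
Proof.
move=> hC.
have PF : ProperFilter F by exact: ultra_proper.
have UF : UltraFilter (h @ F).
  split; first exact: fmap_proper_filter.
  move=> G PG hFG; apply/seteqP; split => // A GA.
  have [//|FnA] := in_ultra_setVsetC (h @^-1` A) FF.
  have GnA : G (~` A) by apply: hFG.
  have : G (A `&` ~` A) by exact: filterI.
  by rewrite setICr => /filter_not_empty.
have := @segment_compact R (- C) C; rewrite compact_ultra => /(_ _ UF).
case.
  by near=> t; rewrite /= in_itv/= -ler_norml; near: t.
by move=> p [_ hp]; apply/cvg_ex; exists p.
Unshelve. all: by end_near. Qed.

End UltrafilterLimits.

Section TimeAverages.
Context {R : realType}.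

Lemma Rintegral_primitive (f F : R -> R) (a b : R) : a <= b -> continuous f ->
  (forall t, is_derive t (1 : R) F (f t)) ->
  \int[@lebesgue_measure R]_(t in `[a, b]) f t = F b - F a.
Proof.
move=> ab cf dF; case: (ltgtP a b) ab => // [ab _|-> _]; last first.
  by rewrite set_itv1 Rintegral_set1 subrr.
rewrite /Rintegral (@continuous_FTC2 _ f F a b ab) ?EFinN//.
- exact: continuous_subspaceT.
- have cF : continuous F by move=> t; exact: is_derive_continuous (dF t).
  split => [x _||]; first by have [] := dF x.
  + apply: cvg_at_right_filter; exact: cF.
  + apply: cvg_at_left_filter; exact: cF.
- by move=> x _; rewrite derive1E; have [] := dF x.
Qed.

End TimeAverages.

Section KrylovBogoliubov.
Context {R : realType} {d : nat}.
Local Notation V := 'rV[R]_d.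
Variables (B : V -> V) (K M : R).
Hypothesis BKM : lipschitz_bounded B K M.
Hypothesis pB : Zd_periodic B.
Variables (F : set_system R) (x0 : V).
Hypothesis FF : UltraFilter F.
Hypothesis Fy : +oo%R `<=` F.

Local Notation leb := (@lebesgue_measure R).
#[local] Instance ultra_proper_time : ProperFilter F.
Proof. exact: ultra_proper. Qed.

Let Fgt0 : \forall T \near F, 0 < T.
Proof. by apply: Fy; exact: nbhs_pinfty_gt. Qed.

Lemma near_div_le (c e : R) : 0 < e -> \forall T \near F, c * T^-1 <= e.
Proof.
move=> e0; near=> T; have T0 : 0 < T by near: T.
rewrite ler_pdivrMr// mulrC -ler_pdivrMr//; near: T.
by apply: Fy; apply: nbhs_pinfty_ge; exact: num_real.
Unshelve. all: by end_near. Qed.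

Let orbit (s : R) : borel_rV R d := frac_row (flow B s x0).

Lemma measurable_orbit : measurable_fun [set: R] orbit.
Proof.
apply: (measurableT_comp measurable_frac_row).
apply: (@measurability _ _ _ (borel_rV R d) _ _ (@open 'rV[R]_d)) => //.
move=> _ [U oU <-]; rewrite setTI; apply: open_measurable.
by have /continuousP := @flow_continuous_time _ _ _ _ _ BKM x0; apply.
Qed.

Definition time_average (f : V -> R) (T : R) : R :=
  T^-1 * \int[leb]_(s in `[0, T]) f (orbit s).

Let orbit_integrable (f : V -> R) C T : continuous f ->
  (forall x, unit_cube x -> `|f x| <= C) ->
  leb.-integrable `[0, T] (EFin \o (f \o orbit)).
Proof.
move=> cf fC; apply: measurable_bounded_integrable => //.
- by rewrite /= lebesgue_measure_itv/=; case: ifPn => _ //; rewrite -EFinD ltry.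
- apply: (@measurable_funTS _ _ _ _ `[0, T]%classic (f \o orbit)).
  exact: measurableT_comp (continuous_measurable_rV cf) measurable_orbit.
- exists C; split; first exact: num_real.
  move=> r Cr t _ /=; rewrite (le_trans (fC _ _)) ?(ltW Cr)//.
  exact/unit_cell_cube/frac_row_unit_cell.
Qed.

Lemma time_average_cvg (f : V -> R) : continuous f -> cvg (time_average f @ F).
Proof.
move=> cf; have [C fC] := continuous_unit_cube_bounded cf.
apply: (@ultrafilter_bounded_cvg _ _ _ _ _ C); near=> T.
have T0 : 0 < T by near: T.
have intf := orbit_integrable T cf fC.
rewrite /time_average normrM gtr0_norm ?invr_gt0// ler_pdivrMl//.
rewrite (le_trans (le_normr_Rintegral _ intf))//.
have -> : T * C = \int[leb]_(s in `[0, T]) C.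
  by rewrite Rintegral_cst//= lebesgue_measure_itv/= lte_fin T0/= subr0 mulrC.
apply: le_Rintegral => //.
- exact: (integrable_norm intf).
- by apply: (@continuous_compact_integrable _ (cst C)); [exact: segment_compact|exact: continuous_subspaceT (@cst_continuous _ _ _)].
- by move=> s _; apply: fC; exact/unit_cell_cube/frac_row_unit_cell.
Unshelve. all: by end_near. Qed.

Definition limit_average (f : V -> R) : R := lim (time_average f @ F).

Lemma limit_average_positive : positive_functional unit_cube limit_average.
Proof.
split.
- move=> f g cf cg; rewrite /limit_average -limD; [|exact: time_average_cvg..].
  congr (lim (_ @ F)); apply/funext => T; rewrite !fctE /time_average -mulrDr.
  have [C fC] := continuous_unit_cube_bounded cf.
  have [C' gC'] := continuous_unit_cube_bounded cg.
  congr (_ * _); apply: RintegralD => //.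
    exact: orbit_integrable fC.
  exact: orbit_integrable gC'.
- move=> a f cf; apply: cvg_lim => //.
  have [C fC] := continuous_unit_cube_bounded cf.
  have -> : time_average (fun x => a * f x) = (fun T => a * time_average f T).
    apply/funext => T; rewrite /time_average mulrCA; congr (_ * _).
    by rewrite (RintegralZl a _ (orbit_integrable T cf fC)).
  by apply: cvgMr; exact: time_average_cvg.
- move=> f cf f0; apply: limr_ge; first exact: time_average_cvg.
  near=> T; have T0 : 0 < T by near: T.
  apply: mulr_ge0; first by rewrite invr_ge0 ltW.
  apply: Rintegral_ge0 => s _.
  exact/f0/unit_cell_cube/frac_row_unit_cell.
- apply: cvg_lim => //; apply: cvg_near_cst; near=> T.
  have T0 : 0 < T by near: T.
  rewrite /time_average Rintegral_cst//= lebesgue_measure_itv/= lte_fin T0/=.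
  by rewrite subr0 mul1r mulVf// gt_eqF.
Unshelve. all: by end_near. Qed.

(** Flowing for a time [t] shifts the window of the average over [[0, T]], which
    changes the integral by at most [2 * C * `|t|]. *)
Lemma limit_average_shift psi t : periodic_C0 psi ->
  limit_average (fun x => psi (flow B t x)) = limit_average psi.
Proof.
move=> psiC0; have [ppsi cpsi] := psiC0.
have [C C0 psiC] := periodic_bounded ppsi cpsi.
have psitC0 := periodic_C0_flow BKM t pB psiC0.
have cpsiX : continuous (fun s => psi (flow B s x0)).
  move=> s; apply: continuous_comp; last exact: cpsi.
  exact: (@flow_continuous_time _ _ _ _ _ BKM x0 s).
have [P [P0 dP]] := primitive_exists cpsiX.
have dPt s : is_derive s (1 : R) (fun r => P (r + t)) (psi (flow B (s + t) x0)).
  have := @is_derive1_comp _ P (shift t) s _ _ (dP (s + t)) (is_derive_shift s 1 t).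
  by rewrite mulr1.
have cpsiXt : continuous (fun s => psi (flow B (s + t) x0)).
  rewrite (_ : (fun s => _) = fun s => psi (flow B s (flow B t x0))).
    move=> s; apply: continuous_comp; last exact: cpsi.
    exact: (@flow_continuous_time _ _ _ _ _ BKM (flow B t x0) s).
  by apply/funext => s; rewrite (flowD BKM).
apply/eqP; rewrite -subr_eq0 /limit_average -limB; last 2 first.
- exact: time_average_cvg psitC0.2.
- exact: time_average_cvg cpsi.
apply/eqP; apply: cvg_lim => //.
have PC r s : `|P s - P r| <= C * `|s - r|.
  by apply: (derive_lipschitz r s dP) => u; exact: psiC.
apply/cvgrPdist_le => e e0; near=> T; have T0 : 0 < T by near: T.
rewrite sub0r normrN !fctE (@le_trans _ _ (2 * C * `|t| * T^-1))//; last first.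
  by near: T; exact: near_div_le.
rewrite /time_average -mulrBr normrM.
rewrite gtr0_norm ?invr_gt0// mulrC ler_wpM2r ?invr_ge0 ?(ltW T0)//.
rewrite (_ : \int[leb]_(s in `[0, T]) psi (flow B t (orbit s)) = P (T + t) - P t); last first.
  rewrite -[X in _ - P X](add0r t).
  rewrite -(Rintegral_primitive (ltW T0) cpsiXt dPt).
  apply: eq_Rintegral => s _; rewrite (periodic_frac _ psitC0.1).
  by rewrite -(flowD BKM) addrC.
rewrite (_ : \int[leb]_(s in `[0, T]) psi (orbit s) = P T - P 0); last first.
  rewrite -(Rintegral_primitive (ltW T0) cpsiX dP).
  by apply: eq_Rintegral => s _; rewrite (periodic_frac _ ppsi).
rewrite [X in `|X|](_ : _ = (P (T + t) - P T) - (P t - P 0)); last by ring.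
rewrite (le_trans (ler_normB _ _))// (le_trans (lerD (PC _ _) (PC _ _)))//.
by rewrite subr0 [T + t]addrC addrK; lra.
Unshelve. all: by end_near. Qed.

(** The displacement of an orbit is the integral of the field along it. *)
Lemma limit_average_velocity i (l : R) :
  (fun T => (flow B T x0 0 i - x0 0 i) / T) @ F --> l ->
  limit_average (fun x => B x 0 i) = l.
Proof.
move=> cvgl; apply: cvg_lim => //; apply: cvg_trans cvgl.
apply: near_eq_cvg; near=> T; have T0 : 0 < T by near: T.
rewrite /time_average mulrC; congr (_ * _).
have dX s := (is_derive_rowP _ _ _).1 (flow_derive BKM x0 s) i.
have cBX : continuous (fun s => B (flow B s x0) 0 i).
  move=> s; apply: (@continuous_comp _ _ _ (fun s => flow B s x0) (fun y => B y 0 i)).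
    exact: (@flow_continuous_time _ _ _ _ _ BKM x0 s).
  apply: (@continuous_comp _ _ _ B (fun y : V => y 0 i)).
    exact: lipschitz_bounded_continuous BKM _.
  exact: coord_continuous.
have := Rintegral_primitive (ltW T0) cBX dX; rewrite (flow0 BKM) => <-.
by apply: eq_Rintegral => s _; rewrite (periodic_frac _ pB).
Unshelve. all: by end_near. Qed.

(** Krylov and Bogoliubov: the limit of time averages along one orbit is an
    invariant positive functional, hence an invariant measure. *)
Lemma krylov_bogoliubov : exists2 mu, invariant_probability B mu &
  forall i, limit_average (fun x => B x 0 i) = vintegral mu B 0 i.
Proof.
have [mu inv_mu muL] := invariant_functional BKM pB limit_average_positive
  (fun t psi => @limit_average_shift psi t).
exists mu => // i; rewrite mxE muL//; exact: periodic_C0_coord BKM pB.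
Qed.

End KrylovBogoliubov.

(** If every invariant measure has rotation vector [0] then all orbits have mean
    velocity [0]: along an ultrafilter witnessing the contrary, the mean
    velocity would be a nonzero rotation vector. *)
Lemma rotation0_mean_velocity (R : realType) d (B : 'rV[R]_d -> 'rV[R]_d) K M x :
  lipschitz_bounded B K M -> Zd_periodic B ->
  rotation_set B `<=` [set 0] -> t^-1 *: flow B t x @[t --> +oo%R] --> (0 : 'rV[R]_d).
Proof.
move=> BKM pB rot0; have [K0 M0 _ B_bnd] := BKM.
apply/cvgrPdist_le => e e0; apply: contrapT => nH.
pose A := [set t : R | `|0 - t^-1 *: flow B t x| <= e].
have PA : ProperFilter (within (~` A) +oo%R).
  split=> [H|]; last exact: within_filter.
  by apply: nH; move: H; rewrite /within/=; apply: filterS => t /contrapT.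
have [F [FF FA]] := ultraFilterLemma PA.
have PF : ProperFilter F by exact: ultra_proper.
have Fy : +oo%R `<=` F.
  by move=> S yS; apply: FA; apply: filterS yS => t St _.
have FnA : F (~` A) by apply: FA; exact: withinT.
have Fgt0 : \forall T \near F, 0 < T by apply: Fy; exact: nbhs_pinfty_gt.
have [mu invmu muL] := krylov_bogoliubov BKM pB x FF Fy.
have mu0 : vintegral mu B = 0 by apply: rot0; exists mu.
have cvg0 i : (fun T => (flow B T x 0 i - x 0 i) / T) @ F --> 0.
  have c : cvg ((fun T => (flow B T x 0 i - x 0 i) / T) @ F).
    apply: (@ultrafilter_bounded_cvg _ _ _ _ _ M); near=> T.
    have T0 : 0 < T by near: T.
    rewrite normrM normfV [X in _ / X]gtr0_norm// ler_pdivrMr//.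
    have := flow_lipschitz_time BKM x 0 T; rewrite (flow0 BKM) subr0 [`|T|]gtr0_norm//.
    apply: le_trans; have := norm_coord_le (flow B T x - x) i.
    by rewrite !mxE.
  have /(limit_average_velocity BKM pB FF Fy) := c.
  rewrite muL mu0 mxE => H; have : (fun T => (flow B T x 0 i - x 0 i) / T) @ F -->
      lim ((fun T => (flow B T x 0 i - x 0 i) / T) @ F) by exact: c.
  by rewrite -H.
have FA' : F A.
  have : \forall t \near F, forall i, `|(flow B t x 0 i - x 0 i) / t| <= e / 2.
    apply: filter_forall => i; have /cvgrPdist_le/(_ (e / 2)) := cvg0 i.
    rewrite divr_gt0// => /(_ isT); apply: filterS => t.
    by rewrite sub0r normrN.
  move=> H; near=> t; have t0 : 0 < t by near: t.
  rewrite /A/= sub0r normrN; apply: row_norm_le => [|i]; first exact: ltW.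
  rewrite mxE.
  have h1 : `|(flow B t x 0 i - x 0 i) / t| <= e / 2 by move: i; near: t.
  have h2 : `|x| * t^-1 <= e / 2.
    by near: t; apply: near_div_le => //; rewrite divr_gt0.
  rewrite [X in `|X|](_ : _ = (flow B t x 0 i - x 0 i) / t + x 0 i / t); last by ring.
  rewrite (le_trans (ler_normD _ _))// (splitr e) lerD//.
  rewrite normrM normfV [X in _ / X]gtr0_norm// (le_trans _ h2)//.
  by rewrite ler_wpM2r ?invr_ge0 ?(ltW t0)// norm_coord_le.
have : F (A `&` ~` A) by exact: filterI.
by rewrite setICr => /filter_not_empty.
Unshelve. all: by end_near. Qed.

(** * Time changes *)

Section OrbitAverage.
Context {R : realType} {d : nat}.
Local Notation V := 'rV[R]_d.

Lemma continuous_eps_delta (U W : normedModType R) (f : U -> W) :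
  (forall y e, 0 < e -> exists2 dlt : R, 0 < dlt &
    forall z, `|y - z| <= dlt -> `|f y - f z| <= e) -> continuous f.
Proof.
move=> H y; apply/cvgrPdist_le => e e0; have [dlt dlt0 fdlt] := H y e e0.
by near=> z; apply: fdlt; near: z; exact: cvgr_dist_le.
Unshelve. all: by end_near. Qed.

Lemma primitive_unique (F G f : R -> R) : F 0 = G 0 ->
  (forall t, is_derive t (1 : R) F (f t)) ->
  (forall t, is_derive t (1 : R) G (f t)) -> F = G.
Proof.
move=> FG0 dF dG; apply/funext => t; apply/eqP; rewrite -subr_eq0.
have dFG s : is_derive s (1 : R) (F - G) 0.
  by rewrite -(subrr (f s)); apply: is_deriveB.
by have /eqP := is_derive_0_is_cst t 0 dFG; rewrite !fctE FG0 subrr.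
Qed.

Lemma is_derive0_cvg_seq (g : R -> R) l : is_derive (0 : R) (1 : R) g l ->
  n.+1%:R * (g n.+1%:R^-1 - g 0) @[n --> \oo] --> l.
Proof.
move=> [dg <-]; have h0 : (fun n => n.+1%:R^-1 : R) @ \oo --> (0 : R)^'.
  move=> A A0; change (\forall n \near \oo, A (n.+1%:R^-1)).
  have : \forall n \near \oo, (n.+1%:R^-1 : R) != 0 -> A n.+1%:R^-1.
    exact: (@cvg_harmonic R _ A0).
  by apply: filterS => n; apply; rewrite invr_eq0 pnatr_eq0.
apply: cvg_trans (cvg_comp _ _ h0 dg); apply: near_eq_cvg; near=> n.
by rewrite /= addr0 [_ *: 1]mulr1 invrK.
Unshelve. all: by end_near. Qed.

(** Weighting by [w] an invariant measure of [w B] gives one of [B]. With [F y]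
    the integral of [psi] over a piece of the [B]-orbit of [y], the derivative of
    [F] along [w B] at [y] is [w y] times the increment of [psi] along that
    piece, and derivatives along an invariant flow integrate to [0]. The field
    being only Lipschitz, [F] need not be differentiable in space, but it is
    along orbits. *)
Lemma time_change_invariant (B : V -> V) (w : V -> R) (K M K' M' : R)
    (mu : probability (borel_rV R d) R) (s : R) (psi : V -> R) :
  lipschitz_bounded B K M -> Zd_periodic B -> periodic_C0 w ->
  lipschitz_bounded (fun x => w x *: B x) K' M' ->
  invariant_probability (fun x => w x *: B x) mu -> periodic_C0 psi ->
  \int[mu]_(y in unit_cell R d) (w y * psi (flow B s y)) =
  \int[mu]_(y in unit_cell R d) (w y * psi y).
Proof.
move=> BKM pB wC0 wBKM [_ inv_mu].
(* Invariance in negative time follows by applying it to [psi] flowed. *)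
wlog s0 : s psi / 0 <= s.
  move=> H psiC0; case: (leP 0 s) => [|/ltW] s0; first exact: H.
  rewrite -(H (- s) (fun x => psi (flow B s x))) ?oppr_ge0//.
    apply: eq_Rintegral => y _.
    by rewrite -(flowD BKM) subrr (flow0 BKM).
  exact: (periodic_C0_flow BKM).
move=> psiC0; have [ppsi cpsi] := psiC0; have [pw cw] := wC0.
have [C C0 psiC] := periodic_bounded ppsi cpsi.
have [W W0 wW] := periodic_bounded pw cw.
have pwB : Zd_periodic (fun x => w x *: B x) by move=> x k; rewrite pw pB.
set X := flow (fun x => w x *: B x) in inv_mu *.
have /choice[I IP] (f : R -> R) : exists F : R -> R, continuous f ->
    F 0 = 0 /\ forall t, is_derive t (1 : R) F (f t).
  have [cf|ncf] := pselect (continuous f); last by exists f.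
  by have [F FP] := primitive_exists cf; exists F.
have cpsiY y : continuous (fun r => psi (flow B r y)).
  move=> r; apply: continuous_comp; last exact: cpsi.
  exact: (@flow_continuous_time _ _ _ _ _ BKM y r).
have cwX y : continuous (fun r => w (X r y)).
  move=> r; apply: continuous_comp; last exact: cw.
  exact: (@flow_continuous_time _ _ _ _ _ wBKM y r).
pose P y := I (fun r => psi (flow B r y)).
have P0 y : P y 0 = 0 by exact: (IP _ (cpsiY y)).1.
have dP y t : is_derive t (1 : R) (P y) (psi (flow B t y)).
  exact: (IP _ (cpsiY y)).2.
pose tau y := I (fun r => w (X r y)).
have tau0 y : tau y 0 = 0 by exact: (IP _ (cwX y)).1.
have dtau y t : is_derive t (1 : R) (tau y) (w (X t y)).
  exact: (IP _ (cwX y)).2.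
pose F y := P y s.
have FY h y : F (flow B h y) = P y (s + h) - P y h.
  apply: (congr1 (fun f => f s)
    (_ : P (flow B h y) = fun r => P y (r + h) - P y h)).
  apply: (@primitive_unique _ _ (fun r => psi (flow B r (flow B h y)))).
  - by rewrite P0 add0r subrr.
  - move=> r; rewrite -(flowD BKM) -[psi _]subr0.
    apply: is_deriveB.
    have := @is_derive1_comp _ (P y) (shift h) r _ _ (dP y (r + h)) (is_derive_shift r 1 h).
    by rewrite mulr1.
(* Both sides solve the equation of field [B] with the factor [w (X t y)]. *)
have XY h y : X h y = flow B (tau y h) y.
  apply: (congr1 (fun f => f h)
    (_ : (fun t => X t y) = fun t => flow B (tau y t) y)).
  apply: (ode_unique BKM (c := fun t => w (X t y)) (C := W)) => //.
  - exact: (flow_derive wBKM).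
  - move=> t; apply: (@is_derive_row_comp _ _ (fun r => flow B r y) (tau y)).
    exact: (flow_derive BKM).
  - by rewrite tau0 (flow0 BKM) /X (flow0 wBKM).
have FC0 : periodic_C0 F.
  split.
    move=> y k; rewrite /F /P; congr (I _ s); apply/funext => r.
    by rewrite (flow_periodic BKM)// ppsi.
  apply: continuous_eps_delta => y _/posnumP[e].
  have s1 : 0 < s + 1 by rewrite ltr_wpDl.
  have es0 : 0 < e%:num / (s + 1) by rewrite divr_gt0.
  have [dlt dlt0 psidlt] := periodic_unif_continuous ppsi cpsi es0.
  pose E := 2 * expR (2 * K * s).
  have E0 : 0 < E by rewrite mulr_gt0// expR_gt0.
  exists (dlt / E) => [|z yz]; first by rewrite divr_gt0.
  have dc t : is_derive t (1 : R) (fun r => e%:num / (s + 1) * r) (e%:num / (s + 1)).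
    by rewrite -[X in is_derive _ _ _ X]mulr1; apply: is_deriveZ.
  have := derive_norm_le_increment s0 (fun t => is_deriveB (dP y t) (dP z t)) dc.
  rewrite !fctE !P0 subrr subr0 mulr0 subr0 => H.
  apply: (@le_trans _ _ (e%:num / (s + 1) * s)); last first.
    by rewrite -mulrA ler_piMr// mulrC ler_pdivrMr// mul1r lerDl.
  apply: H => r /andP[r0 rs]; apply: psidlt.
  rewrite (le_trans (flow_lipschitz BKM r y z))//.
  apply: (@le_trans _ _ (E * (dlt / E))); last by rewrite mulrC divfK// gt_eqF.
  rewrite ler_pM// ?mulr_ge0 ?expR_ge0// /E ler_pM2l// ler_expR.
  by have [K0 _ _ _] := BKM; rewrite ler_pM2l ?mulr_gt0// ger0_norm.
pose h_ n : R := n.+1%:R^-1.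
have h_gt0 n : 0 < h_ n by rewrite invr_gt0.
pose f_ n y := n.+1%:R * (F (X (h_ n) y) - F y).
pose f y := w y * (psi (flow B s y) - psi y).
have gE y h : F (X h y) = P y (s + tau y h) - P y (tau y h) by rewrite XY FY.
pose G y t := P y (s + t) - P y t.
have dG y t : is_derive t (1 : R) (G y) (psi (flow B (s + t) y) - psi (flow B t y)).
  apply: is_deriveB.
  have := @is_derive1_comp _ (P y) (shift s) t _ _ (dP y (t + s)) (is_derive_shift t 1 s).
  rewrite mulr1 [t + s]addrC; congr is_derive; apply/funext => r /=.
  by rewrite addrC.
have FXG y h : F (X h y) = G y (tau y h) by rewrite gE.
have mF : measurable_fun [set: borel_rV R d] F by exact: measurable_periodic_C0.
have FXC0 n : periodic_C0 (fun y => F (X (h_ n) y)).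
  exact: (periodic_C0_flow wBKM).
have mFX n := measurable_periodic_C0 (FXC0 n).
have mf_ n : measurable_fun [set: borel_rV R d] (f_ n).
  apply: measurable_funM; first exact: measurable_cst.
  exact: measurable_funB.
have int_f_ n : \int[mu]_(y in unit_cell R d) f_ n y = 0.
  rewrite /f_ RintegralZl//; last 2 first.
  - exact: measurable_unit_cell.
  - exact: (periodic_C0_integrable mu (periodic_C0_sub (FXC0 n) FC0)).
  rewrite RintegralB//; last 3 first.
  - exact: measurable_unit_cell.
  - exact: (periodic_C0_integrable mu (FXC0 n)).
  - exact: (periodic_C0_integrable mu FC0).
  by rewrite (inv_mu (h_ n) F FC0) subrr mulr0.
have f_bnd n y : `|f_ n y| <= 2 * C * W.
  rewrite normrM [X in X * _]ger0_norm// -ler_pdivlMl// mulrC.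
  have -> : F y = G y (tau y 0) by rewrite tau0 /G addr0 P0 subr0.
  rewrite FXG (le_trans (derive_lipschitz _ _ (dG y) (M := 2 * C) _))//.
    by move=> t; rewrite (le_trans (ler_normB _ _))// mulr_natl mulr2n lerD.
  rewrite -[leRHS]mulrA ler_pM2l ?mulr_gt0//.
  rewrite (le_trans (derive_lipschitz _ _ (dtau y) (M := W) _))//.
  by rewrite subr0 gtr0_norm.
have f_cvg y : f_ ^~ y @ \oo --> f y.
  have dFX : is_derive (0 : R) (1 : R) (fun h => F (X h y)) (f y).
    have H : is_derive (0 : R) (1 : R) (G y \o tau y) (f y).
      rewrite /f mulrC; apply: is_derive1_comp.
        rewrite tau0; have := dG y 0; rewrite addr0 (flow0 BKM)//.
      by have := dtau y 0; rewrite /X (flow0 wBKM).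
    by apply: is_derive_eq => //; move: H; congr is_derive; apply/funext => h; rewrite FXG.
  by have := is_derive0_cvg_seq dFX; rewrite /X (flow0 wBKM).
have intC : mu.-integrable (unit_cell R d) (EFin \o fun=> 2 * C * W).
  exact: (@bounded_integrable _ _ _ _ _ measurable_unit_cell _ `|2 * C * W|).
have [_ cvgf] := Rintegral_dominated measurable_unit_cell
  (fun n => measurable_funTS (mf_ n)) (fun y _ => f_cvg y) intC
  (fun n y _ => f_bnd n y).
have {cvgf} : \int[mu]_(y in unit_cell R d) f y = 0.
  rewrite -(cvg_lim _ cvgf)//; apply: cvg_lim => //.
  by under eq_fun do rewrite int_f_; exact: cvg_cst.
have wbint g : periodic_C0 g ->
    mu.-integrable (unit_cell R d) (EFin \o (fun y => w y * g y)).
  by move=> gC0; apply: periodic_C0_integrable; exact: periodic_C0_mul.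
have psiYC0 := periodic_C0_flow BKM s pB psiC0.
under eq_Rintegral do rewrite /f mulrBr.
rewrite (RintegralB measurable_unit_cell (wbint _ psiYC0) (wbint _ psiC0)).
by move/eqP; rewrite subr_eq0 => /eqP.
Qed.

End OrbitAverage.

(** * Integration on lines parallel to the axes *)

Section CoordinateIntegration.
Context {R : realType}.
Local Notation leb := (@lebesgue_measure R).
Local Notation Rm := (measurableTypeR R).

(** The bounded case follows from the nonnegative one by adding the constant
    [C]. *)
Lemma integral_uniform_bounded (f : Rm -> R) C : measurable_fun setT f ->
  (forall x, `|f x| <= C) ->
  (\int[uniform_prob (@ltr01 R)]_u (f u)%:E =
   \int[leb]_(u in `[0%R, 1%R]) (f u)%:E)%E.
Proof.
move=> mf fC; pose P : probability Rm R := uniform_prob (@ltr01 R).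
rewrite -/P.
have leb1 : leb `[0%R, 1%R]%classic = 1%E.
  by rewrite lebesgue_measure_itv/= lte_fin ltr01 -EFinB subr0.
have fC' u : `|f u + C| <= 2 * C.
  have C0 : 0 <= C by exact: le_trans (normr_ge0 _) (fC u).
  by rewrite (le_trans (ler_normD _ _))// (ger0_norm C0) mulr_natl mulr2n lerD.
have int_f : P.-integrable setT (EFin \o f).
  exact: (@bounded_integrable _ _ _ P _ measurableT _ _ mf (fun x _ => fC x)).
have int_C : P.-integrable setT (EFin \o cst C).
  by apply: finite_measure_integrable_cst.
have lebfin : (leb `[0%R, 1%R]%classic < +oo)%E by rewrite leb1 ltry.
have lint_f : leb.-integrable `[0%R, 1%R] (EFin \o f).
  apply: measurable_bounded_integrable => //; first exact: measurable_funTS.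
  exists C; split; first exact: num_real.
  by move=> r Cr x _ /=; rewrite (le_trans (fC _))// ltW.
have lint_C : leb.-integrable `[0%R, 1%R] (EFin \o cst C).
  apply: measurable_bounded_integrable => //.
  exists `|C|; split; first exact: num_real.
  by move=> r Cr x _ /=; rewrite ltW.
have := @integral_uniform R 0 1 ltr01 (fun u => (f u + C)%:E).
rewrite subr0 invr1 mul1e => H.
have {H} : (\int[P]_u (f u + C)%:E = \int[leb]_(u in `[0%R, 1%R]) (f u + C)%:E)%E.
  apply: H.
    by apply/measurable_EFinP; apply: measurable_funD.
  by move=> u; rewrite lee_fin; have := fC u; rewrite ler_norml; lra.
have -> : (\int[P]_u (f u + C)%:E = \int[P]_u (f u)%:E + C%:E)%E.
  have := integralD measurableT int_f int_C.
  rewrite [X in (_ + X)%E](integral_cst P measurableT C%:E).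
  by rewrite [X in (_ * X)%E]probability_setT mule1.
have -> : (\int[leb]_(u in `[0%R, 1%R]) (f u + C)%:E =
    \int[leb]_(u in `[0%R, 1%R]) (f u)%:E + C%:E)%E.
  have := integralD _ lint_f lint_C => ->//.
  rewrite [X in (_ + X)%E](integral_cst leb _ C%:E)//.
  by rewrite [X in (_ * X)%E]leb1 mule1.
by move=> /(congr1 (fun x => x - C%:E)%E); rewrite !addeK.
Qed.

Definition tuple_set n (t : n.-tuple Rm) (i : 'I_n) (u : Rm) : n.-tuple Rm :=
  [tuple if j == i then u else tnth t j | j < n].

Lemma cons_tuple_set n (u : Rm) (t : n.-tuple Rm) (j : 'I_n) (v : Rm) :
  [tuple of u :: tuple_set t j v] =
  tuple_set [tuple of u :: t] (lift ord0 j) v.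
Proof.
apply: eq_from_tnth => k; rewrite tnth_mktuple.
case: (unliftP ord0 k) => [k'|] ->; last first.
  by rewrite (negbTE (neq_lift _ _)) !tnth0.
rewrite !tnthS tnth_mktuple (inj_eq lift_inj)//.
Qed.

Lemma tuple_set_cons0 n (u v : Rm) (t : n.-tuple Rm) :
  tuple_set [tuple of v :: t] ord0 u = [tuple of u :: t].
Proof.
apply: eq_from_tnth => k; rewrite tnth_mktuple.
case: (unliftP ord0 k) => [k'|] ->; last by rewrite eqxx tnth0.
by rewrite eq_sym (negbTE (neq_lift _ _)) !tnthS.
Qed.

(** Fubini: integrate first in the coordinate [i]. *)
Lemma uniform_tuple_coordinate0 n (i : 'I_n) (G : n.-tuple Rm -> R) C :
  measurable_fun setT G -> (forall t, `|G t| <= C) ->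
  (forall t, \int[leb]_(u in `[0%R, 1%R]) (G (tuple_set t i u))%:E = 0)%E ->
  (\int[uniform_tuple n]_t (G t)%:E = 0)%E.
Proof.
elim: n i G => [[]//|n IH] i G mG GC G0.
pose P : probability Rm R := uniform_prob (@ltr01 R).
pose Q := uniform_tuple (R := R) n.
pose PQ : probability (Rm * n.-tuple Rm)%type R := (P \x Q)%E.
pose H (p : Rm * n.-tuple Rm) := G (cons_pair p).
have mH : measurable_fun setT H.
  exact: measurableT_comp mG (@measurable_cons_pair R n).
have intH : (P \x Q)%E.-integrable setT (EFin \o H).
  exact: (@bounded_integrable _ _ _ PQ _ measurableT _ _ mH (fun p _ => GC _)).
have -> : (\int[uniform_tuple n.+1]_t (G t)%:E = \int[(P \x Q)%E]_p (H p)%:E)%E.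
  rewrite /= integral_distribution//; first exact/measurable_EFinP.
have mG1 (u : Rm) : measurable_fun setT (fun t : n.-tuple Rm => G [tuple of u :: t]).
  apply: (measurableT_comp mG); apply: measurable_cons => //.
have mG2 (t : n.-tuple Rm) : measurable_fun setT (fun u : Rm => G [tuple of u :: t]).
  apply: (measurableT_comp mG); apply: measurable_cons => //.
case: (unliftP ord0 i) => [j|] ij; rewrite ij in G0.
- rewrite -(integral12_prod_meas1 intH); apply: integral0_eq => u _.
  apply: (IH j (fun t => G [tuple of u :: t])) => // t.
  rewrite -[RHS](G0 [tuple of u :: t]); apply: eq_integral => v _.
  by rewrite -cons_tuple_set.
- rewrite -(integral21_prod_meas1 intH); apply: integral0_eq => t _.
  apply: (etrans (integral_uniform_bounded (mG2 t) (fun u => GC _))).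
  rewrite -[RHS](G0 [tuple of 0 :: t]); apply: eq_integral => v _.
  by rewrite tuple_set_cons0.
Qed.

End CoordinateIntegration.

Section LebesgueTorusIntegration.
Context {R : realType} {d : nat}.
Local Notation V := 'rV[R]_d.
Local Notation leb := (@lebesgue_measure R).
Local Notation Rm := (measurableTypeR R).
Local Notation e_ i := (delta_mx 0 i : V).

(** Only the value [1] of a coordinate has to be excluded, a single point of
    each line. *)
Lemma uniform_tuple_unit_cell :
  {ae uniform_tuple d, forall t, unit_cell R d (row_of_tuple t)}.
Proof.
apply: filter_forall => i.
pose S : set (d.-tuple Rm) := (fun t => tnth t i) @^-1` (~` `[0%R, 1%R[).
have mS : measurable S.
  rewrite -[S]setTI; apply: (@measurable_tnth _ Rm d i) => //.
  exact: measurableC.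
exists S; split => //; last first.
  by move=> t /= nt; rewrite /S/= in_itv/=; move: nt; rewrite mxE.
have := integral_indic (uniform_tuple d) measurableT mS; rewrite setIT => <-.
apply: (@uniform_tuple_coordinate0 _ _ i _ 1).
- exact: measurable_indic.
- by move=> t; rewrite indicE; case: (t \in S); rewrite ?normr1 ?normr0.
move=> t; rewrite (eq_integral (fun u : Rm => (\1_(~` `[0%R, 1%R[) u)%:E)); last first.
  move=> u _; congr (_%:E); rewrite !indicE; congr (_%:R); congr nat_of_bool.
  by apply/idP/idP; rewrite !inE /S/= tnth_mktuple eqxx.
rewrite integral_indic//; last exact: measurableC.
rewrite (_ : _ `&` _ = [set 1]); last first.
  apply/seteqP; split => u /=; rewrite !in_itv/=.
    move=> [nu /andP[u0 u1]]; apply/eqP; rewrite eq_le u1/= leNgt.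
    by apply/negP => u1'; apply: nu; rewrite u0 u1'.
  by move=> ->; rewrite ltxx lexx ler01 andbF; split.
exact: lebesgue_measure_set1.
Qed.

Lemma lebesgue_torus_unit_cell : lebesgue_torus R d (unit_cell R d) = 1%E.
Proof.
pose N := ~` (@row_of_tuple R d @^-1` unit_cell R d).
have mcell : measurable (@row_of_tuple R d @^-1` unit_cell R d).
  rewrite -[X in measurable X]setTI.
  exact: measurable_row_of_tuple measurable_unit_cell.
have N0 : uniform_tuple d N = 0%E.
  by apply: measure_negligible; [exact: measurableC|exact: uniform_tuple_unit_cell].
rewrite (_ : lebesgue_torus R d _ = uniform_tuple d (~` N)); last by rewrite setCK.
by rewrite probability_setC ?N0 ?sube0//; exact: measurableC.
Qed.

Lemma lebesgue_torus_Rintegral (f : V -> R) C :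
  measurable_fun [set: borel_rV R d] f -> (forall x, `|f x| <= C) ->
  \int[lebesgue_torus R d]_(y in unit_cell R d) f y =
  \int[uniform_tuple d]_t f (row_of_tuple t).
Proof.
move=> mf fC; rewrite /Rintegral /lebesgue_torus /distribution.
have mcell : measurable (@row_of_tuple R d @^-1` unit_cell R d).
  rewrite -[X in measurable X]setTI.
  exact: measurable_row_of_tuple measurable_unit_cell.
have mfr : measurable_fun setT (f \o @row_of_tuple R d).
  exact: measurableT_comp mf (@measurable_row_of_tuple R d).
have intf : (uniform_tuple d).-integrable setT (EFin \o (f \o @row_of_tuple R d)).
  exact: (@bounded_integrable _ _ _ _ _ measurableT _ _ mfr (fun t _ => fC _)).
rewrite integral_pushforward//; last 3 first.
- exact/measurable_EFinP.
- exact: integrableS intf.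
- exact: measurable_unit_cell.
congr fine; rewrite -[in LHS](setCK (_ @^-1` _)) -setTD.
rewrite -(@negligible_integral _ _ _ (uniform_tuple d))//.
- exact: measurableC.
- apply: measure_negligible; first exact: measurableC.
  exact: uniform_tuple_unit_cell.
Qed.

Lemma lebesgue_torus_coordinate0 (f : V -> R) C i :
  measurable_fun [set: borel_rV R d] f -> (forall x, `|f x| <= C) ->
  (forall x, \int[leb]_(u in `[0, 1]) f (x + u *: e_ i) = 0) ->
  \int[lebesgue_torus R d]_(y in unit_cell R d) f y = 0.
Proof.
move=> mf fC f0; rewrite (lebesgue_torus_Rintegral mf fC) /Rintegral.
rewrite (@uniform_tuple_coordinate0 _ _ i (f \o @row_of_tuple R d) C)//.
- exact: measurableT_comp mf (@measurable_row_of_tuple R d).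
- by move=> t; exact: fC.
move=> t; have := f0 (row_of_tuple (tuple_set t i 0)).
rewrite /Rintegral => H.
have E : (\int[leb]_(u in `[0%R, 1%R]) ((f \o @row_of_tuple R d) (tuple_set t i u))%:E =
  \int[leb]_(u in `[0%R, 1%R]) (f (row_of_tuple (tuple_set t i 0) + u *: e_ i))%:E)%E.
  apply: eq_integral => u _; congr (_%:E); congr (f _); apply/rowP => j.
  rewrite !mxE !tnth_mktuple; case: eqVneq => _; first by rewrite mulr1 add0r.
  by rewrite mulr0 addr0.
rewrite E -[LHS]fineK ?H//.
apply: integrable_fin_num => //.
apply: measurable_bounded_integrable => //.
- by rewrite /= lebesgue_measure_itv/= lte_fin ltr01 -EFinB ltry.
- apply: measurable_funTS; apply: (measurableT_comp mf).
  rewrite (_ : (fun u => _) = fun u => row_of_tuple (tuple_set t i u)); last first.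
    apply/funext => u; apply/rowP => j.
    rewrite !mxE !tnth_mktuple; case: eqVneq => _; first by rewrite mulr1 add0r.
    by rewrite mulr0 addr0.
  apply: (measurableT_comp (@measurable_row_of_tuple R d)).
  apply/measurable_fun_tnthP => j.
  rewrite (_ : _ \o _ = fun u => if j == i then u else tnth t j); last first.
    by apply/funext => u /=; rewrite tnth_mktuple.
  by case: (j == i).
- exists C; split; first exact: num_real.
  by move=> r Cr u _ /=; rewrite (le_trans (fC _))// ltW.
Qed.

End LebesgueTorusIntegration.

(** * Liouville's theorem *)

Lemma sum_seq_le (R : numDomainType) (I : Type) (s : seq I) (F : I -> R) (c : R) :
  (forall i, F i <= c) -> \sum_(i <- s) F i <= (size s)%:R * c.
Proof.
move=> Fc; elim: s => [|i s IH]; first by rewrite big_nil mul0r.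
by rewrite big_cons /= -natr1 mulrDl mul1r addrC lerD.
Qed.

Section LipschitzDensity.
Context {R : realType} {d : nat}.

Lemma periodic_inf_convolution (g : 'rV[R]_d -> R) c n :
  (forall x, c <= g x) -> 0 <= n -> Zd_periodic g ->
  Zd_periodic (inf_convolution g n).
Proof.
move=> gc n0 pg.
have le x k : inf_convolution g n (x + map_mx intr k) <= inf_convolution g n x.
  apply: (inf_convolution_ge gc n0) => y; rewrite -(pg y k).
  rewrite (le_trans (inf_convolution_le gc n0 _ (y + map_mx intr k)))//.
  by rewrite opprD addrACA subrr addr0.
move=> x k; apply/eqP; rewrite eq_le le/=.
have := le (x + map_mx intr k) (- k).
by rewrite -addrA -map_mxD subrr map_mx0 addr0.
Qed.

(** An inf-convolution of slope [2 * C / dlt] does not use points farther than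
    [dlt], where its penalty exceeds the oscillation of [psi]. *)
Lemma periodic_C0_lipschitz_approx (psi : 'rV[R]_d -> R) (e : R) :
  periodic_C0 psi -> 0 < e -> exists g L, [/\ 0 <= L, periodic_C0 g,
    forall x y, `|g x - g y| <= L * `|x - y| & forall x, `|psi x - g x| <= e].
Proof.
move=> [ppsi cpsi] e0.
have [C C0 psiC] := periodic_bounded ppsi cpsi.
have [dlt dlt0 psidlt] := periodic_unif_continuous ppsi cpsi e0.
have psi_ge x : - C <= psi x by have := psiC x; rewrite ler_norml => /andP[].
pose n := 2 * C / dlt.
have n0 : 0 <= n by rewrite divr_ge0 ?(ltW dlt0)// mulr_ge0// ltW.
exists (inf_convolution psi n), n; split => //.
- split; first exact: periodic_inf_convolution psi_ge n0 ppsi.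
  exact: inf_convolution_continuous psi_ge n0.
- exact: inf_convolution_lipschitz psi_ge n0.
move=> x.
have ub : inf_convolution psi n x <= psi x.
  by have := inf_convolution_le psi_ge n0 x x; rewrite subrr normr0 mulr0 addr0.
have lb : psi x - e <= inf_convolution psi n x.
  apply: (inf_convolution_ge psi_ge n0) => y.
  have [xy|xy] := leP `|x - y| dlt.
    have := psidlt x y xy; rewrite ler_norml => /andP[_ h].
    have := mulr_ge0 n0 (normr_ge0 (x - y)); lra.
  have h : 2 * C <= n * `|x - y|.
    by rewrite /n mulrAC ler_pdivlMr// ler_wpM2l ?(ltW xy)// mulr_ge0// ltW.
  have := psi_ge y; have := psiC x; rewrite ler_norml => /andP[_]; lra.
by rewrite ler_norml; apply/andP; split; lra.
Qed.

End LipschitzDensity.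

Section Liouville.
Context {R : realType} {d : nat}.
Local Notation V := 'rV[R]_d.
Local Notation leb := (@lebesgue_measure R).
Local Notation e_ i := (delta_mx 0 i : V).
Local Notation lam := (lebesgue_torus R d).
Local Notation cell := (unit_cell R d).
Variables (B : V -> V) (K M : R) (dB : 'I_d -> V -> R).
Hypothesis BKM : lipschitz_bounded B K M.
Hypothesis pB : Zd_periodic B.
Hypothesis dBC0 : forall i, periodic_C0 (dB i).
Hypothesis dBE : forall i x, is_derive x (e_ i) (fun y => B y 0 i) (dB i x).
Hypothesis divB0 : forall x, \sum_i dB i x = 0.

Let K0 : 0 < K. Proof. by case: BKM. Qed.
Let M0 : 0 <= M. Proof. by case: BKM. Qed.
Let B_lip x y : `|B x - B y| <= K * `|x - y|. Proof. by case: BKM. Qed.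
Let B_bnd x : `|B x| <= M. Proof. by case: BKM. Qed.

(** The flow in time [h] is, up to an error in [h ^+ 2], the composition of the
    shears moving one coordinate at a time, whose effect on integrals is explicit
    and does not involve the derivative of the flow in space. *)
Definition shear (h : R) (i : 'I_d) (x : V) : V := x + (h * B x 0 i) *: e_ i.

Lemma shear_periodic h i x k :
  shear h i (x + map_mx intr k) = shear h i x + map_mx intr k.
Proof. by rewrite /shear pB addrAC. Qed.

Lemma shear_continuous h i : continuous (shear h i).
Proof.
apply: (@lipschitz_continuous _ _ _ _ (1 + `|h| * K * `|e_ i|)) => x y.
have -> : shear h i x - shear h i y =
    (x - y) + (h * (B x 0 i - B y 0 i)) *: e_ i.
  by rewrite /shear opprD addrACA -scalerBl mulrBr.
rewrite (le_trans (ler_normD _ _))// mulrDl mul1r lerD2l normrZ [`|h * _|]normrM.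
rewrite [leRHS]mulrAC ler_wpM2r// -[leRHS]mulrA ler_wpM2l//.
have := norm_coord_le (B x - B y) i; rewrite !mxE => /le_trans; apply.
exact: B_lip.
Qed.

Lemma periodic_C0_shear h i g : periodic_C0 g -> periodic_C0 (g \o shear h i).
Proof.
move=> [pg cg]; split; first by move=> x k /=; rewrite shear_periodic pg.
by move=> x; apply: continuous_comp; [exact: shear_continuous|exact: cg].
Qed.

(** On each line parallel to the axis [i] a shear is a change of variable of
    the circle, with Jacobian [1 + h * dB i]: along the line the weighted
    function is the derivative of a primitive of [g] composed with the shear. *)
Lemma shear_integral h i g : periodic_C0 g ->
  \int[lam]_(y in cell) (g (shear h i y) * (1 + h * dB i y)) =
  \int[lam]_(y in cell) g y.
Proof.
move=> gC0; have [pg cg] := gC0.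
have JC0 : periodic_C0 (fun y => 1 + h * dB i y).
  rewrite (_ : (fun y => _) = (fun y => 1 - (- h) * dB i y)); last first.
    by apply/funext => y; rewrite mulNr opprK.
  apply: periodic_C0_sub; first exact: periodic_C0_cst.
  by apply: periodic_C0_mul => //; exact: periodic_C0_cst.
have gSC0 := periodic_C0_shear h i gC0.
have gSJC0 := periodic_C0_mul gSC0 JC0.
have fC0 := periodic_C0_sub gSJC0 gC0.
apply/eqP; rewrite -subr_eq0 -RintegralB; last 3 first.
- exact: measurable_unit_cell.
- exact: periodic_C0_integrable gSJC0.
- exact: periodic_C0_integrable gC0.
have [C C0 fC] := periodic_bounded fC0.1 fC0.2.
apply/eqP; apply: (@lebesgue_torus_coordinate0 _ _ _ C i) => //.
  exact: measurable_periodic_C0 fC0.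
move=> x; have cline : continuous (fun u : R => x + u *: e_ i).
  apply: (@lipschitz_continuous _ _ _ _ `|e_ i|) => u v.
  by rewrite opprD addrACA subrr add0r -scalerBl normrZ mulrC.
have cq : continuous (fun r : R => g (x + r *: e_ i)).
  by move=> r; apply: continuous_comp; [exact: cline|exact: cg].
have [G [G0 dG]] := primitive_exists cq.
pose b u := B (x + u *: e_ i) 0 i.
have db u : is_derive u (1 : R) b (dB i (x + u *: e_ i)).
  exact: (is_derive_line (f := fun y => B y 0 i)).
have e_int : e_ i = map_mx intr (delta_mx 0 i : 'rV[int]_d).
  by apply/rowP => j; rewrite !mxE; case: (_ && _).
pose H u := G (u + h * b u) - G u.
have dH u : is_derive u (1 : R) H
    (g (shear h i (x + u *: e_ i)) * (1 + h * dB i (x + u *: e_ i)) -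
     g (x + u *: e_ i)).
  have dhb : is_derive u (1 : R) (fun v => v + h * b v)
      (1 + h * dB i (x + u *: e_ i)).
    exact: (is_deriveD (is_derive_id u (1 : R)) (is_deriveZ h (db u))).
  apply: is_deriveB; rewrite /shear -addrA -scalerDl.
  exact: (@is_derive1_comp _ G (fun v => v + h * b v) u _ _ (dG _) dhb).
rewrite (Rintegral_primitive (F := H))//; last 1 first.
  by move=> u; apply: (@continuous_comp _ _ _ (fun u : R => x + u *: e_ i)
    (fun y => g (shear h i y) * (1 + h * dB i y) - g y));
    [exact: cline|exact: fC0.2].
have b1 : b 1 = b 0 by rewrite /b scale1r scale0r addr0 e_int pB.
have GS r : G (r + 1) - G r = G (0 + 1) - G 0.
  pose D s := G (s + 1) - G s.
  rewrite -/(D r) -/(D 0); apply: is_derive_0_is_cst => s.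
  rewrite (_ : 0 = g (x + (s + 1) *: e_ i) - g (x + s *: e_ i)).
    apply: is_deriveB.
    have := @is_derive1_comp _ G (shift 1) s _ _ (dG (s + 1)) (is_derive_shift s 1 1).
    by rewrite mulr1.
  by rewrite scalerDl scale1r addrA e_int pg subrr.
rewrite /H b1 add0r [1 + _]addrC.
have := GS (h * b 0); rewrite add0r; lra.
Qed.

Definition shears (h : R) (s : seq 'I_d) (x : V) : V :=
  foldl (fun z i => shear h i z) x s.

Lemma periodic_C0_shears h s g : periodic_C0 g -> periodic_C0 (g \o shears h s).
Proof.
elim: s g => [|i s IH] g gC0; first by rewrite (_ : _ \o _ = g).
exact: (periodic_C0_shear h i (IH g gC0)).
Qed.

Lemma norm_delta_le i : `|e_ i| <= 1.
Proof.
apply: row_norm_le => // j; rewrite mxE; case: (_ && _); by rewrite ?normr1 ?normr0.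
Qed.

Lemma shear_displacement h i x : 0 <= h -> `|shear h i x - x| <= h * M.
Proof.
move=> h0; rewrite /shear addrAC subrr add0r normrZ [`|h * _|]normrM (ger0_norm h0).
rewrite -[leRHS]mulr1 ler_pM ?mulr_ge0 ?norm_delta_le// ler_wpM2l//.
exact: le_trans (norm_coord_le _ _) (B_bnd _).
Qed.

Lemma shears_displacement h s x : 0 <= h ->
  `|shears h s x - x| <= (size s)%:R * (h * M).
Proof.
move=> h0; elim: s x => [|i s IH] x /=; first by rewrite subrr normr0 mul0r.
rewrite -(subrKA (shear h i x)) (le_trans (ler_normD _ _))//.
by rewrite -natr1 mulrDl mul1r lerD ?IH ?shear_displacement.
Qed.

Lemma shears_euler h s x : 0 <= h ->
  `|shears h s x - (x + h *: \sum_(i <- s) B x 0 i *: e_ i)| <=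
  (size s)%:R ^+ 2 * (K * M * h ^+ 2).
Proof.
move=> h0; elim: s x => [|i s IH] x /=.
  by rewrite big_nil scaler0 addr0 subrr normr0 expr0n mul0r.
set z := shear h i x; set n := size s.
have -> : shears h s z - (x + h *: \sum_(j <- i :: s) B x 0 j *: e_ j) =
   (shears h s z - (z + h *: \sum_(j <- s) B z 0 j *: e_ j)) +
   h *: \sum_(j <- s) (B z 0 j - B x 0 j) *: e_ j.
  rewrite big_cons scalerDr scalerA addrA -/(shear h i x) -/z.
  rewrite (eq_bigr (F1 := fun j => (B z 0 j - B x 0 j) *: e_ j)
    (fun j => B z 0 j *: e_ j - B x 0 j *: e_ j)); last first.
    by move=> j _; rewrite scalerBl.
  rewrite sumrB scalerBr !opprD !addrA; congr (_ - _).
  by rewrite -[RHS]addrA addNr addr0.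
rewrite (le_trans (ler_normD _ _))//.
have h1 : `|h *: \sum_(j <- s) (B z 0 j - B x 0 j) *: e_ j| <=
    n%:R * (K * M * h ^+ 2).
  rewrite normrZ (ger0_norm h0) (_ : n%:R * _ = h * (n%:R * (K * M * h))); last by ring.
  rewrite ler_wpM2l// (le_trans (ler_norm_sum _ _ _))//.
  apply: sum_seq_le => j; rewrite normrZ -[leRHS]mulr1 ler_pM ?norm_delta_le//.
  have := norm_coord_le (B z - B x) j; rewrite !mxE => /le_trans; apply.
  rewrite (le_trans (B_lip _ _))// -mulrA ler_wpM2l ?(ltW K0)// mulrC.
  exact: shear_displacement.
rewrite (le_trans (lerD (IH z) h1))// -mulrDl ler_wpM2r//.
  by rewrite !mulr_ge0 ?exprn_ge0// ltW.
by rewrite -/n -natr1 sqrrD1 -mulr_natr; have := ler0n R n; lra.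
Qed.

(** First-order expansion of the integral after a composition of shears; the
    error is quadratic in [h] and depends on [g] only through its Lipschitz
    constant. *)
Lemma shears_integral h s g L D : 0 <= h -> 0 <= L -> 0 <= D ->
  periodic_C0 g -> (forall x y, `|g x - g y| <= L * `|x - y|) ->
  (forall i x, `|dB i x| <= D) ->
  `|\int[lam]_(y in cell) g (shears h s y) - \int[lam]_(y in cell) g y +
    h * \int[lam]_(y in cell) (g y * \sum_(i <- s) dB i y)| <=
  (size s)%:R ^+ 2 * (L * M * D * h ^+ 2).
Proof.
move=> h0 L0 D0 gC0 gL dBD; have mcell := @measurable_unit_cell R d.
have sumC0 r : periodic_C0 (fun y => \sum_(i <- r) dB i y).
  elim: r => [|i r IH].
    by rewrite (_ : (fun y => _) = (fun=> 0));
      [exact: periodic_C0_cst|apply/funext => y; rewrite big_nil].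
  rewrite (_ : (fun y => _) = (fun y => dB i y - (0 - \sum_(i <- r) dB i y))).
    by do 2 apply: periodic_C0_sub => //; exact: periodic_C0_cst.
  by apply/funext => y; rewrite big_cons sub0r opprK.
elim: s => [|i s IH].
  rewrite /= subrr add0r expr0n mul0r (_ : (\int[lam]_(y in cell) _) = 0).
    by rewrite mulr0 normr0.
  transitivity (\int[lam]_(y in cell) (0 : R)).
    by apply: eq_Rintegral => y _; rewrite big_nil mulr0.
  by rewrite Rintegral_cst ?mul0r//; exact: mcell.
pose G := g \o shears h s; pose G' := G \o shear h i.
have GC0 : periodic_C0 G by exact: periodic_C0_shears.
have G'C0 : periodic_C0 G' by exact: periodic_C0_shear.
have G'dC0 := periodic_C0_mul G'C0 (dBC0 i).
have gdC0 := periodic_C0_mul gC0 (dBC0 i).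
have gsC0 := periodic_C0_mul gC0 (sumC0 s).
have int := periodic_C0_integrable lam.
have E1 : \int[lam]_(y in cell) G' y =
    \int[lam]_(y in cell) G y - h * \int[lam]_(y in cell) (G' y * dB i y).
  rewrite -(shear_integral h i GC0) -(RintegralZl h mcell (int _ G'dC0)).
  have hC0 := periodic_C0_mul (periodic_C0_cst h) G'dC0.
  have G'JC0 : periodic_C0 (fun y => G (shear h i y) * (1 + h * dB i y)).
    rewrite (_ : (fun y => _) = (fun y => G' y - (0 - h * (G' y * dB i y)))).
      by do 2 apply: periodic_C0_sub => //; exact: periodic_C0_cst.
    by apply/funext => y; rewrite /G'/=; ring.
  rewrite -(RintegralB mcell (int _ G'JC0) (int _ hC0)).
  by apply: eq_Rintegral => y _; rewrite /G'/=; ring.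
have E2 : \int[lam]_(y in cell) (g y * \sum_(j <- i :: s) dB j y) =
    \int[lam]_(y in cell) (g y * dB i y) +
    \int[lam]_(y in cell) (g y * \sum_(j <- s) dB j y).
  rewrite -(RintegralD mcell (int _ gdC0) (int _ gsC0)).
  by apply: eq_Rintegral => y _; rewrite big_cons mulrDr.
rewrite -[\int[lam]_(y in cell) g (shears h (i :: s) y)]/(\int[lam]_(y in cell) G' y).
rewrite E1 E2.
set A := \int[lam]_(y in cell) G y in IH *.
set A0 := \int[lam]_(y in cell) g y in IH *.
set S := \int[lam]_(y in cell) (g y * \sum_(j <- s) dB j y) in IH *.
set a := \int[lam]_(y in cell) (G' y * dB i y).
set b := \int[lam]_(y in cell) (g y * dB i y).
have -> : A - h * a - A0 + h * (b + S) = (A - A0 + h * S) - h * (a - b) by ring.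
have ab : `|a - b| <= (size s).+1%:R * (L * M * D * h).
  rewrite /a /b -(RintegralB mcell (int _ G'dC0) (int _ gdC0)).
  apply: Rintegral_norm_le => //.
  - by rewrite !mulr_ge0.
  - exact: measurable_funTS (measurable_periodic_C0 (periodic_C0_sub G'dC0 gdC0)).
  move=> y _; rewrite -mulrBl normrM.
  rewrite (_ : _ * _ = L * ((size (i :: s))%:R * (h * M)) * D); last by rewrite /=; ring.
  rewrite ler_pM// (le_trans (gL _ _))// ler_wpM2l//.
  exact: (shears_displacement (i :: s)).
rewrite (le_trans (ler_normB _ _))// normrM (ger0_norm h0).
rewrite (le_trans (lerD IH (ler_wpM2l h0 ab)))//.
rewrite (_ : h * (_ * _) = (size s).+1%:R * (L * M * D * h ^+ 2)); last by ring.
rewrite -mulrDl ler_wpM2r//; first by rewrite !mulr_ge0 ?exprn_ge0.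
by rewrite /= -natr1; have := ler0n R (size s); rewrite sqrrD1 -mulr_natr; lra.
Qed.

(** Composing the shears in all directions, the first-order term is the integral
    of [g] times the divergence, which vanishes. *)
Lemma liouville_step D : 0 <= D -> (forall i x, `|dB i x| <= D) ->
  exists2 C, 0 <= C & forall h g L, 0 <= h -> 0 <= L -> periodic_C0 g ->
    (forall x y, `|g x - g y| <= L * `|x - y|) ->
    `|\int[lam]_(y in cell) g (flow B h y) - \int[lam]_(y in cell) g y| <=
    L * C * h ^+ 2.
Proof.
move=> D0 dBD; pose s := index_enum 'I_d; pose n2 : R := (size s)%:R ^+ 2.
have n20 : 0 <= n2 by rewrite exprn_ge0.
exists (n2 * (M * D) + (K * M + n2 * (K * M))).
  by rewrite !(addr_ge0, mulr_ge0)// ltW.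
move=> h g L h0 L0 gC0 gL; have mcell := @measurable_unit_cell R d.
have int := periodic_C0_integrable lam.
have gfC0 := periodic_C0_flow BKM h pB gC0.
have gsC0 := periodic_C0_shears h s gC0.
have := shears_integral s h0 L0 D0 gC0 gL dBD.
rewrite (_ : \int[lam]_(y in cell) (g y * _) = 0); last first.
  transitivity (\int[lam]_(y in cell) (0 : R)).
    by apply: eq_Rintegral => y _; rewrite divB0 mulr0.
  by rewrite Rintegral_cst ?mul0r//; exact: mcell.
rewrite mulr0 addr0 => H1.
have H2 : `|\int[lam]_(y in cell) g (flow B h y) -
    \int[lam]_(y in cell) g (shears h s y)| <=
    L * (K * M * h ^+ 2 + n2 * (K * M * h ^+ 2)).
  rewrite -(RintegralB mcell (int _ gfC0) (int _ gsC0)).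
  apply: Rintegral_norm_le => //.
  - have KMh : 0 <= K * M * h ^+ 2 by rewrite mulr_ge0 ?exprn_ge0// mulr_ge0// ltW.
    by rewrite mulr_ge0// addr_ge0// mulr_ge0.
  - exact: measurable_funTS (measurable_periodic_C0 (periodic_C0_sub gfC0 gsC0)).
  move=> y _; rewrite (le_trans (gL _ _))// ler_wpM2l//.
  rewrite -(subrKA (y + h *: B y)) (le_trans (ler_normD _ _))// lerD//.
    exact: flow_euler_step.
  rewrite distrC; have := shears_euler s y h0.
  by rewrite -row_sum_delta_mx.
rewrite -(subrKA (\int[lam]_(y in cell) g (shears h s y))).
rewrite (le_trans (ler_normD _ _))// (le_trans (lerD H2 H1))//.
by rewrite -/n2 le_eqVlt; apply/orP; left; apply/eqP; ring.
Qed.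

(** The error of [2 ^ n] steps of length [t / 2 ^ n] is of order [2 ^ (- n)]: a
    Lipschitz function composed with the flow stays Lipschitz with a constant
    bounded on bounded times. *)
Lemma liouville_lipschitz t g L : 0 <= t -> 0 <= L -> periodic_C0 g ->
  (forall x y, `|g x - g y| <= L * `|x - y|) ->
  \int[lam]_(y in cell) g (flow B t y) = \int[lam]_(y in cell) g y.
Proof.
move=> t0 L0 gC0 gL.
have /choice[D_ DP] i : exists D, 0 < D /\ forall x, `|dB i x| <= D.
  have [D D0 dBD] := periodic_bounded (dBC0 i).1 (dBC0 i).2.
  by exists D.
have D_0 i : 0 <= D_ i by have [/ltW] := DP i.
have dBD i x : `|dB i x| <= \sum_j D_ j.
  have [_ h] := DP i; rewrite (le_trans (h x))//.
  by rewrite (bigD1 i)//= lerDl sumr_ge0.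
have [C C0 step] := liouville_step (sumr_ge0 _ (fun i _ => D_0 i)) dBD.
pose L' := L * (2 * expR (2 * K * t)).
have L'0 : 0 <= L' by rewrite mulr_ge0// mulr_ge0// expR_ge0.
pose a s := \int[lam]_(y in cell) g (flow B s y).
have a0 : a 0 = \int[lam]_(y in cell) g y.
  by apply: eq_Rintegral => y _; rewrite (flow0 BKM).
rewrite -/(a t) -a0; apply/eqP; rewrite -subr_eq0 -normr_le0.
apply: (@geometric_le _ _ _ (L' * C * t ^+ 2)) => n; rewrite addr0.
pose N := (2 ^ n)%N; pose h := t / N%:R.
have N0 : 0 < N%:R :> R by rewrite ltr0n expn_gt0.
have h0 : 0 <= h by rewrite divr_ge0// ltW.
have aj j : (j <= N)%N -> `|a (j%:R * h) - a 0| <= j%:R * (L' * C * h ^+ 2).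
  elim: j => [|j IH] jN; first by rewrite !mul0r subrr normr0.
  rewrite -natr1 !mulrDl !mul1r [leRHS]addrC.
  rewrite -(subrKA (a (j%:R * h))) (le_trans (ler_normD _ _))// lerD ?IH ?(ltnW jN)//.
  have jh0 : 0 <= j%:R * h by rewrite mulr_ge0.
  have gjL x y : `|g (flow B (j%:R * h) x) - g (flow B (j%:R * h) y)| <= L' * `|x - y|.
    rewrite (le_trans (gL _ _))// /L' -mulrA ler_wpM2l//.
    rewrite (le_trans (flow_lipschitz BKM _ _ _))// ler_wpM2r// ler_pM2l//.
    rewrite ler_expR ler_pM2l ?mulr_gt0// ger0_norm// /h mulrCA ler_piMr//.
    by rewrite ler_pdivrMr// mul1r ler_nat ltnW.
  rewrite (_ : a (j%:R * h + h) =
      \int[lam]_(y in cell) g (flow B (j%:R * h) (flow B h y))).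
    exact: step h0 L'0 (periodic_C0_flow BKM (j%:R * h) pB gC0) gjL.
  by apply: eq_Rintegral => y _; rewrite (flowD BKM).
have := aj N (leqnn N); rewrite /h [N%:R * (t / _)]mulrC divfK ?gt_eqF// => /le_trans.
apply; rewrite le_eqVlt; apply/orP; left; apply/eqP.
by rewrite /N natrX exprVn; field; rewrite expf_neq0.
Qed.

(** Lipschitz functions are uniformly dense in the continuous periodic ones. *)
Lemma liouville : invariant_probability B lam.
Proof.
split=> [|t psi psiC0]; first exact: lebesgue_torus_unit_cell.
wlog t0 : t psi psiC0 / 0 <= t.
  move=> H; case: (leP 0 t) => [|/ltW] t0; first exact: H.
  rewrite -(H (- t) (fun x => psi (flow B t x))) ?oppr_ge0//.
    by apply: eq_Rintegral => y _; rewrite -(flowD BKM) subrr (flow0 BKM).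
  exact: (periodic_C0_flow BKM).
have mcell := @measurable_unit_cell R d.
have int := periodic_C0_integrable lam.
apply/eqP; rewrite -subr_eq0 -normr_le0; apply/ler_addgt0Pr => _/posnumP[e].
rewrite add0r; have e2 : 0 < e%:num / 2 by rewrite divr_gt0.
have [g [L [L0 gC0 gL psig]]] := periodic_C0_lipschitz_approx psiC0 e2.
have psifC0 := periodic_C0_flow BKM t pB psiC0.
have gfC0 := periodic_C0_flow BKM t pB gC0.
have le u v : periodic_C0 u -> periodic_C0 v -> (forall x, `|u x - v x| <= e%:num / 2) ->
    `|\int[lam]_(y in cell) u y - \int[lam]_(y in cell) v y| <= e%:num / 2.
  move=> uC0 vC0 uv; rewrite -(RintegralB mcell (int _ uC0) (int _ vC0)).
  apply: Rintegral_norm_le => //.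
  exact: measurable_funTS (measurable_periodic_C0 (periodic_C0_sub uC0 vC0)).
rewrite -(subrKA (\int[lam]_(y in cell) g (flow B t y))) (le_trans (ler_normD _ _))//.
rewrite (splitr e%:num) lerD//; first exact: le.
rewrite (liouville_lipschitz t0 L0 gC0 gL) distrC; exact: le.
Qed.

End Liouville.

(** * Harmonic means *)

Section HarmonicMean.
Context {R : realType} {d : nat}.
Local Notation V := 'rV[R]_d.
Local Notation lam := (lebesgue_torus R d).
Local Notation cell := (unit_cell R d).

Lemma periodic_C0_inv (f : V -> R) : periodic_C0 f -> (forall x, 0 < f x) ->
  periodic_C0 (fun x => (f x)^-1).
Proof.
move=> [pf cf] f0; split; first by move=> x k; rewrite pf.
by move=> x; have fx0 : f x != 0 by [rewrite gt_eqF]; exact: (cvgV fx0 (cf x)).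
Qed.

Lemma periodic_C0_Rintegral_gt0 (f : V -> R) : periodic_C0 f ->
  (forall x, 0 < f x) -> 0 < \int[lam]_(y in cell) f y.
Proof.
move=> fC0 f0; have fVC0 := periodic_C0_inv fC0 f0.
have [C C0 fC] := periodic_bounded fVC0.1 fVC0.2.
have mcell := @measurable_unit_cell R d.
apply: (@lt_le_trans _ _ (\int[lam]_(y in cell) C^-1)).
  rewrite Rintegral_cst; last exact: mcell.
  by rewrite [X in fine X](lebesgue_torus_unit_cell : lam cell = _) mulr1 invr_gt0.
apply: le_Rintegral => //.
- exact: (periodic_C0_integrable _ (periodic_C0_cst _)).
- exact: (periodic_C0_integrable _ fC0).
- move=> x _; rewrite -[leRHS]invrK lef_pV2 ?posrE ?invr_gt0//.
  exact: le_trans (ler_norm _) (fC x).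
Qed.

(** The inverse of [a] is the increasing limit of the inverses of the positive
    functions [a + 1 / (k + 1)], also where [a] vanishes and its inverse is
    infinite. *)
Definition regular_inverse (a : V -> R) (k : nat) (y : V) : R :=
  (a y + k.+1%:R^-1)^-1.

Lemma regular_inverse_cvg (a : V -> R) y : 0 <= a y ->
  (regular_inverse a k y)%:E @[k --> \oo] --> ((a y)%:E^-1)%E.
Proof.
move=> ay0; rewrite inver; case: eqVneq => [ay|ay].
  apply/cvgeryP; rewrite (_ : (fun k => _) = (fun k => k.+1%:R)); last first.
    by apply/funext => k; rewrite /regular_inverse ay add0r invrK.
  by rewrite (cvg_shiftS (fun k => k%:R : R)); exact: cvgr_idn.
apply: cvg_EFin; first exact: nearW.
apply: cvgV => //; rewrite -[X in _ --> X]addr0.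
by apply: cvgD; [exact: cvg_cst|exact: cvg_harmonic].
Qed.

Lemma regular_inverse_C0 (a : V -> R) k : periodic_C0 a -> (forall x, 0 <= a x) ->
  periodic_C0 (regular_inverse a k).
Proof.
move=> aC0 a0; apply: periodic_C0_inv => [|x]; last by rewrite ltr_wpDl.
rewrite (_ : (fun y => _) = (fun y => a y - (- k.+1%:R^-1))); last first.
  by apply/funext => y; rewrite opprK.
by apply: periodic_C0_sub => //; exact: periodic_C0_cst.
Qed.

Lemma measurable_regular_inverse (a : V -> R) k : periodic_C0 a ->
  (forall x, 0 <= a x) ->
  measurable_fun (cell : set (borel_rV R d))
    (fun y : borel_rV R d => (regular_inverse a k y)%:E).
Proof.
move=> aC0 a0; apply/measurable_EFinP.
exact: measurable_funTS (measurable_periodic_C0 (regular_inverse_C0 k aC0 a0)).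
Qed.

Lemma measurable_inverse (a : V -> R) : periodic_C0 a -> (forall x, 0 <= a x) ->
  measurable_fun (cell : set (borel_rV R d)) (fun y : borel_rV R d => ((a y)%:E^-1)%E).
Proof.
move=> aC0 a0.
apply: (emeasurable_fun_cvg
  (fun k (y : borel_rV R d) => (regular_inverse a k y)%:E)) => [k|y _].
  exact: measurable_regular_inverse.
exact: regular_inverse_cvg.
Qed.

(** The integral of the inverse of [a_ n] is at most that of the inverse of [a]
    because [a <= a_ n]. For large [n] the inverse of [a_ n] dominates that of
    [a + 1 / (k + 1)], whose integrals increase to that of the inverse of [a] by
    monotone convergence, even when this limit is infinite. *)
Lemma harmonic_mean_cvg (a : V -> R) (a_ : nat -> V -> R) :
  periodic_C0 a -> (forall x, 0 <= a x) ->
  (forall n, periodic_C0 (a_ n)) -> (forall n x, 0 < a_ n x) ->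
  (forall n x, a x <= a_ n x) ->
  (forall e : R, 0 < e -> \forall n \near \oo, forall x, a_ n x <= a x + e) ->
  (\int[lam]_(y in cell) (a_ n y)^-1)^-1 @[n --> \oo] --> harmonic_mean_torus a.
Proof.
move=> aC0 a0 anC0 an0 a_an an_a; have mcell := @measurable_unit_cell R d.
pose I n := \int[lam]_(y in cell) (a_ n y)^-1.
have anVC0 n : periodic_C0 (fun y => (a_ n y)^-1) by exact: periodic_C0_inv.
have I0 n : 0 < I n.
  by apply: periodic_C0_Rintegral_gt0 => // x; rewrite invr_gt0.
have IE n : (\int[lam]_(y in cell) ((a_ n y)^-1)%:E = (I n)%:E)%E.
  rewrite /I /Rintegral fineK//; apply: integrable_fin_num => //.
  exact: periodic_C0_integrable (anVC0 n).
pose g y : \bar R := ((a y)%:E^-1)%E.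
pose J := (\int[lam]_(y in cell) g y)%E.
have gE y : g y = if a y == 0 then +oo%E else ((a y)^-1)%:E by rewrite /g inver.
pose h := regular_inverse a.
have ak0 k y : 0 < a y + k.+1%:R^-1 by rewrite ltr_wpDl.
have hg y : (h k y)%:E @[k --> \oo] --> g y by exact: regular_inverse_cvg.
have mh (k : nat) : measurable_fun (cell : set (borel_rV R d))
    (fun y : borel_rV R d => (h k y)%:E) by exact: measurable_regular_inverse.
have hJ : (\int[lam]_(y in cell) (h k y)%:E)%E @[k --> \oo] --> J.
  have := @cvg_monotone_convergence _ _ _ lam cell mcell (fun k y => (h k y)%:E) mh.
  have -> : (\int[lam]_(x in cell) limn (fun k => (h k x)%:E) = J)%E.
    by apply: eq_integral => y _; apply: cvg_lim => //; exact: hg.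
  apply=> [k y _|y _ k l kl]; first by rewrite lee_fin invr_ge0 ltW.
  rewrite lee_fin lef_pV2 ?posrE// lerD2l lef_pV2 ?posrE// ler_nat ltnS//.
have mg : measurable_fun (cell : set (borel_rV R d)) g.
  exact: measurable_inverse.
have IJ n : ((I n)%:E <= J)%E.
  rewrite -IE; apply: ge0_le_integral => //.
  - by move=> y _; rewrite lee_fin invr_ge0 ltW.
  - by apply/measurable_EFinP; exact: measurable_funTS (measurable_periodic_C0 (anVC0 n)).
  - move=> y _; rewrite gE; case: eqVneq => [_|ay0]; first by rewrite leey.
    by rewrite lee_fin lef_pV2 ?posrE// lt_neqAle eq_sym ay0/=.
have nearJ (A : R) : (A%:E < J)%E -> \forall n \near \oo, A < I n.
  move=> AJ; have : \forall k \near \oo, (A%:E < \int[lam]_(y in cell) (h k y)%:E)%E.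
    exact: (hJ [set u | (A%:E < u)%E] (open_ereal_gt' AJ)).
  move=> [k _ /(_ k (leqnn k)) /= Ak].
  have := an_a k.+1%:R^-1; rewrite invr_gt0 ltr0n => /(_ isT); apply: filterS => n an.
  rewrite -lte_fin -IE; apply: lt_le_trans Ak _; apply: ge0_le_integral => //.
  - by move=> y _; rewrite lee_fin invr_ge0 ltW.
  - by apply/measurable_EFinP; exact: measurable_funTS (measurable_periodic_C0 (anVC0 n)).
  - by move=> y _; rewrite lee_fin lef_pV2 ?posrE.
have J0 : (0 < J)%E by apply: lt_le_trans (IJ 0%N); rewrite lte_fin.
rewrite /harmonic_mean_torus -/J -/I.
case: J IJ nearJ J0 {hJ} => [r||] IJ nearJ J0 //.
- rewrite inver gt_eqF//=; apply: cvgV; first by rewrite gt_eqF.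
  apply/cvgrPdist_le => e e0; near=> n.
  have h1 : I n <= r by rewrite -lee_fin.
  have h2 : r - e < I n by near: n; apply: nearJ; rewrite lte_fin ltrBlDr ltrDl.
  by rewrite -/(I n) ger0_norm ?subr_ge0//; lra.
- rewrite invey/=; apply/cvgrPdist_le => e e0; near=> n; rewrite -/(I n).
  rewrite sub0r normrN ger0_norm; last by rewrite invr_ge0 ltW.
  rewrite -[leRHS]invrK.
  rewrite lef_pV2 ?posrE ?invr_gt0//; apply: ltW; near: n; apply: nearJ.
  exact: ltry.
Unshelve. all: by end_near. Qed.

(** The inverse of [a], infinite where [a] vanishes, has a finite integral, so
    [a] vanishes only on a null set. *)
Lemma harmonic_mean_gt0 (a : V -> R) (D : set (borel_rV R d)) :
  D = cell `&` [set y | 0 < a y] ->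
  periodic_C0 a -> (forall x, 0 <= a x) -> 0 < harmonic_mean_torus a ->
  [/\ measurable D, lam (cell `\` D) = 0%E,
      lam.-integrable D (EFin \o (fun y => (a y)^-1)) &
      \int[lam]_(y in D) (a y)^-1 = (harmonic_mean_torus a)^-1].
Proof.
move=> DE aC0 a0; have mcell := @measurable_unit_cell R d.
pose g (y : borel_rV R d) : \bar R := ((a y)%:E^-1)%E.
have gE y : g y = if a y == 0 then +oo%E else ((a y)^-1)%:E by rewrite /g inver.
have g0 y : (0 <= g y)%E by rewrite gE; case: ifP => // _; rewrite lee_fin invr_ge0.
have mg : measurable_fun (cell : set (borel_rV R d)) g by exact: measurable_inverse.
have mD : measurable D.
  rewrite DE; apply: measurableI => //; rewrite -[X in measurable X]setTI.
  rewrite (_ : [set y | 0 < a y] = a @^-1` `]0, +oo[%classic); last first.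
    by apply/seteqP; split => y /=; rewrite in_itv/= andbT.
  exact: (measurable_periodic_C0 aC0).
have J0 : (0 <= \int[lam]_(y in cell) g y)%E by exact: integral_ge0.
rewrite /harmonic_mean_torus; case JE : (\int[lam]_(y in cell) g y)%E J0 => [r||] // r0.
2: by rewrite invey ltxx.
rewrite inver; case: ifPn => [_|rn0 /= hm0]; first by rewrite ltxx.
have ig : lam.-integrable (cell : set (borel_rV R d)) g.
  apply/integrableP; split => //; under eq_integral do rewrite gee0_abs//.
  by rewrite JE ltry.
have N0 : lam (cell `\` D) = 0%E.
  apply: measure_negligible; first exact: measurableD.
  apply: negligibleS (integrable_ae mcell ig) => y /= [cy nD] /(_ cy).
  rewrite gE; case: eqVneq => // ay _; apply: nD; rewrite DE; split => //=.
  by rewrite lt_neqAle eq_sym ay a0.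
have DN : (cell : set (borel_rV R d)) `\` (cell `\` D) = D.
  by rewrite setDD; apply/seteqP; split => [y []//|y Dy]; split => //; move: Dy; rewrite DE => -[].
have gD y : y \in D -> g y = ((a y)^-1)%:E.
  by rewrite inE DE => -[_ /= ay]; rewrite gE gt_eqF.
have igD : lam.-integrable D (EFin \o (fun y => (a y)^-1)).
  apply: (eq_integrable mD g) => //.
  apply: integrableS ig => //.
  by rewrite DE => y [].
split => //.
have := negligible_integral (measurableD mcell mD) mcell ig N0.
rewrite JE DN (eq_integral _ _ gD) => /(congr1 fine) /= rE.
by rewrite invrK rE.
Qed.

End HarmonicMean.

(** * Limits of slowed fields *)

Section UniformLimits.
Context {R : realType} {d : nat}.
Local Notation V := 'rV[R]_d.

Lemma uniform_near (f_ : nat -> V -> R) (f : V -> R) : {uniform, f_ @ \oo --> f} ->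
  forall e : R, 0 < e -> \forall n \near \oo, forall x, `|f_ n x - f x| < e.
Proof.
move=> ff e e0.
suff /ff : nbhs (f : {uniform V -> R}) [set g | forall x, `|g x - f x| < e] by [].
apply/uniform_nbhs; exists [set xy | ball xy.1 e xy.2]; split.
  exact: (entourage_ball (R : pseudoMetricType R) (PosNum e0)).
by move=> g /= gf x; have := gf x I; rewrite /ball/= distrC.
Qed.

Lemma flow_cvg (B_ : nat -> V -> V) (B : V -> V) (K M : R) (t : R) (x : V) :
  (forall n, exists K' M', lipschitz_bounded (B_ n) K' M') ->
  lipschitz_bounded B K M ->
  (forall e : R, 0 < e -> \forall n \near \oo, forall z, `|B_ n z - B z| <= e) ->
  flow (B_ n) t x @[n --> \oo] --> flow B t x.
Proof.
move=> BnKM BKM BnB; have [K0 _ _ _] := BKM.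
apply/cvgrPdist_le => e e0.
have E0 : 0 < expR (2 * K * `|t|) by exact: expR_gt0.
have e'0 : 0 < e * K / expR (2 * K * `|t|) by rewrite divr_gt0// mulr_gt0.
apply: filterS (BnB _ e'0) => n nB; rewrite distrC.
have [K' [M' B'KM]] := BnKM n.
apply: le_trans (flow_perturbation t x x BKM B'KM nB) _.
rewrite subrr normr0 mulr0 add0r le_eqVlt; apply/orP; left; apply/eqP.
by field; rewrite !gt_eqF.
Qed.

End UniformLimits.

Section TimeChange.
Context {R : realType} {d : nat}.
Local Notation V := 'rV[R]_d.
Local Notation cell := (unit_cell R d).

(** If [B] has a single mean velocity [zeta], an invariant measure of the slowed
    field [w B] has a mean velocity proportional to [zeta]: its density [w],
    once normalised, gives an invariant measure of [B], unless [w] vanishes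
    almost everywhere. *)
Lemma vintegral_time_change (B : V -> V) (w : V -> R) (K M K' M' : R) (zeta : V)
    (mu : probability (borel_rV R d) R) :
  lipschitz_bounded B K M -> Zd_periodic B ->
  periodic_C0 w -> (forall x, 0 <= w x) ->
  lipschitz_bounded (fun x => w x *: B x) K' M' ->
  rotation_set B = [set zeta] ->
  invariant_probability (fun x => w x *: B x) mu ->
  vintegral mu (fun x => w x *: B x) = (\int[mu]_(y in cell) w y) *: zeta.
Proof.
move=> BKM pB wC0 w0 wBKM Bzeta muI; have mcell := @measurable_unit_cell R d.
have [_ M0 _ BM] := BKM.
set m := \int[mu]_(y in cell) w y.
have m0 : 0 <= m by apply: Rintegral_ge0 => // y _; exact: w0.
have iw : mu.-integrable cell (EFin \o w) by exact: periodic_C0_integrable.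
have wBE i : \int[mu]_(y in cell) (w y *: B y) 0 i = \int[mu]_(y in cell) (w y * B y 0 i).
  by apply: eq_Rintegral => y _; rewrite mxE.
have BC0 i : periodic_C0 (fun x => B x 0 i) by exact: periodic_C0_coord BKM pB.
case: (eqVneq m 0) => [m_eq0|mn0].
  apply/rowP => i; rewrite !mxE m_eq0 mul0r wBE; apply/eqP; rewrite -normr_le0.
  have wBC0 := periodic_C0_mul wC0 (BC0 i).
  apply: le_trans (le_normr_Rintegral mcell (periodic_C0_integrable mu wBC0)) _.
  have -> : 0 = \int[mu]_(y in cell) (M * w y) by rewrite RintegralZl// -/m m_eq0 mulr0.
  apply: le_Rintegral => //.
  - exact: (integrable_norm (periodic_C0_integrable mu wBC0)).
  - exact: (periodic_C0_integrable mu (periodic_C0_mul (periodic_C0_cst M) wC0)).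
  - move=> y _; rewrite normrM ger0_norm// mulrC ler_wpM2r//.
    exact: le_trans (norm_coord_le _ _) (BM y).
have mgt0 : 0 < m by rewrite lt_neqAle eq_sym mn0.
have posL := density_positive_functional mcell unit_cell_cube
  (fun x _ => w0 x) iw mgt0 (erefl m).
have [t psi psiC0|nu nuI nuE] := invariant_functional BKM pB posL.
  by congr (_ * _); exact: time_change_invariant BKM pB wC0 wBKM muI psiC0.
have : rotation_set B (vintegral nu B) by exists nu.
rewrite Bzeta => /= <-; apply/rowP => i; rewrite !mxE wBE nuE//.
by rewrite mulVKf.
Qed.

Lemma lebesgue_invariant_scale (s : V -> R) (Phi : V -> V) :
  periodic_C1 s -> periodic_C1 Phi ->
  (forall x, divergence (fun y => s y *: Phi y) x = 0) ->
  invariant_probability (fun y => s y *: Phi y) (lebesgue_torus R d).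
Proof.
move=> sC1 PhiC1 div0; have [psB [K [M BKM]]] := periodic_C1_scale sC1 PhiC1.
pose dB i x := 'D_(delta_mx 0 i) (fun y => (s y *: Phi y) 0 i) x.
have PC1 i := periodic_C1_coord i PhiC1.
have BE i : (fun y => (s y *: Phi y) 0 i) = (fun y => s y * Phi y 0 i).
  by apply/funext => y; rewrite mxE.
have ds x v : derivable s x v by apply: diff_derivable; exact: sC1.2.1.
have dP i x v : derivable (fun y => Phi y 0 i) x v.
  by apply: diff_derivable; exact: (PC1 i).2.1.
have dBE i x : dB i x = s x * 'D_(delta_mx 0 i) (fun y => Phi y 0 i) x +
    Phi x 0 i * 'D_(delta_mx 0 i) s x.
  by rewrite /dB BE deriveM.
apply: (liouville (dB := dB) BKM psB) => [i|i x|x]; last exact: div0.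
- split; first by apply: periodic_derive => x k; rewrite psB.
  rewrite (_ : dB i = fun x => s x * 'D_(delta_mx 0 i) (fun y => Phi y 0 i) x +
    Phi x 0 i * 'D_(delta_mx 0 i) s x); last by apply/funext => x; exact: dBE.
  have cs := periodic_C1_continuous sC1; have cP := periodic_C1_continuous (PC1 i).
  move=> x; apply: (@continuousD _ _ _
    (fun x => s x * 'D_(delta_mx 0 i) (fun y => Phi y 0 i) x)
    (fun x => Phi x 0 i * 'D_(delta_mx 0 i) s x)).
    exact: (continuous_mulf cs ((PC1 i).2.2 (delta_mx 0 i))).
  exact: (continuous_mulf cP (sC1.2.2 (delta_mx 0 i))).
- by apply: derivableP; rewrite BE; apply: derivableM.
Qed.

End TimeChange.

(** * The rotation set of the slowed field *)

Section Alternative.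
Context {R : realType} {d : nat}.
Local Notation V := 'rV[R]_d.
Local Notation lam := (lebesgue_torus R d).
Local Notation cell := (unit_cell R d).
Variables (rho : V -> R) (Phi : V -> V) (rho_ : nat -> V -> R) (sigma : V -> R).
Hypotheses (rho_C1 : periodic_C1 rho) (rho_ge0 : forall x, 0 <= rho x).
Hypothesis Phi_C1 : periodic_C1 Phi.
Hypotheses (rho_n_C1 : forall n, periodic_C1 (rho_ n))
  (rho_n_ge : forall n x, rho x <= rho_ n x)
  (rho_n_gt0 : forall n x, 0 < rho_ n x)
  (rho_n_cvg : {uniform, rho_ @ \oo --> rho}).
Hypothesis rotation_n : forall n, exists zeta_n : V,
  rotation_set (fun x => rho_ n x *: Phi x) = [set zeta_n].
Hypotheses (sigma_C1 : periodic_C1 sigma) (sigma_gt0 : forall x, 0 < sigma x).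
Hypothesis div_free : forall x, divergence (fun y => sigma y *: Phi y) x = 0.

Local Notation b := (fun x : V => rho x *: Phi x).
Local Notation b_ n := (fun x : V => rho_ n x *: Phi x).
Local Notation hm := (harmonic_mean_torus (fun x => rho x / sigma x)).
Local Notation v := (vintegral lam (fun y => sigma y *: Phi y)).

(** The total mass of the invariant measure of [b_ n] with density
    [sigma / rho_ n]. *)
Definition mass n : R := \int[lam]_(y in cell) (sigma y / rho_ n y).

Let periodic_C1_C0 (f : V -> R) : periodic_C1 f -> periodic_C0 f.
Proof. by move=> fC1; split; [exact: fC1.1|exact: periodic_C1_continuous]. Qed.

Let quotient_C0 (f g : V -> R) : periodic_C1 f -> periodic_C1 g ->
  (forall x, 0 < g x) -> periodic_C0 (fun x => f x / g x).
Proof.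
move=> fC1 gC1 g0; apply: periodic_C0_mul; first exact: periodic_C1_C0.
by apply: periodic_C0_inv => //; exact: periodic_C1_C0.
Qed.

Let rescale (f g : V -> R) : (forall x, 0 < g x) ->
  (fun x => f x / g x *: (g x *: Phi x)) = (fun x => f x *: Phi x).
Proof. by move=> g0; apply/funext => x; rewrite scalerA divfK// gt_eqF. Qed.

Let mass_gt0 n : 0 < mass n.
Proof.
apply: periodic_C0_Rintegral_gt0; first exact: quotient_C0.
by move=> x; rewrite divr_gt0.
Qed.

(** By Liouville's theorem the Lebesgue measure is invariant for [sigma Phi],
    which is [b_ n] slowed down by [sigma / rho_ n]. *)
Lemma rotation_velocity n : rotation_set (b_ n) = [set (mass n)^-1 *: v].
Proof.
have [zeta zetaE] := rotation_n n; rewrite zetaE; congr [set _].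
have [pb [K [M BKM]]] := periodic_C1_scale (rho_n_C1 n) Phi_C1.
have [_ [K' [M' sKM]]] := periodic_C1_scale sigma_C1 Phi_C1.
have lamI := lebesgue_invariant_scale sigma_C1 Phi_C1 div_free.
have := @vintegral_time_change _ _ (b_ n) (fun x => sigma x / rho_ n x)
  K M K' M' zeta lam BKM pb (quotient_C0 sigma_C1 (rho_n_C1 n) (@rho_n_gt0 n)).
rewrite rescale// => ->//.
  by rewrite scalerA mulVf ?scale1r// gt_eqF// mass_gt0.
by move=> x; rewrite divr_ge0// ltW.
Qed.

Lemma mass_cvg : (mass n)^-1 @[n --> \oo] --> hm.
Proof.
rewrite (_ : (fun n => _) = (fun n => (\int[lam]_(y in cell) (rho_ n y / sigma y)^-1)^-1)).
  apply: harmonic_mean_cvg => [|x|n|n x|n x|e e0].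
  - exact: quotient_C0.
  - by rewrite divr_ge0// ltW.
  - exact: quotient_C0.
  - by rewrite divr_gt0.
  - by rewrite ler_pM2r ?invr_gt0.
  - have sVC0 := periodic_C0_inv (periodic_C1_C0 sigma_C1) sigma_gt0.
    have [C C0 sC] := periodic_bounded sVC0.1 sVC0.2.
    have eC : 0 < e / C by rewrite divr_gt0.
    apply: filterS (uniform_near rho_n_cvg eC) => n near_rho x.
    rewrite -lerBlDl -mulrBl; apply: le_trans (_ : e / C * C <= e); last by rewrite divfK ?gt_eqF.
    apply: ler_pM; rewrite ?subr_ge0 ?invr_ge0 ?(ltW (sigma_gt0 x))//.
      exact: le_trans (ler_norm _) (ltW (near_rho x)).
    exact: le_trans (ler_norm _) (sC x).
apply/funext => n; congr (_^-1); apply: eq_Rintegral => y _.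
by rewrite invf_div.
Qed.

(** Slowing [b_ n] down to [b] multiplies mean velocities by a factor between
    [0] and [1], so every mean velocity of [b] is [c_ n *: v] with
    [0 <= c_ n <= (mass n)^-1]; unless [v] vanishes, [c_ n] is independent of
    [n] and the limit of these bounds applies to it. *)
Lemma rotation_set_sub z : rotation_set b z -> exists2 c, 0 <= c <= hm & z = c *: v.
Proof.
move=> [mu muI <-]; have mcell := @measurable_unit_cell R d.
have [_ [K [M BKM]]] := periodic_C1_scale rho_C1 Phi_C1.
pose m n := \int[mu]_(y in cell) (rho y / rho_ n y).
have wC0 n : periodic_C0 (fun x => rho x / rho_ n x) by exact: quotient_C0.
have w0 n x : 0 <= rho x / rho_ n x by rewrite divr_ge0// ltW.
have m0 n : 0 <= m n by apply: Rintegral_ge0.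
have m1 n : m n <= 1.
  apply: le_trans (ler_norm _) _; apply: Rintegral_norm_le => //.
    exact: measurable_funTS (measurable_periodic_C0 (wC0 n)).
  by move=> y _; rewrite ger0_norm// ler_pdivrMr ?mul1r.
have vE n : vintegral mu b = (m n / mass n) *: v.
  have [pb [K' [M' B'KM]]] := periodic_C1_scale (rho_n_C1 n) Phi_C1.
  have := @vintegral_time_change _ _ (b_ n) (fun x => rho x / rho_ n x)
    K' M' K M _ mu B'KM pb (wC0 n) (w0 n).
  rewrite rescale// => /(_ _ BKM (rotation_velocity n) muI) ->.
  by rewrite scalerA.
have c_le n : 0 <= m n / mass n <= (mass n)^-1.
  have mV : 0 <= (mass n)^-1 by rewrite invr_ge0 ltW.
  by rewrite mulr_ge0//= -[leRHS]mul1r ler_wpM2r.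
have hm0 : 0 <= hm by apply: cvgr_to_ge mass_cvg _; apply: nearW => n; rewrite invr_ge0 ltW.
have [v0|vn0] := eqVneq v 0.
  by exists 0; rewrite ?lexx ?hm0// (vE 0%N) v0 !scaler0.
exists (m 0%N / mass 0%N) => //; have /andP[-> _] := c_le 0%N.
apply: cvgr_to_ge mass_cvg _; apply: nearW => n.
suff -> : m 0%N / mass 0%N = m n / mass n by have /andP[] := c_le n.
apply/eqP; rewrite -subr_eq0.
have : (m 0%N / mass 0%N - m n / mass n) *: v = 0 by rewrite scalerBl -!vE subrr.
by move/eqP; rewrite scaler_eq0 (negbTE vn0) orbF.
Qed.

(** With a positive harmonic mean the measure of density [sigma / rho] is finite;
    it is carried by the set [D] where [rho] is positive. *)
Section PositiveMean.
Hypothesis hm_gt0 : 0 < hm.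
Local Notation D := ((cell : set (borel_rV R d)) `&` [set y | 0 < rho y / sigma y]).

Let Dfacts := harmonic_mean_gt0 (erefl D)
  (quotient_C0 rho_C1 sigma_C1 sigma_gt0)
  (fun x => divr_ge0 (rho_ge0 x) (ltW (sigma_gt0 x))) hm_gt0.

Let mD : measurable D. Proof. by have [] := Dfacts. Qed.

Let D_gt0 y : D y -> 0 < rho y.
Proof. by move=> [_ /=]; rewrite pmulr_lgt0// invr_gt0. Qed.

Let density_D : lam.-integrable D (EFin \o (fun y => sigma y / rho y)).
Proof.
have [_ _ iD _] := Dfacts.
by apply: (eq_integrable mD _ _ _ iD) => y _; rewrite /= invf_div.
Qed.

Let density_D_mass : \int[lam]_(y in D) (sigma y / rho y) = hm^-1.
Proof.
have [_ _ _ <-] := Dfacts.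
by apply: eq_Rintegral => y _; rewrite invf_div.
Qed.

Let Rintegral_D (f : V -> R) : periodic_C0 f ->
  \int[lam]_(y in cell) f y = \int[lam]_(y in D) f y.
Proof.
move=> fC0; have [_ N0 _ _] := Dfacts; have mcell := @measurable_unit_cell R d.
rewrite /Rintegral (negligible_integral (measurableD mcell mD) mcell _ N0).
  congr (fine (integral _ _ _)).
  by rewrite setDD; apply/seteqP; split => [y []//|y Dy]; split => //; case: Dy.
exact: periodic_C0_integrable.
Qed.

(** The measure of density [sigma / rho_ n] is invariant for [b_ n]. Dominated
    convergence passes to the limit, the densities being at most [sigma / rho]
    and the flows of [b_ n] converging to that of [b]. *)
Lemma density_invariant (t : R) (psi : V -> R) : periodic_C0 psi ->
  \int[lam]_(y in D) (sigma y / rho y * psi (flow b t y)) =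
  \int[lam]_(y in D) (sigma y / rho y * psi y).
Proof.
move=> psiC0; have [pb [K [M BKM]]] := periodic_C1_scale rho_C1 Phi_C1.
have [C C0 psiC] := periodic_bounded psiC0.1 psiC0.2.
have lamI := lebesgue_invariant_scale sigma_C1 Phi_C1 div_free.
have bnb (e : R) : 0 < e -> \forall n \near \oo, forall z, `|b_ n z - b z| <= e.
  have [_ [K' [M' [_ M'0 _ PhiM]]]] : Zd_periodic Phi /\
      exists K' M', lipschitz_bounded Phi K' M'.
    by split; [exact: Phi_C1.1|exact: periodic_C1_row_lipschitz_bounded].
  move=> e0; have eM : 0 < e / (M' + 1) by rewrite divr_gt0// ltr_wpDl.
  apply: filterS (uniform_near rho_n_cvg eM) => n near_rho z.
  rewrite -scalerBl normrZ; apply: le_trans (_ : e / (M' + 1) * (M' + 1) <= e).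
    apply: ler_pM => //; first exact: ltW.
    by apply: le_trans (PhiM z) _; rewrite lerDl.
  by rewrite divfK// gt_eqF// ltr_wpDl.
have rho_cvg y : rho_ n y @[n --> \oo] --> rho y.
  apply/cvgrPdist_lt => e e0; apply: filterS (uniform_near rho_n_cvg e0) => n.
  by rewrite distrC; exact.
have dens_cvg y : D y -> sigma y / rho_ n y @[n --> \oo] --> sigma y / rho y.
  by move=> /D_gt0 ry; apply: cvgMr; apply: cvgV => //; rewrite gt_eqF.
have dC0 n : periodic_C0 (fun y => sigma y / rho_ n y) by exact: quotient_C0.
have dom : lam.-integrable D (EFin \o (fun y => C * (sigma y / rho y))).
  exact: (integrableZl mD C density_D).
have limit (phi_ : nat -> V -> R) (phi : V -> R) :
    (forall n, periodic_C0 (phi_ n)) -> (forall n x, `|phi_ n x| <= C) ->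
    (forall x, phi_ n x @[n --> \oo] --> phi x) ->
    \int[lam]_(y in cell) (sigma y / rho_ n y * phi_ n y) @[n --> \oo] -->
    \int[lam]_(y in D) (sigma y / rho y * phi y).
  move=> phiC0 phiC phi_cvg; rewrite (_ : (fun n => _) = (fun n =>
    \int[lam]_(y in D) (sigma y / rho_ n y * phi_ n y))); last first.
    by apply/funext => n; apply: Rintegral_D; exact: periodic_C0_mul.
  refine (proj2 (@Rintegral_dominated _ _ _ lam D mD
    (fun n (y : borel_rV R d) => sigma y / rho_ n y * phi_ n y)
    (fun y => sigma y / rho y * phi y) _ _ _ dom _)) => [n|y Dy|n y Dy].
  - by apply: measurable_funTS; apply: measurable_periodic_C0; exact: periodic_C0_mul.
  - by apply: cvgM; [exact: dens_cvg|exact: phi_cvg].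
  - rewrite normrM mulrC; apply: ler_pM => //.
    rewrite ger0_norm ?divr_ge0 ?(ltW (sigma_gt0 y)) ?(ltW (rho_n_gt0 n y))//.
    by rewrite ler_pM2l// lef_pV2 ?posrE ?rho_n_gt0 ?(D_gt0 Dy).
have bnKM n := (periodic_C1_scale (rho_n_C1 n) Phi_C1).2.
have psi_cst x : psi x @[n --> \oo] --> psi x by exact: cvg_cst.
have := limit (fun n x => psi (flow (b_ n) t x)) (fun x => psi (flow b t x)).
have := limit (fun n => psi) psi (fun=> psiC0) (fun=> psiC) psi_cst.
rewrite (_ : (fun n => \int[lam]_(y in cell) (sigma y / rho_ n y * psi y)) = (fun n =>
  \int[lam]_(y in cell) (sigma y / rho_ n y * psi (flow (b_ n) t y)))); last first.
  apply/funext => n; have [pbn [Kn [Mn BnKM]]] := periodic_C1_scale (rho_n_C1 n) Phi_C1.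
  have [_ [K' [M' sKM]]] := periodic_C1_scale sigma_C1 Phi_C1.
  have := @time_change_invariant _ _ (b_ n) (fun x => sigma x / rho_ n x)
    Kn Mn K' M' lam t psi BnKM pbn (dC0 n).
  by rewrite rescale// => /(_ sKM lamI psiC0).
move=> lim1 lim2; rewrite -(cvg_lim (@Rhausdorff R) lim1); symmetry; apply: cvg_lim => //; apply: lim2 => [n|n x|x].
- have [pbn [Kn [Mn BnKM]]] := periodic_C1_scale (rho_n_C1 n) Phi_C1.
  exact: (periodic_C0_flow BnKM t pbn psiC0).
- exact: psiC.
- apply: (@cvg_comp _ _ _ (fun n => flow (b_ n) t x) psi); last exact: psiC0.2.
  exact: flow_cvg BKM bnb.
Qed.

(** The velocity is attained by a convex combination of the Dirac mass at a zero
    of [rho], which is at rest, and of the normalised measure of density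
    [sigma / rho], against which [b] integrates like [sigma Phi]. *)
Lemma rotation_set_sup (s : R) : (exists x, rho x = 0) -> 0 <= s <= 1 ->
  rotation_set b (s *: (hm *: v)).
Proof.
move=> [x0 rx0] s01; have [pb [K [M BKM]]] := periodic_C1_scale rho_C1 Phi_C1.
pose z := frac_row x0.
have bz : b z = 0 by rewrite (periodic_frac x0 rho_C1.1) rx0 scale0r.
have Dcube : D `<=` unit_cube by move=> y [/unit_cell_cube].
have w0 (x : borel_rV R d) : D x -> 0 <= sigma x / rho x.
  by move=> _; rewrite divr_ge0// ltW.
have hmV0 : 0 < hm^-1 by rewrite invr_gt0.
have posL := convex_positive_functional s01
  (eval_positive_functional (unit_cell_cube (frac_row_unit_cell x0)))
  (density_positive_functional mD Dcube w0 density_D hmV0 density_D_mass).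
have [t psi psiC0|mu muI muE] := invariant_functional BKM pb posL.
  by rewrite (flow_fixed BKM bz) density_invariant.
exists mu => //; apply/rowP => i; rewrite !mxE muE; last exact: periodic_C0_coord BKM pb.
rewrite -/z bz mxE mulr0 add0r invrK; congr (_ * (_ * _)).
have [psP [K' [M' sKM]]] := periodic_C1_scale sigma_C1 Phi_C1.
rewrite (Rintegral_D (periodic_C0_coord i sKM psP)); apply: eq_Rintegral => y.
rewrite inE => /D_gt0 ry; rewrite !mxE mulrA divfK// gt_eqF//.
Qed.

End PositiveMean.

End Alternative.

Theorem corollary3p3 (R : realType) (d : nat)
    (rho : 'rV[R]_d -> R) (Phi : 'rV[R]_d -> 'rV[R]_d)
    (rho_C1 : periodic_C1 rho) (rho_ge0 : forall x, 0 <= rho x)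
    (rho_neq0 : exists x, rho x <> 0)
    (Phi_C1 : periodic_C1 Phi) (Phi_neq0 : forall x, Phi x <> 0)
    (rho_ : nat -> 'rV[R]_d -> R)
    (rho_n_C1 : forall n, periodic_C1 (rho_ n))
    (rho_n_ge : forall n x, rho x <= rho_ n x)
    (rho_n_gt0 : forall n x, 0 < rho_ n x)
    (rho_n_cvg : {uniform, rho_ @ \oo --> rho})
    (rotation_n : forall n, exists zeta_n : 'rV[R]_d,
      rotation_set (fun x => rho_ n x *: Phi x) = [set zeta_n])
    (sigma : 'rV[R]_d -> R)
    (sigma_C1 : periodic_C1 sigma) (sigma_gt0 : forall x, 0 < sigma x)
    (div_free : forall x, divergence (fun y => sigma y *: Phi y) x = 0)
    (rho_vanishes : exists x, rho x = 0) :
  let b : 'rV[R]_d -> 'rV[R]_d := fun x => rho x *: Phi x in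
  let hm := harmonic_mean_torus (fun x => rho x / sigma x) in
  (hm = 0 ->
    forall x : 'rV[R]_d, t^-1 *: flow b t x @[t --> +oo%R] --> (0 : 'rV[R]_d)) /\
  (0 < hm ->
    let zeta := hm *: vintegral (lebesgue_torus R d)
                  (fun y => sigma y *: Phi y) in
    rotation_set b = [set s *: zeta | s in `[0, 1]]).
Proof.
move=> b hm; have sub := rotation_set_sub rho_C1 rho_ge0 Phi_C1 rho_n_C1 rho_n_ge
  rho_n_gt0 rho_n_cvg rotation_n sigma_C1 sigma_gt0 div_free.
split=> [hm0 x|hm0 zeta].
  have [pb [K [M BKM]]] := periodic_C1_scale rho_C1 Phi_C1.
  apply: rotation0_mean_velocity BKM pb _ => y /sub[c].
  by rewrite -/hm hm0 => /le_anti <- ->; rewrite scale0r.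
apply/seteqP; split => [y /sub[c /andP[c0 ch] ->]|_ [s s01 <-]].
  exists (c / hm); last by rewrite scalerA divfK ?gt_eqF.
  by rewrite /= in_itv/= divr_ge0 ?(ltW hm0)//= ler_pdivrMr// mul1r.
apply: (rotation_set_sup rho_C1 rho_ge0 Phi_C1 rho_n_C1 rho_n_ge rho_n_gt0
  rho_n_cvg sigma_C1 sigma_gt0 div_free hm0 rho_vanishes).
by move: s01; rewrite /= in_itv.
Qed.
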